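(* Let $S$ be a regular monoid with finitely many left ideals and finitely many right ideals. Then $S$ has finite derivation type if and only if every maximal subgroup of $S$ has finite derivation type.
   Context: A semigroup $S$ is regular if for every $x\in S$ there is $y\in S$ with $xyx=x$. The maximal subgroups of $S$ are the $\mathcal H$-classes (Green's relation) of $S$ containing an idempotent. Having finitely many left and right ideals is equivalent to having finitely many $\mathcal L$-classes and finitely many $\mathcal R$-classes. Presentations. For an alphabet $A$ let $A^*$, $A^+$ be the free monoid and free semigroup on $A$; $u\equiv v$ means equality as words. A semigroup presentation is $\langle A\mid R\rangle$ with $R\subseteq A^+\times A^+$; a rule is $r=(r_{+1},r_{-1})\in R$. It defines the semigroup $A^+/\!\leftrightarrow_R^*$, where $\leftrightarrow_R^*$ is the congruence generated by $R$. It is finite if $A$ and $R$ are finite. Derivation graph. The derivation graph $\Gamma=\Gamma(\mathcal P)$ of $\mathcal P=\langle A\mid R\rangle$ has vertex set $A^+$ and edges $\mathbb E=(w_1,r,\epsilon,w_2)$ with $w_1,w_2\in A^*$, $r\in R$, $\epsilon\in\{+1,-1\}$; $\iota\mathbb E\equiv w_1r_{\epsilon}w_2$, $\tau\mathbb E\equiv w_1r_{-\epsilon}w_2$, $\mathbb E^{-1}=(w_1,r,-\epsilon,w_2)$. Paths are sequences of composable edges, including an empty path $1_w$ at each vertex $w$; $P(\Gamma)$ is the set of all paths; $\iota,\tau,{}^{-1}$ extend to paths. For $x,y\in A^*$, $x\cdot(w_1,r,\epsilon,w_2)\cdot y=(xw_1,r,\epsilon,w_2y)$, extended edgewise to paths.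 Paths with the same initial and the same terminal vertices are parallel, written $\parallel$. A homotopy relation is an equivalence relation $\sim$ on $P(\Gamma)$ contained in $\parallel$ such that: (H1) $(\mathbb E_1\cdot\iota\mathbb E_2)(\tau\mathbb E_1\cdot\mathbb E_2)\sim(\iota\mathbb E_1\cdot\mathbb E_2)(\mathbb E_1\cdot\tau\mathbb E_2)$ for all edges $\mathbb E_1,\mathbb E_2$; (H2) $\mathbb P\sim\mathbb Q$ implies $x\cdot\mathbb P\cdot y\sim x\cdot\mathbb Q\cdot y$ for all $x,y\in A^*$; (H3) $\mathbb P\sim\mathbb Q$ implies $\mathbb R\mathbb P\mathbb S\sim\mathbb R\mathbb Q\mathbb S$ whenever the compositions are defined; (H4) $\mathbb P\mathbb P^{-1}\sim 1_{\iota\mathbb P}$ for every path. For $C\subseteq\,\parallel$, $\sim_C$ is the smallest homotopy relation containing $C$; $C$ is a homotopy base if $\sim_C\,=\,\parallel$. A presentation has finite derivation type (FDT) if its derivation graph has a finite homotopy base. A finitely presented semigroup (or monoid) has FDT if some finite semigroup presentation defining it has FDT; it is known that then every finite presentation of it does, and that for monoids using monoid or semigroup presentations gives the same notion. Having FDT includes being finitely presented. *)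

(* Defs.v *)
From mathcomp Require Import all_boot all_classical.

Set Implicit Arguments.
Unset Strict Implicit.
Unset Printing Implicit Defensive.

Local Open Scope classical_set_scope.

Definition regular_semigroup (S : semigroupType) : Prop :=
  forall x : S, exists y : S, (x * y * x)%g = x.

Definition left_ideal (S : semigroupType) (I : set S) : Prop :=
  I !=set0 /\ forall s x : S, I x -> I (s * x)%g.

Definition right_ideal (S : semigroupType) (I : set S) : Prop :=
  I !=set0 /\ forall s x : S, I x -> I (x * s)%g.

(* Green's relations are defined through S^1, and S^1 = S on a monoid. *)
Definition greenL (S : monoidType) (x y : S) : Prop :=
  range (fun s : S => (s * x)%g) = range (fun s : S => (s * y)%g).

Definition greenR (S : monoidType) (x y : S) : Prop :=
  range (fun s : S => (x * s)%g) = range (fun s : S => (y * s)%g).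

Definition greenH (S : monoidType) (x y : S) : Prop :=
  greenL x y /\ greenR x y.

Definition maximal_subgroup (S : monoidType) (H : set S) : Prop :=
  exists e : S, (e * e)%g = e /\ H = [set x | greenH x e].

(* The free monoid on A is seq A; the free semigroup is its subset Aplus. *)
Definition Aplus (A : Type) : set (seq A) := [set w | w <> [::]].
Arguments Aplus : clear implicits.

Record presentation := Presentation {
  letter : Type;
  rules : set (seq letter * seq letter);
  rules_Aplus : rules `<=` Aplus letter `*` Aplus letter
}.

Definition finite_presentation (P : presentation) : Prop :=
  finite_set [set: letter P] /\ finite_set (@rules P).

Record congruence (A : Type) (c : seq A -> seq A -> Prop) : Prop := {
  cong_dom : forall u v, c u v -> Aplus A u /\ Aplus A v;
  cong_refl : forall u, Aplus A u -> c u u;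
  cong_sym : forall u v, c u v -> c v u;
  cong_trans : forall u v w, c u v -> c v w -> c u w;
  cong_mull : forall w u v, Aplus A w -> c u v -> c (w ++ u) (w ++ v);
  cong_mulr : forall w u v, Aplus A w -> c u v -> c (u ++ w) (v ++ w)
}.

Definition rules_cong (P : presentation) (u v : seq (letter P)) : Prop :=
  forall c, congruence c -> (forall r, rules r -> c r.1 r.2) -> c u v.

(* P defines T: the map phi (irrelevant on the empty word) induces an
   isomorphism from the semigroup A^+ / rules_cong P onto T.  A subset T for
   which this holds is automatically a subsemigroup of S. *)
Definition defines (P : presentation) (S : semigroupType) (T : set S) : Prop :=
  exists phi : seq (letter P) -> S,
    [/\ forall u v, Aplus _ u -> Aplus _ v -> phi (u ++ v) = (phi u * phi v)%g,
        forall u v, Aplus _ u -> Aplus _ v -> (phi u = phi v <-> rules_cong u v)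
      & phi @` Aplus (letter P) = T].

(* The sign is true for +1 and false for -1. *)
Record edge (A : Type) := Edge {
  eleft : seq A;
  erule : seq A * seq A;
  esign : bool;
  eright : seq A
}.

(* A path is its initial vertex with its list of edges, so that there is an
   empty path at every vertex; is_edge and is_path below single out the actual
   edges and paths of the derivation graph. *)
Record gpath (A : Type) := GPath { pstart : seq A; pedges : seq (edge A) }.

Section Words.
Variable A : Type.
Implicit Types (e : edge A) (p q : gpath A) (x y : seq A).

Definition rule_side (r : seq A * seq A) (b : bool) : seq A :=
  if b then r.1 else r.2.

Definition esrc e : seq A := eleft e ++ rule_side (erule e) (esign e) ++ eright e.
Definition etgt e : seq A := eleft e ++ rule_side (erule e) (~~ esign e) ++ eright e.
Definition einv e : edge A := Edge (eleft e) (erule e) (~~ esign e) (eright e).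
Definition eact x e y : edge A :=
  Edge (x ++ eleft e) (erule e) (esign e) (eright e ++ y).

Definition psrc p : seq A := pstart p.
Definition ptgt p : seq A := last (pstart p) (map etgt (pedges p)).
Definition pempty x : gpath A := GPath x [::].
Definition pedge e : gpath A := GPath (esrc e) [:: e].
Definition pinv p : gpath A := GPath (ptgt p) (rev (map einv (pedges p))).
Definition pact x p y : gpath A :=
  GPath (x ++ pstart p ++ y) [seq eact x e y | e <- pedges p].

(* Meaningful when ptgt p = psrc q. *)
Definition pcomp p q : gpath A := GPath (pstart p) (pedges p ++ pedges q).

End Words.

Section DerivationGraph.
Variable P : presentation.
Local Notation A := (letter P).
Implicit Types (e : edge A) (p q : gpath A).

Definition is_edge e : Prop := rules (erule e).

Fixpoint composable (w : seq A) (es : seq (edge A)) : Prop :=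
  if es is e :: es' then [/\ is_edge e, esrc e = w & composable (etgt e) es']
  else True.

Definition is_path p : Prop := Aplus A (pstart p) /\ composable (pstart p) (pedges p).

Definition parallel p q : Prop :=
  [/\ is_path p, is_path q, psrc p = psrc q & ptgt p = ptgt q].

Record homotopy_relation (sim : gpath A -> gpath A -> Prop) : Prop := {
  hom_parallel : forall p q, sim p q -> parallel p q;
  hom_refl : forall p, is_path p -> sim p p;
  hom_sym : forall p q, sim p q -> sim q p;
  hom_trans : forall p q r, sim p q -> sim q r -> sim p r;
  hom_H1 : forall e1 e2, is_edge e1 -> is_edge e2 ->
    sim (pcomp (pact [::] (pedge e1) (esrc e2)) (pact (etgt e1) (pedge e2) [::]))
        (pcomp (pact (esrc e1) (pedge e2) [::]) (pact [::] (pedge e1) (etgt e2)));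
  hom_H2 : forall x y p q, sim p q -> sim (pact x p y) (pact x q y);
  hom_H3 : forall r s p q, is_path r -> is_path s ->
    ptgt r = psrc p -> ptgt p = psrc s -> sim p q ->
    sim (pcomp (pcomp r p) s) (pcomp (pcomp r q) s);
  hom_H4 : forall p, is_path p -> sim (pcomp p (pinv p)) (pempty (psrc p))
}.

Definition homotopy_gen (C : set (gpath A * gpath A)) p q : Prop :=
  forall sim, homotopy_relation sim -> (forall a b, C (a, b) -> sim a b) -> sim p q.

Definition homotopy_base (C : set (gpath A * gpath A)) : Prop :=
  (forall p q, C (p, q) -> parallel p q) /\
  (forall p q, homotopy_gen C p q <-> parallel p q).

Definition presentation_fdt : Prop :=
  exists C : set (gpath A * gpath A), finite_set C /\ homotopy_base C.

End DerivationGraph.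

(* Finite derivation type of the subsemigroup T of S; T = [set: S] is S itself. *)
Definition has_fdt (S : semigroupType) (T : set S) : Prop :=
  exists P : presentation,
    [/\ finite_presentation P, defines P T & presentation_fdt P].

(* Main.v *)
Require Import Defs.
From mathcomp Require Import all_boot all_classical.

Set Implicit Arguments.
Unset Strict Implicit.
Unset Printing Implicit Defensive.

Local Open Scope classical_set_scope.

(** Given a homotopy relation, call a set of words coherent if parallel paths
    through these words are homotopic.  A finite presentation has finite
    derivation type when finitely many homotopies force the set of all words to be
    coherent.  The main tool is [scan_coherent]: if words are evaluated from left
    to right by a device whose states are words, then coherence reduces to a
    statement about single letters and single relations, and when those are
    finite in number only finitely many homotopies have to be imposed.

    From the monoid to a maximal subgroup, the H-class of an idempotent [e].
    Since there are finitely many left ideals, the R-class of [e] consists of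
    finitely many right cosets of the subgroup, and the Reidemeister-Schreier
    method gives a finite presentation whose letters are the pairs of a coset and
    a letter of the monoid.  Reading words of the monoid from the coset of [e]
    translates paths to paths, and a finite homotopy base has finitely many
    translates ([transducer_coherent]).  Each letter of the subgroup is equal to
    the translate of a word of the monoid; replacing letters by these translates
    carries any path of the subgroup to a translated one at the cost of one
    homotopy for each relation ([subgroup_fdt]).

    From the maximal subgroups to the monoid.  There are finitely many two-sided
    ideals, and it is enough to pass from a maximal proper ideal [K] of an ideal
    [I], possibly empty, to [I] ([ideal_fdt]).  The elements of [I] outside [K]
    form a single J-class, and because there are finitely many one-sided ideals
    and the monoid is regular, each of them is uniquely [x i * g * y k] with [i]
    and [k] in finite sets and [g] in a maximal subgroup [H]
    ([layer_coordinates]).  A presentation of [I] is obtained from those of [K]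
    and [H] by adding the letters [x i] and [y k] and the products of two letters
    ([layer_pres]).

    For the homotopies, words are absorbed by the letters of [K] that they
    contain.  A word that begins with such a letter is absorbed from left to right
    ([Bfirst_coherent]), and reversal takes care of words that end with one
    ([Blast_coherent]).  If the letter is in the middle, both can be done in either
    order: as [K] is regular, its elements have words of length at least two, so
    the two absorptions can be made to act on disjoint factors ([Bin_coherent]).
    All other words are scanned: as long as the value stays outside [K] the state
    is [x i] followed by a word of [H] and by [y k], and the next letter involves
    [y k] only; once the value falls into [K] the state has a letter of [K], and
    the previous cases apply.  So finitely many homotopies, one for each [y k] and
    each relation, suffice in addition to those of [K] and [H] ([layer_fdt]). *)


(** * Paths of the derivation graph *)

(** One-sided actions.  Unlike the two-sided action they leave no trailing
    empty word behind, so that the laws below are plain rewriting rules. *)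
Section PathActions.
Variable A : Type.
Implicit Types (x y : seq A) (p q : seq (edge A)).

Definition lact x p := [seq Edge (x ++ eleft e) (erule e) (esign e) (eright e) | e <- p].
Definition ract p y := [seq Edge (eleft e) (erule e) (esign e) (eright e ++ y) | e <- p].
Definition pathinv p := rev (map (@einv A) p).

End PathActions.
Arguments lact : simpl never.
Arguments ract : simpl never.

Reserved Notation "x >* p" (at level 58, right associativity).
Reserved Notation "p *< y" (at level 48, left associativity).
Local Notation "x >* p" := (lact x p).
Local Notation "p *< y" := (ract p y).

Section PathActionsTheory.
Variable A : Type.
Implicit Types (x y : seq A) (p q : seq (edge A)).

Lemma lact_cat x p q : x >* (p ++ q) = x >* p ++ x >* q.
Proof. exact: map_cat. Qed.

Lemma ract_cat p q y : (p ++ q) *< y = p *< y ++ q *< y.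
Proof. exact: map_cat. Qed.

Lemma lact0 p : [::] >* p = p.
Proof. by rewrite /lact /ract; elim: p => //= [[l r s t] p ->]. Qed.

Lemma ract0 p : p *< [::] = p.
Proof. by rewrite /lact /ract; elim: p => //= [[l r s t] p ->] /=; rewrite cats0. Qed.

Lemma lactM x y p : (x ++ y) >* p = x >* y >* p.
Proof. by rewrite /lact /ract; elim: p => //= [[l r s t] p ->] /=; rewrite catA. Qed.

Lemma ractM p x y : p *< (x ++ y) = p *< x *< y.
Proof. by rewrite /lact /ract; elim: p => //= [[l r s t] p ->] /=; rewrite catA. Qed.

Lemma lract x p y : (x >* p) *< y = x >* p *< y.
Proof. by rewrite /lact /ract; elim: p => //= e p ->. Qed.

Lemma eact_lract x p y : [seq eact x e y | e <- p] = x >* p *< y.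
Proof. by rewrite /lact /ract; elim: p => //= e p ->. Qed.

End PathActionsTheory.

Section Paths.
Variable P : presentation.
Local Notation word := (seq (letter P)).
Implicit Types (u v w x y : word) (p q : seq (edge (letter P))) (W : word -> Prop).

(** All vertices of the path are required to satisfy [W]: coherence is proved
    for larger and larger full subgraphs of the derivation graph. *)
Fixpoint pth W u p v : Prop :=
  if p is e :: p' then [/\ rules (erule e), esrc e = u, W u & pth W (etgt e) p' v]
  else [/\ W u, u <> [::] & u = v].

Definition anyword u := True.

Lemma rule_side_neq0 (r : word * word) b : rules r -> rule_side r b <> [::].
Proof. by case/rules_Aplus=> ? ?; case: b. Qed.

Lemma esrc_neq0 e : rules (erule e) -> esrc e <> [::] :> word.
Proof.
move=> /(@rule_side_neq0 _ (esign e)); rewrite /esrc.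
by case: (eleft e) => //=; case: rule_side.
Qed.

Lemma pth_src W u p v : pth W u p v -> W u /\ u <> [::].
Proof. by case: p => [[]|e p [/esrc_neq0 + <- ? _]]. Qed.

Lemma pth_tgt W u p v : pth W u p v -> W v /\ v <> [::].
Proof. by elim: p u => [|e p IH] u /= [] // => [? ? <-|_ _ _ /IH]. Qed.

Lemma pth_nil W u : W u -> u <> [::] -> pth W u [::] u.
Proof. by []. Qed.

Lemma pth_cat W u p v q w : pth W u p v -> pth W v q w -> pth W u (p ++ q) w.
Proof. by elim: p u => [|e p IH] u /= [] // => [? ? <-|? ? ? /IH H /H]. Qed.

Lemma pth_sub W W' u p v : (forall w, W w -> W' w) -> pth W u p v -> pth W' u p v.
Proof.
move=> WW'; elim: p u => [|e p IH] u /= []; first by move=> /WW'.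
by move=> ? ? /WW' ? /IH.
Qed.

Lemma pth_any W u p v : pth W u p v -> pth anyword u p v.
Proof. exact: pth_sub. Qed.

Lemma pth_lact W W' x u p v : (forall w, W w -> W' (x ++ w)) ->
  pth W u p v -> pth W' (x ++ u) (x >* p) (x ++ v).
Proof.
move=> WW'; rewrite /lact /ract; elim: p u => [|e p IH] u /= [].
  by move=> /WW' ? u0 <-; split=> //; case: (x).
by move=> ? <- /WW' ? /IH; rewrite /esrc /etgt /= -!catA.
Qed.

Lemma pth_ract W W' u p v y : (forall w, W w -> W' (w ++ y)) ->
  pth W u p v -> pth W' (u ++ y) (p *< y) (v ++ y).
Proof.
move=> WW'; rewrite /lact /ract; elim: p u => [|e p IH] u /= [].
  by move=> /WW' ? u0 <-; split=> //; case: (u) u0.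
by move=> ? <- /WW' + /IH; rewrite /esrc /etgt /= -!catA.
Qed.

Lemma pthl x W u p v : pth W u p v -> pth anyword (x ++ u) (x >* p) (x ++ v).
Proof. exact: pth_lact. Qed.

Lemma pthr y W u p v : pth W u p v -> pth anyword (u ++ y) (p *< y) (v ++ y).
Proof. exact: pth_ract. Qed.

Lemma pth_edge W l r b t : rules r -> W (l ++ rule_side r b ++ t) ->
  W (l ++ rule_side r (~~ b) ++ t) ->
  pth W (l ++ rule_side r b ++ t) [:: Edge l r b t] (l ++ rule_side r (~~ b) ++ t).
Proof.
move=> rr ? ?; split=> //; split=> //.
exact: (@esrc_neq0 (Edge l r (~~ b) t)).
Qed.

Lemma pth_inv W u p v : pth W u p v -> pth W v (pathinv p) u.
Proof.
elim: p u => [|[l r b t] p IH] u /=; first by case=> ? ? <-.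
case=> rr <- Wu H; have [Wt _] := pth_src H.
rewrite /pathinv /= rev_cons -cats1; apply: pth_cat (IH _ H) _.
by have := @pth_edge W l r (~~ b) t rr; rewrite negbK; apply.
Qed.

Lemma pth_is_path W u p v : pth W u p v -> is_path (GPath u p) /\ ptgt (GPath u p) = v.
Proof.
move=> H; have [_ u0] := pth_src H; rewrite /is_path /ptgt /=.
suff: composable u p /\ last u (map (@etgt _) p) = v by case.
elim: p u H {u0} => [|e p IH] u /=; first by case.
by case=> ? <- _ /IH[? <-].
Qed.

Lemma is_path_pth (p : gpath (letter P)) : is_path p ->
  pth anyword (psrc p) (pedges p) (ptgt p).
Proof.
case: p => u p [/= u0]; rewrite /ptgt /=.
elim: p u u0 => [|e p IH] u u0 //= [? <- ?]; split=> //; apply: IH => //.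
exact: (@esrc_neq0 (einv e)).
Qed.

Definition connected u v := exists p, pth anyword u p v.

Lemma connected_refl u : u <> [::] -> connected u u.
Proof. by exists [::]. Qed.

Lemma connected_sym u v : connected u v -> connected v u.
Proof. by case=> p /pth_inv; eexists; eassumption. Qed.

Lemma connected_trans v u w : connected u v -> connected v w -> connected u w.
Proof. by move=> [p ?] [q ?]; exists (p ++ q); apply: pth_cat; eassumption. Qed.

Lemma connected_catl x u v : connected u v -> connected (x ++ u) (x ++ v).
Proof. by case=> p ?; exists (x >* p); apply: pth_lact; last eassumption. Qed.

Lemma connected_catr y u v : connected u v -> connected (u ++ y) (v ++ y).
Proof. by case=> p ?; exists (p *< y); apply: pth_ract; last eassumption. Qed.

Lemma connected_rule r : rules r -> connected r.1 r.2.
Proof.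
move=> rr; exists [:: Edge [::] r true [::]].
by have := @pth_edge anyword [::] r true [::] rr I I; rewrite /= !cats0.
Qed.

(** Being joined by a path is a congruence containing the rules, and it is
    contained in every such congruence. *)
Lemma rules_congE u v : rules_cong u v <-> connected u v.
Proof.
split=> [H|[p]].
  apply: (H (@connected)); last exact: connected_rule.
  split=> //.
  - by move=> {H}u {}v [p H]; split; [case: (pth_src H)|case: (pth_tgt H)].
  - exact: connected_refl.
  - exact: connected_sym.
  - by move=> a b c; apply: connected_trans.
  - by move=> w a b _; apply: connected_catl.
  - by move=> w a b _; apply: connected_catr.
elim: p u => [|[l r b t] p IH] u /=; first by case=> _ ? <- c cc _; apply: cong_refl.
case=> rr <- _ /IH{IH}H c cc cr; apply: cong_trans (H c cc cr) => // {H}.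
have {rr}cr : c (rule_side r b) (rule_side r (~~ b)).
  by case: b => /=; [apply: cr|apply: cong_sym => //; apply: cr].
have {}cr : c (rule_side r b ++ t) (rule_side r (~~ b) ++ t).
  case: t => [|a t]; first by rewrite !cats0.
  exact: cong_mulr.
by rewrite /esrc /etgt; case: l => [|a l] //; apply: (cong_mull cc (w := a :: l)).
Qed.

(** ** Homotopy of paths with a common start *)

Section Homotopy.
Variable sim : gpath (letter P) -> gpath (letter P) -> Prop.
Definition heq u p q := sim (GPath u p) (GPath u q).

Hypothesis simH : homotopy_relation sim.

Lemma heq_refl W u p v : pth W u p v -> heq u p p.
Proof. by case/pth_is_path=> + _; apply: hom_refl simH _. Qed.

Lemma heq_sym u p q : heq u p q -> heq u q p.
Proof. exact: (hom_sym simH). Qed.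

Lemma heq_trans u q p r : heq u p q -> heq u q r -> heq u p r.
Proof. exact: (hom_trans simH). Qed.

Lemma heq_pth u p q : heq u p q ->
  exists v, pth anyword u p v /\ pth anyword u q v.
Proof.
case/(hom_parallel simH)=> /is_path_pth ? /is_path_pth + _ e.
by rewrite -e; eexists; split; eassumption.
Qed.

Lemma heq_ctx W W' u r v p q s v' w : pth W u r v -> heq v p q ->
  pth W' v' s w -> pth anyword v p v' -> heq u (r ++ p ++ s) (r ++ q ++ s).
Proof.
move=> /pth_is_path[rp rt] H /pth_is_path[sp st] /pth_is_path[_ pt].
by have := @hom_H3 _ _ simH (GPath u r) (GPath v' s) (GPath v p) (GPath v q)
  rp sp rt pt H; rewrite /Defs.pcomp /= -!catA.
Qed.

Lemma heq_catl W u r v p q : pth W u r v -> heq v p q -> heq u (r ++ p) (r ++ q).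
Proof.
move=> rp H; have [v' [pp _]] := heq_pth H; have [_ v0] := pth_tgt pp.
by have := heq_ctx rp H (@pth_nil anyword v' I v0) pp; rewrite !cats0.
Qed.

Lemma heq_catr W W' u p q v s w : heq u p q -> pth W u p v -> pth W' v s w ->
  heq u (p ++ s) (q ++ s).
Proof.
move=> H pp sp; have [_ u0] := pth_src pp.
exact: (heq_ctx (@pth_nil anyword u I u0) H sp (pth_any pp)).
Qed.

Lemma heq_lact x u p q : heq u p q -> heq (x ++ u) (x >* p) (x >* q).
Proof.
move=> /(hom_H2 simH x [::]).
by rewrite /heq /pact /= !eact_lract !ract0 !cats0.
Qed.

Lemma heq_ract y u p q : heq u p q -> heq (u ++ y) (p *< y) (q *< y).
Proof.
move=> /(hom_H2 simH [::] y).
by rewrite /heq /pact /= !eact_lract !lact0.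
Qed.

Lemma heq_inv W u p v : pth W u p v -> heq u (p ++ pathinv p) [::].
Proof.
move=> H; have [pp _] := pth_is_path H.
exact: (hom_H4 simH pp).
Qed.

Lemma heq_Kinv W W' u p v s w : pth W u p v -> pth W' u s w ->
  heq u (p ++ pathinv p ++ s) s.
Proof.
move=> /pth_any pp sp; rewrite catA.
exact: heq_catr (heq_inv pp) (pth_cat pp (pth_inv pp)) sp.
Qed.

Lemma heq_rcancel W W' u p q v s w : pth W u p v -> pth W u q v -> pth W' v s w ->
  heq u (p ++ s) (q ++ s) -> heq u p q.
Proof.
move=> /pth_any pp /pth_any qp /pth_any sp H.
have cancel r : pth anyword u r v -> heq u (r ++ s ++ pathinv s) r.
  by move=> rp; have := heq_catl rp (heq_inv sp); rewrite cats0.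
apply: heq_trans (heq_sym (cancel p pp)) _; apply: heq_trans (cancel q qp).
rewrite !catA; apply: heq_catr (H) _ (pth_inv sp); exact: pth_cat pp sp.
Qed.

(** This extends (H1) from edges to paths, one edge at a time. *)
Lemma heq_xchg W W' u p u' v q v' : pth W u p u' -> pth W' v q v' ->
  heq (u ++ v) (p *< v ++ u' >* q) (u >* q ++ p *< v').
Proof.
move=> /pth_any pp /pth_any qp.
have one e f : rules (erule e) -> rules (erule f) ->
    heq (esrc e ++ esrc f) ([:: e] *< esrc f ++ etgt e >* [:: f])
                           (esrc e >* [:: f] ++ [:: e] *< etgt f).
  move=> re rf; have := hom_H1 simH re rf.
  by rewrite /heq /Defs.pcomp /pact /pedge /= /eact /= !cats0 ?lact0.
elim: p u pp => [|e p IHp] u pp.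
  case: pp => _ _ <-; rewrite cats0.
  apply: heq_refl; exact: pthl qp.
case: pp => re <- _ pp.
have ep : pth anyword (esrc e) [:: e] (etgt e) by split=> //; case: (pth_src pp).
have {IHp} := IHp _ pp => IHp.
have step : heq (esrc e ++ v) ([:: e] *< v ++ etgt e >* q) (esrc e >* q ++ [:: e] *< v').
  elim: q v qp {IHp} => [|f q IHq] v qp.
    case: qp => _ _ <-; rewrite [etgt e >* _](_ : _ = [::]) // cats0.
    apply: heq_refl; exact: (pthr v ep).
  case: qp => rf <- _ qp.
  have fp : pth anyword (esrc f) [:: f] (etgt f) by split=> //; case: (pth_src qp).
  rewrite -[f :: q]cat1s !lact_cat.
  apply: (@heq_trans _ ((esrc e >* [:: f] ++ [:: e] *< etgt f) ++ etgt e >* q)).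
    rewrite catA; apply: heq_catr (one e f re rf) _ (pthl _ qp).
    apply: pth_cat (pthr _ ep) (pthl _ fp).
  rewrite -[X in heq _ X]catA -[X in heq _ _ X]catA.
  apply: heq_catl (pthl _ fp) _; exact: IHq.
rewrite -[e :: p]cat1s !ract_cat -[X in heq _ X]catA.
apply: (@heq_trans _ ([:: e] *< v ++ etgt e >* q ++ p *< v')).
  exact: heq_catl (pthr _ ep) IHp.
rewrite !catA; apply: heq_catr (step) _ (pthr _ pp).
exact: pth_cat (pthr _ ep) (pthl _ qp).
Qed.

(** Modulo [sim], every component of the full subgraph on [W] is simply
    connected.  For [W] the set of all words this says that [sim] is the
    parallelism relation. *)
Definition coherent W := forall u p q v, pth W u p v -> pth W u q v -> heq u p q.

End Homotopy.
End Paths.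
Arguments anyword {P} u.


(** * Properties forced by finitely many parallel pairs *)

Section FinitelyForced.
Variable P : presentation.
Local Notation relation := (gpath (letter P) -> gpath (letter P) -> Prop).
Implicit Types (phi psi : relation -> Prop) (C : set (gpath (letter P) * gpath (letter P))).

Lemma parallelP (p q : gpath (letter P)) : parallel p q <->
  psrc p = psrc q /\
  exists v, pth anyword (psrc p) (pedges p) v /\ pth anyword (psrc p) (pedges q) v.
Proof.
split=> [[/is_path_pth pp /is_path_pth qp e f]|[]].
  by split=> //; exists (ptgt p); split=> //; rewrite e f.
case: p q => [u p] [u' q] /= <- [v [/pth_is_path[? <-] /pth_is_path[? ?]]].
by split.
Qed.

(** Parallelism is the largest homotopy relation, so one inclusion in the
    definition of a homotopy base is automatic. *)
Lemma parallel_homotopy : homotopy_relation (@parallel P).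
Proof.
split=> //.
- by move=> p q [].
- by move=> p q r [? ? e f] [? ? e' f']; split; rewrite // (e, f).
- move=> e f re rf; apply/parallelP; split; first by rewrite /psrc /= cats0.
  have ep : pth anyword (esrc e) [:: e] (etgt e).
    by split=> //; split=> //; apply: (@esrc_neq0 P (einv e)).
  have fp : pth anyword (esrc f) [:: f] (etgt f).
    by split=> //; split=> //; apply: (@esrc_neq0 P (einv f)).
  exists (etgt e ++ etgt f); split.
    have := pth_cat (pthr (esrc f) ep) (pthl (etgt e) fp).
    by rewrite /lact /ract /=/eact cats0.
  have := pth_cat (pthl (esrc e) fp) (pthr (etgt f) ep).
  by rewrite /lact /ract /=/eact cats0.
- move=> x y p q /parallelP[e [v [pp qp]]]; apply/parallelP.
  rewrite /psrc in e pp qp *; split; first by rewrite /= e.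
  exists (x ++ v ++ y); rewrite /= !eact_lract.
  by split; apply: pthl; apply: pthr; eassumption.
- move=> [u r] [w s] [v p] [v' q] rp sp + + /parallelP[/= e [v'' [pp qp]]].
  rewrite /psrc /= in e pp qp *; rewrite -{}e => rv pw.
  have := is_path_pth rp; rewrite rv /psrc /= => {}rp.
  have [_ pv] := pth_is_path pp; rewrite -{}pw {}pv in sp.
  have := is_path_pth sp; rewrite /psrc /= => {}sp.
  apply/parallelP; split=> //; eexists; split; rewrite /psrc /=.
    exact: pth_cat (pth_cat rp pp) sp.
  exact: pth_cat (pth_cat rp qp) sp.
- move=> [u p] /is_path_pth pp; apply/parallelP; split=> //; exists u.
  split; first exact: pth_cat pp (pth_inv pp).
  by have [] := pth_src pp.
Qed.

(** Finite derivation type is this property for the coherence of all words.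
    Finite conjunctions preserve it, so a finite homotopy base can be assembled
    from the finitely many homotopies that a proof of coherence requests. *)
Definition finitely_forced phi := exists C,
  [/\ finite_set C, forall p q, C (p, q) -> parallel p q &
    forall sim, homotopy_relation sim ->
      (forall p q, C (p, q) -> sim p q) -> phi sim].

Lemma finitely_forced_sub phi psi :
  (forall sim, homotopy_relation sim -> phi sim -> psi sim) ->
  finitely_forced phi -> finitely_forced psi.
Proof. by move=> H [C [? ? Cphi]]; exists C; split=> // sim ? ?; apply/H/Cphi. Qed.

Lemma finitely_forcedT : finitely_forced (fun=> True).
Proof. by exists set0. Qed.

Lemma finitely_forced_all T (X : set T) (phi : T -> relation -> Prop) :
  finite_set X -> (forall x, X x -> finitely_forced (phi x)) ->
  finitely_forced (fun sim => forall x, X x -> phi x sim).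
Proof.
move=> finX H.
have /choice[C CP] : forall x, exists C, X x -> [/\ finite_set C,
    forall p q, C (p, q) -> parallel p q &
    forall sim, homotopy_relation sim ->
      (forall p q, C (p, q) -> sim p q) -> phi x sim].
  by move=> x; have [/H[C HC]|nX] := pselect (X x); [exists C|exists set0].
exists (\bigcup_(x in X) C x); split.
- by apply: bigcup_finite => // x /CP[].
- by move=> p q [x /CP[_ H' _] /H'].
- by move=> sim hs sC x Xx; have [_ _ H'] := CP x Xx; apply: H' => // p q ?; apply: sC; exists x.
Qed.

Lemma finitely_forced_and phi psi : finitely_forced phi -> finitely_forced psi ->
  finitely_forced (fun sim => phi sim /\ psi sim).
Proof.
move=> Hphi Hpsi; pose chi (b : bool) := if b then phi else psi.
have : finitely_forced (fun sim => forall b, [set: bool] b -> chi b sim).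
  by apply: finitely_forced_all => [|[] _] //; apply: finite_finset.
by apply: finitely_forced_sub => sim _ H; split; [apply: (H true)|apply: (H false)].
Qed.

Lemma finitely_forced_heq W W' u p q v : pth W u p v -> pth W' u q v ->
  finitely_forced (fun sim => heq sim u p q).
Proof.
move=> pp qp; exists [set (GPath u p, GPath u q)]; split.
- exact: finite_set1.
- move=> _ _ [-> ->]; apply/parallelP; split=> //; exists v.
  by split; [exact: pth_any pp|exact: pth_any qp].
- by move=> sim _; apply.
Qed.

Lemma finitely_forced_fdt :
  finitely_forced (fun sim => coherent sim anyword) -> presentation_fdt P.
Proof.
case=> C [finC Cpar CH]; exists C; split=> //; split=> // p q.
split=> [H|]; first by apply: H => //; exact: parallel_homotopy.
case: p q => [u p] [u' q] /parallelP[]; rewrite /psrc /= => <- [v [pp qp]] sim hs Csim.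
exact: (CH sim hs Csim) pp qp.
Qed.

End FinitelyForced.

(** * Coherence by scanning words from left to right *)

(** A scanner reads a word letter by letter and keeps a state [N] which stands
    for a word [wd N]; each step comes with a path
    [wd N ++ [:: a] -> wd (step N a)].  The states play the part of normal
    forms, but they need not be unique: the paths [inner N p N'] connect
    different states for the same element, and parallel inner paths are known to
    be homotopic.  If an edge never changes the result of scanning by more than
    an inner path, then every path is homotopic to an inner path up to the
    evaluations of its two ends.  Since the scanner processes prefixes first,
    this has to be checked only for inner paths followed by one letter
    ([step_inner]), for relations after a state ([run_rule]) and for relations
    at the beginning of a word ([eval_rule]). *)

Section Scan.
Variable P : presentation.
Local Notation word := (seq (letter P)).
Local Notation edges := (seq (edge (letter P))).
Variables (sim : gpath (letter P) -> gpath (letter P) -> Prop) (simH : homotopy_relation sim).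

Variables (T : Type) (ok : T -> Prop) (wd : T -> word).
Variables (inner : T -> edges -> T -> Prop).
Variables (start : letter P -> Prop) (init : letter P -> T) (initp : letter P -> edges).
Variables (step : T -> letter P -> T) (stepp : T -> letter P -> edges).

Definition run := foldl step.

Fixpoint runp N z : edges :=
  if z is a :: z' then stepp N a *< z' ++ runp (step N a) z' else [::].

Lemma runp_cons N a z : runp N (a :: z) = stepp N a *< z ++ runp (step N a) z.
Proof. by []. Qed.

Definition starting (w : word) := if w is a :: _ then start a else False.

Definition eval w N p := if w is a :: z then
  N = run (init a) z /\ p = initp a *< z ++ runp (init a) z else False.

Hypothesis wd_neq0 : forall N, ok N -> wd N <> [::].
Hypothesis ok_init : forall a, start a -> ok (init a).
Hypothesis ok_step : forall N a, ok N -> ok (step N a).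
Hypothesis initP : forall a, start a -> pth anyword [:: a] (initp a) (wd (init a)).
Hypothesis stepP : forall N a, ok N ->
  pth anyword (wd N ++ [:: a]) (stepp N a) (wd (step N a)).

Hypothesis innerP : forall N p N', inner N p N' -> pth anyword (wd N) p (wd N').
Hypothesis inner_nil : forall N, ok N -> inner N [::] N.
Hypothesis inner_cat : forall N p N' q N'', inner N p N' -> inner N' q N'' ->
  inner N (p ++ q) N''.
Hypothesis inner_coherent : forall N p q N', inner N p N' -> inner N q N' ->
  heq sim (wd N) p q.

Hypothesis step_inner : forall N p N' a, ok N -> ok N' -> inner N p N' ->
  exists2 q, inner (step N a) q (step N' a) &
    heq sim (wd N ++ [:: a]) (p *< [:: a] ++ stepp N' a) (stepp N a ++ q).

Hypothesis run_rule : forall N r b, ok N -> rules r ->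
  exists2 q, inner (run N (rule_side r b)) q (run N (rule_side r (~~ b))) &
    heq sim (wd N ++ rule_side r b)
      (Edge (wd N) r b [::] :: runp N (rule_side r (~~ b)))
      (runp N (rule_side r b) ++ q).

Hypothesis eval_rule : forall r b N p N' p', rules r ->
  starting (rule_side r b) -> starting (rule_side r (~~ b)) ->
  eval (rule_side r b) N p -> eval (rule_side r (~~ b)) N' p' ->
  exists2 q, inner N q N' &
    heq sim (rule_side r b) (Edge [::] r b [::] :: p') (p ++ q).

Lemma ok_run N z : ok N -> ok (run N z).
Proof. by elim: z N => //= a z IH N /(@ok_step _ a)/IH. Qed.

Lemma pth_run N z : ok N -> pth anyword (wd N ++ z) (runp N z) (wd (run N z)).
Proof.
elim: z N => [|a z IH] N okN /=; first by rewrite cats0; split=> //; apply: wd_neq0.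
rewrite -cat1s catA; apply: pth_cat (IH _ (ok_step a okN)).
by apply: pthr; exact: stepP.
Qed.

Lemma run_cat N z z' : run N (z ++ z') = run (run N z) z'.
Proof. exact: foldl_cat. Qed.

Lemma runp_cat N z z' : runp N (z ++ z') = runp N z *< z' ++ runp (run N z) z'.
Proof. by elim: z N => //= a z IH N; rewrite IH ractM ract_cat catA. Qed.

Lemma pth_eval w N p : starting w -> eval w N p -> ok N /\ pth anyword w p (wd N).
Proof.
case: w => // a z /= sa [-> ->]; have oka := ok_init sa.
split; first exact: ok_run.
apply: pth_cat (pth_run z oka).
by rewrite -cat1s; apply: pthr; exact: initP.
Qed.

Lemma run_inner N p N' z : ok N -> ok N' -> inner N p N' ->
  exists2 q, inner (run N z) q (run N' z) &
    heq sim (wd N ++ z) (p *< z ++ runp N' z) (runp N z ++ q).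
Proof.
elim: z N p N' => [|a z IH] N p N' okN okN' pI /=.
  by exists p => //; rewrite !cats0 ract0; apply: heq_refl (innerP pI).
have [q qI Hq] := step_inner a okN okN' pI.
have [q' qI' Hq'] := IH _ _ _ (ok_step a okN) (ok_step a okN') qI.
exists q' => //; rewrite -[a :: z]cat1s catA ractM.
apply: (@heq_trans _ _ simH _ ((stepp N a *< z ++ q *< z) ++ runp (step N' a) z)).
  rewrite catA -!ract_cat.
  apply: (heq_catr simH) (heq_ract simH z Hq) _ (pth_run z (ok_step a okN')).
  apply: pthr.
  by apply: pth_cat (stepP a okN'); apply: pthr; exact: innerP.
rewrite -!catA; apply: (heq_catl simH) Hq'.
by rewrite catA; apply: pthr; apply: stepP.
Qed.

Lemma run_edge N r b t : ok N -> rules r ->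
  exists2 q, inner (run N (rule_side r b ++ t)) q (run N (rule_side r (~~ b) ++ t)) &
    heq sim (wd N ++ rule_side r b ++ t)
      (Edge (wd N) r b t :: runp N (rule_side r (~~ b) ++ t))
      (runp N (rule_side r b ++ t) ++ q).
Proof.
move=> okN rr; have [q qI Hq] := run_rule b okN rr.
have okb c := ok_run (rule_side r c) okN.
have [q' qI' Hq'] := run_inner t (okb b) (okb (~~ b)) qI.
exists q'; rewrite ?run_cat // !runp_cat.
apply: (@heq_trans _ _ simH _
  ((runp N (rule_side r b) *< t ++ q *< t) ++ runp (run N (rule_side r (~~ b))) t)).
  have De : [:: Edge (wd N) r b t] = [:: Edge (wd N) r b [::]] *< t by [].
  rewrite (catA (wd N)) -cat1s De (catA ([:: _] *< t)) -!ract_cat.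
  apply: (heq_catr simH) (heq_ract simH t Hq) _ (pth_run t (okb (~~ b))).
  apply: pthr.
  rewrite -cat1s; apply: pth_cat (pth_run (rule_side r (~~ b)) okN).
  by have := @pth_edge _ anyword (wd N) _ b [::] rr I I; rewrite !cats0.
rewrite -!catA; apply: (heq_catl simH) Hq'.
by rewrite catA; apply: pthr; apply: pth_run.
Qed.

(** The evaluation of the prefix [l] acts on other letters than the relation,
    so the two commute and the case of a relation after a state applies. *)
Lemma eval_edge l r b t N p N' p' : rules r ->
  starting (l ++ rule_side r b ++ t) -> starting (l ++ rule_side r (~~ b) ++ t) ->
  eval (l ++ rule_side r b ++ t) N p -> eval (l ++ rule_side r (~~ b) ++ t) N' p' ->
  exists2 q, inner N q N' &
    heq sim (l ++ rule_side r b ++ t) (Edge l r b t :: p') (p ++ q).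
Proof.
move=> rr; case: l => [|a l] /=.
  have side c : starting (rule_side r c ++ t) ->
      exists N p, [/\ starting (rule_side r c), eval (rule_side r c) N p &
      forall N' p', eval (rule_side r c ++ t) N' p' ->
        N' = run N t /\ p' = p *< t ++ runp N t].
    case Dr: (rule_side r c) => [|x z] sx /=; first by case: (rule_side_neq0 rr Dr).
    do 2 eexists; split=> // N0 p0 [-> ->].
    by rewrite run_cat runp_cat ractM !ract_cat catA.
  move=> /side[M [q [sb ev Hb]]] /side[M' [q' [snb ev' Hnb]]] /Hb[-> ->] /Hnb[-> ->].
  have [s sI Hs] := eval_rule rr sb snb ev ev'.
  have [okM qp] := pth_eval sb ev; have [okM' qp'] := pth_eval snb ev'.
  have [s' sI' Hs'] := run_inner t okM okM' sI.
  exists s' => //.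
  apply: (@heq_trans _ _ simH _ ((q *< t ++ s *< t) ++ runp M' t)).
    have De : [:: Edge [::] r b t] = [:: Edge [::] r b [::]] *< t by [].
    rewrite -cat1s De (catA ([:: _] *< t)) -!ract_cat.
    apply: (heq_catr simH) (heq_ract simH t Hs) _ (pth_run t okM').
    apply: pthr.
    apply: (@pth_cat _ _ _ [:: _] _ _ _ _ qp').
    by have := @pth_edge _ anyword [::] _ b [::] rr I I; rewrite !cats0.
  rewrite -!catA; apply: (heq_catl simH) Hs'.
  by apply: pthr; exact: qp.
move=> sa _ [-> ->] [-> ->].
rewrite !(run_cat (init a) l) !(runp_cat (init a) l).
have oka := ok_init sa; set M := run (init a) l.
have okM : ok M := ok_run l oka.
have [s sI Hs] := run_edge b t okM rr; exists s => //.
set q := initp a *< l ++ runp (init a) l.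
have qp : pth anyword (a :: l) q (wd M).
  apply: pth_cat (pth_run l oka).
  by rewrite -cat1s; apply: pthr; apply: initP.
pose e := [:: Edge [::] r b t].
have ep : pth anyword (rule_side r b ++ t) e (rule_side r (~~ b) ++ t).
  exact: (@pth_edge _ anyword [::] _ b t rr I I).
have X := heq_xchg simH qp ep.
have E c : initp a *< (l ++ rule_side r c ++ t) ++
    runp (init a) l *< (rule_side r c ++ t) ++ runp M (rule_side r c ++ t) =
    q *< (rule_side r c ++ t) ++ runp M (rule_side r c ++ t).
  by rewrite ractM [q *< _]ract_cat !catA.
rewrite !E -(catA (q *< _)); set R := runp M _; set R' := runp M _.
have De : [:: Edge (a :: l) r b t] = (a :: l) >* e by rewrite /lact /= cats0.
rewrite -[Edge _ _ _ _ :: _]cat1s De (catA (_ >* e)).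
apply: (@heq_trans _ _ simH _ ((q *< (rule_side r b ++ t) ++ wd M >* e) ++ R)).
  apply: heq_sym => //; apply: (heq_catr simH X) (pth_run _ okM).
  apply: pth_cat (pthr _ qp) (pthl _ ep).
rewrite -catA; apply: (heq_catl simH) (pthr _ qp) _.
rewrite -[wd M >* e]/([:: Edge _ _ _ _]) cats0.
exact: Hs.
Qed.

Lemma starting_eval w : starting w -> exists N p, eval w N p.
Proof. by case: w => // a z _; do 2 eexists; split. Qed.

Lemma eval_inj w N p N' p' : eval w N p -> eval w N' p' -> N = N' /\ p = p'.
Proof. by case: w => // a z [-> ->] [-> ->]. Qed.

Lemma eval_pth u p v N q N' q' : pth starting u p v -> eval u N q -> eval v N' q' ->
  exists2 s, inner N s N' & heq sim u (p ++ q') (q ++ s).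
Proof.
elim: p u N q => [|[l r b t] p IH] u N q.
  case=> su _ <- ev /(eval_inj ev)[<- <-]; have [okN pq] := pth_eval su ev.
  by exists [::]; [exact: inner_nil|rewrite cats0; apply: heq_refl pq].
case=> rr <- su pp ev ev'; have [sw _] := pth_src pp.
have [M [m evM]] := starting_eval sw.
have [s sI Hs] := IH _ _ _ pp evM ev'.
have [s' sI' Hs'] := eval_edge rr su sw ev evM.
have [okN qp] := pth_eval su ev; have [okM mp] := pth_eval sw evM.
have ep : pth anyword (l ++ rule_side r b ++ t) [:: Edge l r b t]
                      (l ++ rule_side r (~~ b) ++ t) by apply: pth_edge.
exists (s' ++ s); first exact: inner_cat sI' sI.
apply: (@heq_trans _ _ simH _ ([:: Edge l r b t] ++ m ++ s)).
  exact: (heq_catl simH ep Hs).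
rewrite !catA; apply: (heq_catr simH Hs') (innerP sI).
exact: pth_cat ep mp.
Qed.

(** Every path [u -> v] is carried by the evaluations of [u] and [v] to an
    inner path, and parallel inner paths are homotopic. *)
Lemma scan_coherent : coherent sim starting.
Proof.
move=> u p q v pp qp.
have [su _] := pth_src pp; have [sv _] := pth_tgt pp.
have [N [s ev]] := starting_eval su; have [N' [s' ev']] := starting_eval sv.
have [m mI Hm] := eval_pth pp ev ev'; have [n nI Hn] := eval_pth qp ev ev'.
have [okN sp] := pth_eval su ev; have [_ sp'] := pth_eval sv ev'.
apply: (heq_rcancel simH pp qp sp').
apply: (heq_trans simH Hm); apply: heq_sym => //; apply: (heq_trans simH Hn).
by apply: (heq_catl simH sp); apply: inner_coherent nI mI.
Qed.

End Scan.


(** * Transporting homotopies along letter-to-letter transducers *)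

(** A transducer reads a word over one alphabet and writes a word of the same
    length over another.  Its action on edges is defined letter by letter as
    well; the right context is read in the state reached after the first side
    of the rule, which is also the state after the second side when the
    transducer respects the rules. *)
Section TransducerDefs.
Variables (A A' T : Type) (next : T -> A -> T) (out : T -> A -> A').

Definition move := foldl next.

Fixpoint trans t w := if w is a :: w' then out t a :: trans (next t a) w' else [::].

Definition trans_edge t e :=
  let t' := move t (eleft e) in
  Edge (trans t (eleft e)) (trans t' (erule e).1, trans t' (erule e).2) (esign e)
       (trans (move t' (erule e).1) (eright e)).

Lemma trans_cat t u v : trans t (u ++ v) = trans t u ++ trans (move t u) v.
Proof. by elim: u t => //= a u IH t; rewrite IH. Qed.

Lemma move_cat t u v : move t (u ++ v) = move (move t u) v.
Proof. exact: foldl_cat. Qed.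

Lemma trans_neq0 t u : u <> [::] -> trans t u <> [::].
Proof. by case: u. Qed.

End TransducerDefs.

Section Transducer.
Variables (P Q : presentation) (T : Type) (live : T -> Prop).
Variables (next : T -> letter P -> T) (out : T -> letter P -> letter Q).
Local Notation move := (move next).
Local Notation trans := (trans next out).
Local Notation trans_edge := (trans_edge next out).

Hypothesis live_move : forall t a, live (next t a) -> live t.
Hypothesis move_rule : forall t r, rules r -> move t r.1 = move t r.2.
Hypothesis trans_rule : forall t r, rules r -> live (move t r.1) ->
  rules (trans t r.1, trans t r.2).

Lemma live_prefix t u v : live (move t (u ++ v)) -> live (move t u).
Proof.
by elim/last_ind: v => [|v a IH]; rewrite ?cats0 // -rcons_cat /move foldl_rcons => /live_move.
Qed.

Lemma move_side t r b : rules r -> move t (rule_side r b) = move t r.1.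
Proof. by case: b => // /(@move_rule t). Qed.

Lemma trans_side t r b : trans t (rule_side r b) = rule_side (trans t r.1, trans t r.2) b.
Proof. by case: b. Qed.

Lemma esrc_trans t e : rules (erule e) -> esrc (trans_edge t e) = trans t (esrc e).
Proof. by move=> re; rewrite /esrc !trans_cat /= move_side // trans_side. Qed.

Lemma etgt_trans t e : rules (erule e) -> etgt (trans_edge t e) = trans t (etgt e).
Proof. by move=> re; rewrite /etgt !trans_cat /= move_side // trans_side. Qed.

Lemma move_edge t e : rules (erule e) -> move t (esrc e) = move t (etgt e).
Proof. by move=> re; rewrite /esrc /etgt !move_cat !move_side. Qed.

Lemma trans_edge_rule t e : rules (erule e) -> live (move t (esrc e)) ->
  rules (erule (trans_edge t e)).
Proof.
move=> re; rewrite /esrc catA => /live_prefix; rewrite move_cat move_side //.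
exact: trans_rule.
Qed.

Lemma move_pth W t u p v : pth W u p v -> move t u = move t v.
Proof.
elim: p u => [|e p IH] u; first by case=> _ _ <-.
by case=> re <- _ /IH <-; apply: move_edge.
Qed.

Lemma trans_pth W t u p v : pth W u p v -> live (move t u) ->
  pth anyword (trans t u) (map (trans_edge t) p) (trans t v).
Proof.
elim: p u => [|e p IH] u; first by case=> _ u0 <- _; split=> //; apply: trans_neq0.
case=> re <- _ pp lu; split=> //; [exact: trans_edge_rule|exact: esrc_trans|].
by rewrite etgt_trans //; apply: IH => //; rewrite -move_edge.
Qed.

Lemma trans_lact t x p :
  map (trans_edge t) (x >* p) = trans t x >* map (trans_edge (move t x)) p.
Proof.
rewrite /lact -!map_comp; apply: eq_map => e.
by rewrite /trans_edge /= move_cat trans_cat.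
Qed.

Lemma trans_ract W t u p v y : pth W u p v ->
  map (trans_edge t) (p *< y) = map (trans_edge t) p *< trans (move t u) y.
Proof.
elim: p u => // e p IH u [re <- _ pp].
rewrite -[e :: p]cat1s ract_cat !map_cat ract_cat (IH _ pp) -move_edge //.
congr (_ ++ _); rewrite /ract /= /trans_edge /= /esrc trans_cat !move_cat.
by rewrite move_side.
Qed.

Section Pullback.
Variable sim : gpath (letter Q) -> gpath (letter Q) -> Prop.
Hypothesis simH : homotopy_relation sim.

Definition pullback (p q : gpath (letter P)) := parallel p q /\
  forall t, live (move t (psrc p)) -> heq sim (trans t (psrc p))
    (map (trans_edge t) (pedges p)) (map (trans_edge t) (pedges q)).

(** Translation is compatible with composition, with inversion and with the
    actions of words, so it carries each of (H1)-(H4) to an instance of the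
    same law. *)
Lemma pullback_homotopy : homotopy_relation pullback.
Proof.
have parH := parallel_homotopy P.
split.
- by move=> p q [].
- move=> p pp; split=> [|t lt]; first exact: (hom_refl parH).
  by apply: (heq_refl simH); apply: trans_pth (is_path_pth pp) lt.
- move=> p q [pq H]; split=> [|t]; first exact: (hom_sym parH).
  by case: pq => _ _ <- _ lt; apply: heq_sym => //; apply: H.
- move=> p q r [pq H] [qr H']; split=> [|t lt]; first exact: (hom_trans parH) pq qr.
  apply: (heq_trans simH (H t lt)); case: pq lt H' => _ _ -> _ lt H'; exact: H'.
- move=> e f re rf; split; first exact: (hom_H1 parH).
  have ep : pth anyword (esrc e) [:: e] (etgt e).
    by split=> //; split=> //; apply: (@esrc_neq0 P (einv e)).
  have fp : pth anyword (esrc f) [:: f] (etgt f).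
    by split=> //; split=> //; apply: (@esrc_neq0 P (einv f)).
  move=> t.
  have -> : pedges (Defs.pcomp (pact [::] (pedge e) (esrc f)) (pact (etgt e) (pedge f) [::]))
      = [:: e] *< esrc f ++ etgt e >* [:: f] by rewrite /lact /ract /= /eact cats0.
  have -> : pedges (Defs.pcomp (pact (esrc e) (pedge f) [::]) (pact [::] (pedge e) (etgt f)))
      = esrc e >* [:: f] ++ [:: e] *< etgt f by rewrite /lact /ract /= /eact cats0.
  rewrite [psrc _](_ : _ = esrc e ++ esrc f) // => lt.
  have le : live (move t (esrc e)) by apply: live_prefix lt.
  have lf : live (move (move t (esrc e)) (esrc f)) by rewrite -move_cat.
  rewrite !map_cat !trans_lact (trans_ract t (esrc f) ep) (trans_ract t (etgt f) ep).
  rewrite (trans_cat next out t (esrc e) (esrc f)) -(move_edge t re).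
  exact: (heq_xchg simH (trans_pth ep le) (trans_pth fp lf)).
- move=> x y p q [pq H]; split; first exact: (hom_H2 parH).
  move=> t; rewrite /pact /psrc /= !eact_lract -/(psrc p) => lt.
  have lu : live (move (move t x) (psrc p)) by move: lt; rewrite catA -move_cat => /live_prefix.
  have [u [v [pp qp]]] : psrc p = psrc q /\ exists v, pth anyword (psrc p) (pedges p) v /\
    pth anyword (psrc p) (pedges q) v by apply/parallelP.
  rewrite !trans_lact (trans_ract _ _ pp) (trans_ract _ _ qp) !trans_cat.
  by apply: (heq_lact simH); apply: (heq_ract simH); apply: H.
- move=> r s p q rp sp rt pt [pq H]; split; first exact: (hom_H3 parH).
  move=> t; rewrite /Defs.pcomp /psrc /= => lt.
  have [u [v [pp qp]]] : psrc p = psrc q /\ exists v, pth anyword (psrc p) (pedges p) v /\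
    pth anyword (psrc p) (pedges q) v by apply/parallelP.
  have {}rp := is_path_pth rp; have {}sp := is_path_pth sp.
  rewrite rt in rp; rewrite -pt in sp.
  have lp : live (move t (psrc p)) by rewrite -(move_pth t rp).
  have ptv : ptgt p = v := (pth_is_path pp).2.
  rewrite ptv in sp; rewrite !map_cat -!catA.
  apply: (heq_ctx simH (trans_pth rp lt) (H t lp) (trans_pth sp _) (trans_pth pp lp)).
  by rewrite -(move_pth t pp).
- move=> p pp; split=> [|t lt]; first exact: (hom_H4 parH).
  have := heq_inv simH (trans_pth (is_path_pth pp) lt).
  by rewrite /Defs.pcomp /Defs.pinv /psrc /= map_cat /pathinv map_rev -!map_comp.
Qed.

End Pullback.

(** The homotopies between translated paths are all consequences of the
    translates, in finitely many states, of a finite homotopy base. *)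
Lemma transducer_coherent : finite_set [set: T] -> presentation_fdt P ->
  finitely_forced (fun sim => forall t u p q v, pth anyword u p v -> pth anyword u q v ->
    live (move t u) ->
    heq sim (trans t u) (map (trans_edge t) p) (map (trans_edge t) q)).
Proof.
move=> finT [C [finC [Cpar CB]]].
pose phi (c : gpath (letter P) * gpath (letter P)) (t : T) sim :=
  live (move t (psrc c.1)) -> heq sim (trans t (psrc c.1))
    (map (trans_edge t) (pedges c.1)) (map (trans_edge t) (pedges c.2)).
have : finitely_forced (fun sim => forall c, C c -> forall t, [set: T] t -> phi c t sim).
  apply: finitely_forced_all => // -[a b] /Cpar/parallelP[_ [v [pa pb]]].
  apply: finitely_forced_all => // t _.
  have [lt|nlt] := pselect (live (move t (psrc a))).
    have := finitely_forced_heq (trans_pth pa lt) (trans_pth pb lt).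
    by apply: finitely_forced_sub => sim _ H _.
  by apply: finitely_forced_sub (finitely_forcedT _) => sim _ _ /nlt.
apply: finitely_forced_sub => sim simH H t u p q v pp qp lt.
have par : parallel (GPath u p) (GPath u q) by apply/parallelP; split=> //; exists v.
have [] := (CB (GPath u p) (GPath u q)).2 par _ (pullback_homotopy simH).
  by move=> a b Cab; split; [exact: Cpar|move=> s; apply: H Cab s I].
by move=> _ /(_ t lt).
Qed.

End Transducer.


(** ** Relabelling *)

Section Relabelling.
Variables (P Q : presentation) (f : letter P -> letter Q).

Definition relabel e := Edge (map f (eleft e)) (map f (erule e).1, map f (erule e).2)
  (esign e) (map f (eright e)).

Definition relabel_coherent sim := forall u p q v, pth anyword u p v -> pth anyword u q v ->
  heq sim (map f u) (map relabel p) (map relabel q).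

Lemma relabel_lact x p : map relabel (x >* p) = map f x >* map relabel p.
Proof. by rewrite /lact -!map_comp; apply: eq_map => e; rewrite /relabel /= map_cat. Qed.

Lemma relabel_ract p y : map relabel (p *< y) = map relabel p *< map f y.
Proof. by rewrite /ract -!map_comp; apply: eq_map => e; rewrite /relabel /= map_cat. Qed.

Lemma map_rule_side (r : seq (letter P) * seq (letter P)) b :
  map f (rule_side r b) = rule_side (map f r.1, map f r.2) b.
Proof. by case: b. Qed.

Hypothesis f_rule : forall r, rules r -> rules (map f r.1, map f r.2).

(* A relabelling is a transducer with a single state. *)
Let next (_ : unit) (_ : letter P) := tt.
Let out (_ : unit) := f.

Let trans_map t w : trans next out t w = map f w.
Proof. by elim: w t => //= a w IH t; rewrite IH. Qed.

Let trans_relabel t e : trans_edge next out t e = relabel e.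
Proof. by rewrite /trans_edge !trans_map. Qed.

Let next_rule t (r : seq (letter P) * seq (letter P)) : rules r -> move next t r.1 = move next t r.2.
Proof. by case: (move _ _ r.1); case: (move _ _ r.2). Qed.

Let trans_rule t r : rules r -> True -> rules (trans next out t r.1, trans next out t r.2).
Proof. by rewrite !trans_map => /f_rule. Qed.

Lemma relabel_pth W u p v : pth W u p v ->
  pth anyword (map f u) (map relabel p) (map f v).
Proof.
move=> pp; rewrite -(eq_map (trans_relabel tt)) -!(trans_map tt).
exact: (trans_pth (live := fun=> True) (next := next) (fun _ _ => id) next_rule trans_rule pp I).
Qed.

Lemma relabel_fdt : presentation_fdt P -> finitely_forced relabel_coherent.
Proof.
move=> PF; have fin_unit : finite_set [set: unit] by exact: finite_finset.
have H := transducer_coherent (live := fun=> True) (next := next) (fun _ _ => id)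
  next_rule trans_rule fin_unit PF.
apply: finitely_forced_sub H => sim simH H u p q v pp qp.
by have := H tt u p q v pp qp I; rewrite !(eq_map (trans_relabel tt)) trans_map.
Qed.

End Relabelling.

(** * Words beginning with a letter of an absorbing alphabet *)

(** [B] presents an ideal of the semigroup presented by [Q], and [f] embeds its
    letters.  Every product of a [B]-letter and a letter of [Q], in this order,
    is rewritten to a [B]-word by a single relation, so a word that begins with a
    [B]-letter is absorbed from left to right into a [B]-word.  The scanner that
    does this has the nonempty [B]-words as states. *)

Section Absorption.
Variables (B Q : presentation) (f : letter B -> letter Q).
Variable absorb : letter B -> letter Q -> seq (letter B).

Hypothesis f_rule : forall r, rules r -> rules (map f r.1, map f r.2).
Hypothesis f_connected : forall u v, u <> [::] -> v <> [::] ->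
  @connected Q (map f u) (map f v) -> @connected B u v.
Hypothesis absorb_neq0 : forall b a, absorb b a <> [::].
Hypothesis absorb_rule : forall b a, @rules Q ([:: f b; a], map f (absorb b a)).

Definition Bfirst (w : seq (letter Q)) := exists b z, w = f b :: z.

Let ok (u : seq (letter B)) := u <> [::].
Let inner u p v := exists2 q, @pth B anyword u q v & p = map (relabel f) q.
Let start a := exists b, a = f b.
Let init a : seq (letter B) :=
  if pselect (start a) is left H then [:: projT1 (cid H)] else [::].
Let step u a := if u is x :: s then belast x s ++ absorb (last x s) a else [::].
Let stepp u a := if u is x :: s then
  [:: Edge (map f (belast x s)) ([:: f (last x s); a], map f (absorb (last x s) a))
        true [::]] else [::].

(* Only the last letter of the state is involved in a step, so that steps, and
   the homotopies between them, can be prefixed by any [B]-word. *)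
Let step_cat w u a : u <> [::] -> step (w ++ u) a = w ++ step u a.
Proof.
case/lastP: u => // u b _; rewrite -rcons_cat.
have E v : step (rcons v b) a = v ++ absorb b a.
  by case: v => //= x s; rewrite belast_rcons last_rcons.
by rewrite !E catA.
Qed.

Let stepp_cat w u a : u <> [::] -> stepp (w ++ u) a = map f w >* stepp u a.
Proof.
case/lastP: u => // u b _; rewrite -rcons_cat.
have E v : stepp (rcons v b) a =
    [:: Edge (map f v) ([:: f b; a], map f (absorb b a)) true [::]].
  by case: v => //= x s; rewrite belast_rcons last_rcons.
by rewrite !E map_cat.
Qed.

Let ok_step u a : ok u -> ok (step u a).
Proof.
by case: u => // x s _ /=; rewrite /ok; case: (belast _ _) => //=.
Qed.

Let ok_run u z : ok u -> ok (run step u z).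
Proof. by elim: z u => //= a z IH u /(@ok_step _ a)/IH. Qed.

Let run_catl w u z : ok u -> run step (w ++ u) z = w ++ run step u z.
Proof.
elim: z u => //= a z IH u u0.
by rewrite step_cat // IH //; apply: ok_step.
Qed.

Let runp_catl w u z : ok u ->
  runp step stepp (w ++ u) z = map f w >* runp step stepp u z.
Proof.
elim: z u => //= a z IH u u0.
by rewrite step_cat // stepp_cat // IH; [rewrite lact_cat lract|apply: ok_step].
Qed.

Let ok_init a : start a -> ok (init a).
Proof. by rewrite /init; case: pselect. Qed.

Let wd_init a : start a -> map f (init a) = [:: a].
Proof. by rewrite /init; case: pselect => // H _ /=; case: (cid H) => b /= <-. Qed.

Let initP W a : W [:: a] -> start a -> pth W [:: a] [::] (map f (init a)).
Proof. by move=> Wa /wd_init ->. Qed.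

Let stepP W u a : ok u -> W (map f u ++ [:: a]) -> W (map f (step u a)) ->
  pth W (map f u ++ [:: a]) (stepp u a) (map f (step u a)).
Proof.
case/lastP: u => // u b _; rewrite -cats1 step_cat // stepp_cat // !map_cat -!catA /= => H1 H2.
have := @pth_edge Q W (map f u) _ true [::] (absorb_rule b a).
by rewrite /lact /= !cats0; apply.
Qed.

Let starting_Bfirst w : starting start w <-> Bfirst w.
Proof.
case: w => [|a w]; first by split=> // -[b [z]].
by split=> [[b ->]|[b [z [-> _]]]]; [exists b, w|exists b].
Qed.

Let Bfirst_map u z : ok u -> Bfirst (map f u ++ z).
Proof. by case: u => // b u _; exists b, (map f u ++ z). Qed.

Let pth_run_Bfirst u z : ok u ->
  pth Bfirst (map f u ++ z) (runp step stepp u z) (map f (run step u z)).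
Proof.
have B0 u' : ok u' -> Bfirst (map f u') by move/(Bfirst_map [::]); rewrite cats0.
elim: z u => [|a z IH] u u0 /=.
  by rewrite cats0; split=> //; [exact: B0|case: (u) u0].
rewrite -cat1s catA; apply: pth_cat (IH _ (@ok_step _ a u0)).
apply: (@pth_ract _ Bfirst); first by move=> w [b [y ->]]; exists b, (y ++ z).
by apply: stepP => //; [exact: Bfirst_map|apply: B0; apply: ok_step].
Qed.

Lemma Bfirst_absorb w : Bfirst w ->
  exists p u, u <> [::] /\ pth Bfirst w p (map f u).
Proof.
case=> b [z ->]; exists (runp step stepp [:: b] z), (run step [:: b] z).
by split; [apply: ok_run|apply: (@pth_run_Bfirst [:: b])].
Qed.

Let inner_ex u v : ok u -> ok v -> @connected Q (map f u) (map f v) ->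
  exists p, inner u p v.
Proof.
by move=> u0 v0 /(f_connected u0 v0)[p pp]; exists (map (relabel f) p), p.
Qed.

Let innerP u p v : inner u p v -> pth anyword (map f u) p (map f v).
Proof. by case=> q qp ->; apply: relabel_pth qp. Qed.

Hypothesis finB : finite_presentation B.
Hypothesis finQ : finite_presentation Q.

(** The right action of [Q] on [B]-words respects the relations of [B]: only
    the last letter of a [B]-word is touched, so it suffices to ask for one
    homotopy for each relation of [B] and letter of [Q]. *)
Let step_rule sim := forall r, @rules B r -> forall b, [set: bool] b ->
  forall a, [set: letter Q] a ->
  exists2 q, inner (step (rule_side r b) a) q (step (rule_side r (~~ b)) a) &
    heq sim (map f (rule_side r b) ++ [:: a])
      ([:: Edge [::] (map f r.1, map f r.2) b [:: a]] ++ stepp (rule_side r (~~ b)) a)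
      (stepp (rule_side r b) a ++ q).

Let step_rule_forced : finitely_forced step_rule.
Proof.
apply: finitely_forced_all => [|r rr]; first by case: finB.
apply: finitely_forced_all => [|b _]; first exact: finite_finset.
apply: finitely_forced_all => [|a _]; first by case: finQ.
have ok_side c : ok (rule_side r c) by apply: rule_side_neq0.
have sp c := @stepP anyword (rule_side r c) a (ok_side c) I I.
have ep : pth anyword (map f (rule_side r b) ++ [:: a])
    ([:: Edge [::] (map f r.1, map f r.2) b [:: a]]) (map f (rule_side r (~~ b)) ++ [:: a]).
  have := @pth_edge Q anyword [::] _ b [:: a] (f_rule rr) I I.
  by case: (b).
have [|q qI] := @inner_ex (step (rule_side r b) a) (step (rule_side r (~~ b)) a)
    (@ok_step _ a (ok_side b)) (@ok_step _ a (ok_side (~~ b))).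
  by eexists; apply: pth_cat (pth_inv (sp b)) (pth_cat ep (sp (~~ b))).
apply: finitely_forced_sub
  (finitely_forced_heq (pth_cat ep (sp (~~ b))) (pth_cat (sp b) (innerP qI))) => sim _ H.
by exists q.
Qed.

(** A relation of [Q] read after a [B]-word also affects its last letter only. *)
Let letter_rule sim := forall x, [set: letter B] x -> forall r, @rules Q r ->
  forall b, [set: bool] b ->
  exists2 q, inner (run step [:: x] (rule_side r b)) q
                   (run step [:: x] (rule_side r (~~ b))) &
    heq sim ([:: f x] ++ rule_side r b)
      (Edge [:: f x] r b [::] :: runp step stepp [:: x] (rule_side r (~~ b)))
      (runp step stepp [:: x] (rule_side r b) ++ q).

Let letter_rule_forced : finitely_forced letter_rule.
Proof.
apply: finitely_forced_all => [|x _]; first by case: finB.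
apply: finitely_forced_all => [|r rr]; first by case: finQ.
apply: finitely_forced_all => [|b _]; first exact: finite_finset.
have sp c := pth_any (@pth_run_Bfirst [:: x] (rule_side r c) ltac:(done)).
have ep : pth anyword ([:: f x] ++ rule_side r b) [:: Edge [:: f x] r b [::]]
    ([:: f x] ++ rule_side r (~~ b)).
  by have := @pth_edge Q anyword [:: f x] _ b [::] rr I I; rewrite !cats0.
have [|q qI] := @inner_ex (run step [:: x] (rule_side r b))
  (run step [:: x] (rule_side r (~~ b))) (@ok_run [:: x] _ ltac:(done)) (@ok_run [:: x] _ ltac:(done)).
  by eexists; apply: pth_cat (pth_inv (sp b)) (pth_cat ep (sp (~~ b))).
apply: finitely_forced_sub
  (finitely_forced_heq (pth_cat ep (sp (~~ b))) (pth_cat (sp b) (innerP qI))) => sim _ H.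
by exists q.
Qed.

Let head_rule sim := forall r, @rules Q r -> forall b, [set: bool] b ->
  starting start (rule_side r b) -> starting start (rule_side r (~~ b)) ->
  forall N p N' p', eval init (fun=> [::]) step stepp (rule_side r b) N p ->
  eval init (fun=> [::]) step stepp (rule_side r (~~ b)) N' p' ->
  exists2 q, inner N q N' &
    heq sim (rule_side r b) (Edge [::] r b [::] :: p') (p ++ q).

Let pth_evalB w N p : starting start w -> eval init (fun=> [::]) step stepp w N p ->
  ok N /\ pth anyword w p (map f N).
Proof.
apply: (@pth_eval Q _ ok (map f)).
- by case.
- exact: ok_init.
- by move=> u a; apply: ok_step.
- by move=> a; apply: initP.
- by move=> u a u0; apply: stepP.
Qed.

Let head_rule_forced : finitely_forced head_rule.
Proof.
apply: finitely_forced_all => [|r rr]; first by case: finQ.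
apply: finitely_forced_all => [|b _]; first exact: finite_finset.
have [[sb snb]|ns] := pselect (starting start (rule_side r b) /\
    starting start (rule_side r (~~ b))); last first.
  by apply: finitely_forced_sub (finitely_forcedT _) => sim _ _ s s'; case: ns.
have [N [p ev]] := starting_eval init (fun=> [::]) step stepp sb.
have [N' [p' ev']] := starting_eval init (fun=> [::]) step stepp snb.
have [okN pp] := pth_evalB sb ev; have [okN' pp'] := pth_evalB snb ev'.
have ep : pth anyword (rule_side r b) [:: Edge [::] r b [::]] (rule_side r (~~ b)).
  by have := @pth_edge Q anyword [::] _ b [::] rr I I; rewrite !cats0.
have [|q qI] := inner_ex okN okN'.
  by eexists; apply: pth_cat (pth_inv pp) (pth_cat ep pp').
apply: finitely_forced_sub
  (finitely_forced_heq (pth_cat ep pp') (pth_cat pp (innerP qI))) => sim _ H _ _.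
move=> M m M' m' /(eval_inj ev)[<- <-] /(eval_inj ev')[<- <-].
by exists q.
Qed.

Lemma Bfirst_coherent :
  finitely_forced (fun sim => relabel_coherent f sim -> coherent sim Bfirst).
Proof.
apply: finitely_forced_sub (finitely_forced_and step_rule_forced
  (finitely_forced_and letter_rule_forced head_rule_forced)).
move=> sim simH [stepR [letterR headR]] coh.
suff: coherent sim (starting start).
  by move=> H u p q v pp qp; apply: (H u p q v);
    [apply: pth_sub pp|apply: pth_sub qp] => w /starting_Bfirst.
have inner_coh u p q v : inner u p v -> inner u q v -> heq sim (map f u) p q.
  by move=> [p' pp ->] [q' qp ->]; apply: coh pp qp.
have inner_nil u : ok u -> inner u [::] u by exists [::].
have inner_cat u p v q w : inner u p v -> inner v q w -> inner u (p ++ q) w.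
  by move=> [p' pp ->] [q' qp ->]; exists (p' ++ q'); [apply: pth_cat pp qp|rewrite map_cat].
apply: (@scan_coherent Q sim simH _ ok (map f) inner start init (fun=> [::]) step stepp) => //.
- by case.
- by move=> a; apply: initP.
- by move=> u a u0; apply: stepP.
- move=> u _ v a _ _ [p pp ->].
  elim: p u pp => [|[l r b t] p IH] u.
    case=> _ u0 <-; exists [::]; first by apply: inner_nil; apply: ok_step.
    by rewrite cats0; apply: heq_refl (@stepP anyword _ _ _ _ _).
  case=> rr <- _ pp; have [_ w0] := pth_src pp.
  have {IH}[q qI Hq] := IH _ pp.
  pose e := Edge l r b t.
  have u0 : ok (esrc e) by apply: esrc_neq0.
  suff [s sI Hs] : exists2 s, inner (step (esrc e) a) s (step (etgt e) a) &
      heq sim (map f (esrc e) ++ [:: a]) ([:: relabel f e] *< [:: a] ++ stepp (etgt e) a)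
        (stepp (esrc e) a ++ s).
    exists (s ++ q); first exact: inner_cat sI qI.
    have ep : pth anyword (map f (esrc e) ++ [:: a]) ([:: relabel f e] *< [:: a])
        (map f (etgt e) ++ [:: a]).
      by apply: pthr; apply: (@relabel_pth _ _ _ f_rule anyword _ [:: e]).
    have -> : map (relabel f) (e :: p) = [:: relabel f e] ++ map (relabel f) p by [].
    rewrite ract_cat -catA.
    apply: (heq_trans simH (heq_catl simH ep Hq)).
    rewrite !catA; apply: (heq_catr simH Hs) (innerP qI).
    by apply: pth_cat ep _; apply: stepP.
  have {}rr : rules r by []; clear q qI Hq pp w0.
  have De : [:: relabel f e] *< [:: a] =
      map f l >* [:: Edge [::] (map f r.1, map f r.2) b (map f t ++ [:: a])].
    by rewrite /ract /lact /= cats0.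
  have r0 c : rule_side r c <> [::] by apply: rule_side_neq0.
  rewrite {}/e in u0 De *; case/lastP: t u0 De => [|t x] u0 De.
    have [s sI Hs] := stepR r rr b I a I.
    exists (map f l >* s).
      case: sI => s' sp ->; exists (l >* s'); last by rewrite relabel_lact.
      by rewrite /esrc /etgt /= !cats0 !step_cat //; apply: pthl sp.
    rewrite De /esrc /etgt /= !cats0 !stepp_cat // -!lact_cat map_cat -catA.
    by have := heq_lact simH (map f l) Hs; rewrite (lact_cat _ [:: _]) {1}/lact /= cats0.
  rewrite De {De}.
  pose k c := l ++ rule_side r c ++ t.
  have Dk : esrc (Edge l r b (rcons t x)) = k b ++ [:: x] by rewrite /esrc /k -cats1 !catA.
  have Dk' : etgt (Edge l r b (rcons t x)) = k (~~ b) ++ [:: x].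
    by rewrite /etgt /k -cats1 !catA.
  pose g := [:: Edge (map f l) (map f r.1, map f r.2) b (map f t)].
  have gp : pth anyword (map f (k b)) g (map f (k (~~ b))).
    have := @pth_edge Q anyword (map f l) _ b (map f t) (f_rule rr) I I.
    by rewrite /k !map_cat !map_rule_side.
  exists (g *< map f (absorb x a)).
    exists ([:: Edge l r b (t ++ absorb x a)]); last by rewrite /ract /= /relabel /= map_cat.
    rewrite Dk Dk' !step_cat //= /k -!catA.
    exact: pth_edge.
  rewrite Dk Dk' !stepp_cat // map_cat -(catA (map f (k b))).
  have xp : pth anyword ([:: f x] ++ [:: a]) (stepp [:: x] a) (map f (absorb x a)).
    exact: (@stepP anyword [:: x]).
  have -> : map f l >* [:: Edge [::] (map f r.1, map f r.2) b (map f (rcons t x) ++ [:: a])] =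
      g *< ([:: f x] ++ [:: a]) by rewrite /g /ract /lact /= cats0 -cats1 map_cat -catA.
  exact: (heq_xchg simH gp xp).
- move=> u r b u0 rr; case/lastP: u u0 => // u x _; rewrite -cats1.
  have [q [q' qp ->] Hq] := letterR x I r rr b I.
  exists (map (relabel f) (u >* q')).
    by rewrite !run_catl //; exists (u >* q') => //; apply: pthl qp.
  rewrite !runp_catl // relabel_lact -lact_cat map_cat -catA.
  by have := heq_lact simH (map f u) Hq; rewrite /lact.
- by move=> r b N p N' p' rr sb snb ev ev'; apply: headR ev ev'.
Qed.

End Absorption.


(** * Reversal *)

(** Reversing words turns homotopy relations into homotopy relations, since (H1)
    is symmetric.  This transfers statements about words beginning with a
    [B]-letter to words ending with one. *)

Section Reversal.
Variable P : presentation.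
Local Notation L := (letter P).

Lemma rev_neq0 T (w : seq T) : w <> [::] -> rev w <> [::].
Proof. by move=> w0 /(congr1 rev); rewrite revK. Qed.

Definition rev_rules : set (seq L * seq L) := [set r | rules (rev r.1, rev r.2)].

Lemma rev_rules_Aplus : rev_rules `<=` Aplus L `*` Aplus L.
Proof.
by move=> [u v] /rules_Aplus[/= /rev_neq0 + /rev_neq0]; rewrite !revK.
Qed.

Definition rev_pres := Presentation rev_rules_Aplus.

Definition rev_edge (e : edge L) :=
  Edge (rev (eright e)) (rev (erule e).1, rev (erule e).2) (esign e) (rev (eleft e)).

Lemma rev_edgeK : involutive rev_edge.
Proof. by case=> l [u v] b t; rewrite /rev_edge /= !revK. Qed.

Lemma rev_side (r : seq L * seq L) b : rule_side (rev r.1, rev r.2) b = rev (rule_side r b).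
Proof. by case: b. Qed.

Lemma esrc_rev e : esrc (rev_edge e) = rev (esrc e).
Proof. by rewrite /esrc /= rev_side !rev_cat catA. Qed.

Lemma etgt_rev e : etgt (rev_edge e) = rev (etgt e).
Proof. by rewrite /etgt /= rev_side !rev_cat catA. Qed.

Lemma rev_lact x p : map rev_edge (x >* p) = map rev_edge p *< rev x.
Proof. by rewrite /lact /ract -!map_comp; apply: eq_map => e; rewrite /rev_edge /= rev_cat. Qed.

Lemma rev_ract p y : map rev_edge (p *< y) = rev y >* map rev_edge p.
Proof. by rewrite /lact /ract -!map_comp; apply: eq_map => e; rewrite /rev_edge /= rev_cat. Qed.

Lemma pth_rev (W W' : seq L -> Prop) u p v : (forall w, W w -> W' (rev w)) ->
  pth W u p v -> @pth rev_pres W' (rev u) (map rev_edge p) (rev v).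
Proof.
move=> WW'; elim: p u => [|e p IH] u; first by case=> /WW' ? /rev_neq0 ? <-.
case=> re <- /WW' ? /IH H; split=> //; last by rewrite etgt_rev.
- by rewrite /= /rev_rules /= !revK -surjective_pairing.
- exact: esrc_rev.
Qed.

Lemma pth_unrev (W W' : seq L -> Prop) u p v : (forall w, W w -> W' (rev w)) ->
  @pth rev_pres W u p v -> @pth P W' (rev u) (map rev_edge p) (rev v).
Proof.
move=> WW'; elim: p u => [|e p IH] u; first by case=> /WW' ? /rev_neq0 ? <-.
case=> re <- /WW' ? /IH H; split=> //; last by rewrite etgt_rev.
exact: esrc_rev.
Qed.

Lemma connected_rev u v : @connected P u v -> @connected rev_pres (rev u) (rev v).
Proof. by case=> p pp; exists (map rev_edge p); apply: (pth_rev _ pp). Qed.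

Lemma connected_unrev u v : @connected rev_pres u v -> @connected P (rev u) (rev v).
Proof. by case=> p pp; exists (map rev_edge p); apply: (pth_unrev _ pp). Qed.

Definition rev_path (p : gpath L) := GPath (rev (pstart p)) (map rev_edge (pedges p)).

Definition rev_sim sim (p q : gpath (letter rev_pres)) : Prop :=
  sim (rev_path p) (rev_path q) : Prop.

Lemma parallel_unrev (p q : gpath L) :
  @parallel rev_pres p q <-> @parallel P (rev_path p) (rev_path q).
Proof.
split=> /parallelP[e [v [pp qp]]]; apply/parallelP; rewrite /psrc /= in e pp qp *.
  split; first by rewrite e.
  by exists (rev v); split; [apply: pth_unrev pp|apply: pth_unrev qp].
split; first exact: (inv_inj revK).
exists (rev v); split.
  have := @pth_rev anyword anyword _ _ _ (fun _ _ => I) pp.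
  by rewrite revK -map_comp (eq_map rev_edgeK) map_id.
have := @pth_rev anyword anyword _ _ _ (fun _ _ => I) qp.
by rewrite revK -map_comp (eq_map rev_edgeK) map_id.
Qed.

Lemma heq_rev sim (u : seq L) p q :
  heq (P := rev_pres) (rev_sim sim) (rev u) (map rev_edge p) (map rev_edge q) = heq sim u p q.
Proof.
by rewrite /heq /rev_sim /rev_path /= !revK -!map_comp !(eq_map rev_edgeK) !map_id.
Qed.

Lemma rev_homotopy sim : @homotopy_relation P sim -> @homotopy_relation rev_pres (rev_sim sim).
Proof.
move=> simH; have parH := parallel_homotopy rev_pres.
have toheq (p q : gpath L) : psrc p = psrc q -> rev_sim sim p q =
    heq sim (rev (psrc p)) (map rev_edge (pedges p)) (map rev_edge (pedges q)).
  by case: p q => [u p] [u' q]; rewrite /psrc /= => <-.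
split.
- by move=> p q /(hom_parallel simH)/parallel_unrev.
- move=> p /(hom_refl parH) pp; apply: (hom_refl simH).
  by have /parallel_unrev[] := pp.
- by move=> p q; apply: hom_sym simH _ _.
- by move=> p q r; apply: hom_trans simH _ _ _.
- move=> e f re rf.
  have ep : @pth P anyword (rev (esrc e)) [:: rev_edge e] (rev (etgt e)).
    apply: (@pth_unrev anyword _ _ [:: e]) => //; split=> //; split=> //.
    exact: (@esrc_neq0 rev_pres (einv e)).
  have fp : @pth P anyword (rev (esrc f)) [:: rev_edge f] (rev (etgt f)).
    apply: (@pth_unrev anyword _ _ [:: f]) => //; split=> //; split=> //.
    exact: (@esrc_neq0 rev_pres (einv f)).
  rewrite toheq; last by rewrite /psrc /= cats0.
  have -> : pedges (Defs.pcomp (pact [::] (pedge e) (esrc f)) (pact (etgt e) (pedge f) [::]))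
      = [:: e] *< esrc f ++ etgt e >* [:: f] by rewrite /lact /ract /= /eact cats0.
  have -> : pedges (Defs.pcomp (pact (esrc e) (pedge f) [::]) (pact [::] (pedge e) (etgt f)))
      = esrc e >* [:: f] ++ [:: e] *< etgt f by rewrite /lact /ract /= /eact cats0.
  rewrite [psrc _](_ : _ = esrc e ++ esrc f) // rev_cat !map_cat !rev_lact !rev_ract.
  by apply: heq_sym => //; apply: (heq_xchg simH fp ep).
- move=> x y p q H; rewrite /rev_sim in H *.
  have E (r : gpath L) : rev_path (pact x r y) = pact (rev y) (rev_path r) (rev x).
    by rewrite /rev_path /pact /= !eact_lract rev_lact rev_ract lract !rev_cat catA.
  by rewrite !E; apply: hom_H2 simH _ _ _ _ H.
- move=> r s p q rp sp rt pt H; rewrite /rev_sim in H *.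
  have E (a b : gpath L) : rev_path (Defs.pcomp a b) = Defs.pcomp (rev_path a) (rev_path b).
    by rewrite /rev_path /Defs.pcomp /= map_cat.
  have T (a : gpath L) : @is_path rev_pres a -> is_path (P := P) (rev_path a) /\
      ptgt (rev_path a) = rev (ptgt a).
    move=> ap; have := @pth_unrev anyword anyword _ _ _ (fun _ _ => I) (is_path_pth ap).
    by move/pth_is_path.
  rewrite !E; have H' := H; apply: (hom_H3 simH) H'.
  + exact: (T _ rp).1.
  + exact: (T _ sp).1.
  + by rewrite (T _ rp).2 rt.
  + have pp : @is_path rev_pres p by have /parallel_unrev[] := hom_parallel simH H.
    by rewrite (T _ pp).2 pt.
- move=> p pp; have H := is_path_pth pp.
  rewrite toheq //; have := heq_inv simH (@pth_unrev anyword anyword _ _ _ (fun _ _ => I) H).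
  by rewrite /Defs.pcomp /Defs.pinv /psrc /= map_cat /pathinv map_rev -!map_comp.
Qed.

Lemma finitely_forced_rev phi : @finitely_forced rev_pres phi ->
  @finitely_forced P (fun sim => phi (rev_sim sim)).
Proof.
case=> C [finC Cpar CH]; exists [set (rev_path c.1, rev_path c.2) | c in C]; split.
- exact: finite_image.
- by move=> _ _ [[p q] /Cpar + [<- <-]] => /parallel_unrev.
- move=> sim simH H; apply: CH; first exact: rev_homotopy.
  by move=> p q Cpq; apply: H; exists (p, q).
Qed.

Lemma rev_finite : finite_presentation P -> finite_presentation rev_pres.
Proof.
case=> finA finR; split=> //.
apply: (sub_finite_set (B := [set (rev r.1, rev r.2) | r in @rules P])); last exact: finite_image.
by move=> [u v] uv; exists (rev u, rev v); rewrite //= !revK.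
Qed.

End Reversal.

(** ** Words ending with a letter of an absorbing alphabet *)

Section LeftAbsorption.
Variables (B Q : presentation) (f : letter B -> letter Q).
Variable absorb : letter B -> letter Q -> seq (letter B).

Hypothesis f_rule : forall r, rules r -> rules (map f r.1, map f r.2).
Hypothesis f_connected : forall u v, u <> [::] -> v <> [::] ->
  @connected Q (map f u) (map f v) -> @connected B u v.
Hypothesis absorb_neq0 : forall b a, absorb b a <> [::].
Hypothesis absorb_rule : forall b a, @rules Q ([:: a; f b], map f (absorb b a)).
Hypothesis finB : finite_presentation B.
Hypothesis finQ : finite_presentation Q.

Definition Blast (w : seq (letter Q)) := exists z b, w = z ++ [:: f b].

Let Blast_rev w : Blast w <-> @Bfirst (rev_pres B) (rev_pres Q) f (rev w).
Proof.
split=> [[z [b ->]]|[b [z E]]]; first by exists b, (rev z); rewrite rev_cat.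
by exists (rev z), b; rewrite -[w]revK E rev_cons -cats1.
Qed.

Let absorb' (b : letter (rev_pres B)) (a : letter (rev_pres Q)) : seq (letter (rev_pres B)) :=
  rev (absorb b a).

Let rf_rule (r : seq (letter (rev_pres B)) * seq (letter (rev_pres B))) :
  @rules (rev_pres B) r -> @rules (rev_pres Q) (map f r.1, map f r.2).
Proof. by move=> /f_rule; rewrite /= /rev_rules /= !map_rev. Qed.

Let rf_connected (u v : seq (letter B)) : u <> [::] -> v <> [::] ->
  @connected (rev_pres Q) (map f u) (map f v) -> @connected (rev_pres B) u v.
Proof.
move=> /rev_neq0 u0 /rev_neq0 v0 /connected_unrev; rewrite -!map_rev.
by move=> /(f_connected u0 v0)/connected_rev; rewrite !revK.
Qed.

Let absorb'_rule b a : @rules (rev_pres Q) ([:: f b; a], map f (absorb' b a)).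
Proof. by rewrite /= /rev_rules /= /absorb' -map_rev revK; apply: absorb_rule. Qed.

Let absorb'_neq0 b a : absorb' b a <> [::].
Proof. exact: rev_neq0. Qed.

Lemma Blast_absorb w : Blast w -> exists p u, u <> [::] /\ pth Blast w p (map f u).
Proof.
move=> /Blast_rev.
move=> /(Bfirst_absorb absorb'_neq0 absorb'_rule)[p [u [u0 pp]]].
exists (map (@rev_edge Q) p), (rev u); split; first exact: rev_neq0.
rewrite -[w]revK map_rev; apply: (@pth_unrev Q _ Blast) pp => x [b [z ->]].
by exists (rev z), b; rewrite rev_cons -cats1.
Qed.

Lemma Blast_coherent :
  finitely_forced (fun sim => relabel_coherent f sim -> coherent sim Blast).
Proof.
have H := finitely_forced_rev (Bfirst_coherent rf_rule rf_connected absorb'_neq0 absorb'_rule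
  (rev_finite finB) (rev_finite finQ)).
apply: finitely_forced_sub H => sim simH H coh u p q v pp qp.
rewrite -heq_rev; apply: H.
- move=> {pp qp}u {}p {}q {}v pp qp.
  have := coh _ _ _ _ (pth_unrev (fun _ _ => I) pp) (pth_unrev (fun _ _ => I) qp).
  have E (r : seq (edge (letter B))) :
      map (relabel f) (map (@rev_edge B) r) = map (@rev_edge Q) (map (relabel f) r).
    by rewrite -!map_comp; apply: eq_map => e; rewrite /relabel /rev_edge /= !map_rev.
  by rewrite !E map_rev.
- by apply: (@pth_rev Q Blast _ _ _ _ _ pp) => w /Blast_rev.
- by apply: (@pth_rev Q Blast _ _ _ _ _ qp) => w /Blast_rev.
Qed.

End LeftAbsorption.


Lemma cat_cons_split T (a c b d : seq T) x y : a ++ x :: b = c ++ y :: d ->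
  [\/ [/\ a = c, x = y & b = d],
      exists e, c = a ++ x :: e /\ b = e ++ y :: d |
      exists e, a = c ++ y :: e /\ d = e ++ x :: b].
Proof.
elim: a c => [|z a IH] [|t c] /=.
- by case=> -> ->; constructor 1.
- by case=> -> ->; constructor 2; exists c.
- by case=> -> <-; constructor 3; exists a.
- case=> -> /IH[[-> -> ->]|[e [-> ->]]|[e [-> ->]]]; first by constructor 1.
    by constructor 2; exists e.
  by constructor 3; exists e.
Qed.

(** * Words containing a letter of an absorbing alphabet *)

(** A word [x ++ s] with a [B]-letter at the beginning of [s] is evaluated by
    absorbing first what follows that letter and then what precedes it.  The
    result does not depend, up to a path of [B]-words, on the marked letter or on
    the order of the two absorptions; granted this, every edge lies to the right
    of some marked letter or to the left of one, where coherence is known. *)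

Section TwoSided.
Variables (B Q : presentation) (f : letter B -> letter Q).
Variable sim : gpath (letter Q) -> gpath (letter Q) -> Prop.
Hypothesis simH : homotopy_relation sim.

Definition inner u p v := exists2 q, @pth B anyword u q v & p = map (relabel f) q.
Definition Bin (w : seq (letter Q)) := exists x b z, w = x ++ f b :: z.
Local Notation Bfirst := (Bfirst f).
Local Notation Blast := (Blast f).

Hypothesis f_rule : forall r, rules r -> rules (map f r.1, map f r.2).
Hypothesis f_connected : forall u v, u <> [::] -> v <> [::] ->
  @connected Q (map f u) (map f v) -> @connected B u v.
Hypothesis absorbr : forall w, Bfirst w -> exists p u, u <> [::] /\ pth Bfirst w p (map f u).
Hypothesis absorbl : forall w, Blast w -> exists p u, u <> [::] /\ pth Blast w p (map f u).
Hypothesis split_word : forall u, u <> [::] ->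
  exists u1 u2, [/\ u1 <> [::], u2 <> [::] & @connected B u (u1 ++ u2)].
Hypothesis coh_f : relabel_coherent f sim.
Hypothesis coh_first : coherent sim Bfirst.
Hypothesis coh_last : coherent sim Blast.

Lemma inner_connected u v : u <> [::] -> v <> [::] -> @connected Q (map f u) (map f v) ->
  exists p, inner u p v.
Proof.
by move=> u0 v0 /(f_connected u0 v0)[p pp]; exists (map (relabel f) p), p.
Qed.

Lemma inner_pth u p v : inner u p v -> pth anyword (map f u) p (map f v).
Proof. by case=> q qp ->; apply: relabel_pth qp. Qed.

Lemma inner_coherent u p q v : inner u p v -> inner u q v -> heq sim (map f u) p q.
Proof. by move=> [p' pp ->] [q' qp ->]; apply: coh_f pp qp. Qed.

Lemma inner_cat u p v q w : inner u p v -> inner v q w -> inner u (p ++ q) w.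
Proof.
by move=> [p' pp ->] [q' qp ->]; exists (p' ++ q'); [apply: pth_cat pp qp|rewrite map_cat].
Qed.

Lemma inner_neq0 u p v : inner u p v -> u <> [::] /\ v <> [::].
Proof. by case=> q qp _; case: (pth_src qp); case: (pth_tgt qp). Qed.

Let image w := exists2 u, u <> [::] & w = map f u.

Lemma inner_pth_image u p v : inner u p v -> pth image (map f u) p (map f v).
Proof.
case=> q qp ->; elim: q u qp => [|e q IH] u.
  by case=> _ u0 <-; split=> //; [exists u|case: (u) u0].
case=> re eu _ qp.
have ep : pth anyword u [:: e] (etgt e) by split=> //; split=> //; case: (pth_src qp).
case: (relabel_pth f_rule ep) => H1 H2 _ [_ _ H3].
split=> //; first by exists u => //; case: (pth_src ep).
by rewrite H3; apply: IH.
Qed.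

Lemma inner_first y u p v : inner u p v -> pth Bfirst (map f u ++ y) (p *< y) (map f v ++ y).
Proof.
move=> /inner_pth_image; apply: pth_ract => w [[//|b {}u] _ ->].
by exists b, (map f u ++ y).
Qed.

Lemma inner_last x u p v : inner u p v -> pth Blast (x ++ map f u) (x >* p) (x ++ map f v).
Proof.
move=> /inner_pth_image; apply: pth_lact => w [].
by case/lastP=> // {}u b _ ->; exists (x ++ map f u), b; rewrite -cats1 map_cat catA.
Qed.

Lemma last_lact x u p v : pth Blast u p v -> pth Blast (x ++ u) (x >* p) (x ++ v).
Proof. by apply: pth_lact => w [z [b ->]]; exists (x ++ z), b; rewrite catA. Qed.

Lemma first_lact x u p v W : x <> [::] -> pth W u p v ->
  pth Bfirst (map f x ++ u) (map f x >* p) (map f x ++ v).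
Proof. by case: x => // b x _; apply: pth_lact => w _; exists b, (map f x ++ w). Qed.

Lemma last_ract y u p v W : y <> [::] -> pth W u p v ->
  pth Blast (u ++ map f y) (p *< map f y) (v ++ map f y).
Proof.
case/lastP: y => // y b _; apply: pth_ract => w _.
by exists (w ++ map f y), b; rewrite -cats1 map_cat catA.
Qed.

(** Once the marked [B]-word [u] is split in two factors, what follows can be
    absorbed by the second factor and what precedes by the first one, and paths
    that act on disjoint factors commute. *)
Lemma absorb_swap x u y p1 u1 p2 n q1 v1 q2 m :
  pth Bfirst (map f u ++ y) p1 (map f u1) -> pth Blast (x ++ map f u1) p2 (map f n) ->
  pth Blast (x ++ map f u) q1 (map f v1) -> pth Bfirst (map f v1 ++ y) q2 (map f m) ->
  u <> [::] -> u1 <> [::] -> n <> [::] -> v1 <> [::] -> m <> [::] ->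
  exists2 d, inner n d m &
    heq sim (x ++ map f u ++ y) ((x >* p1 ++ p2) ++ d) (q1 *< y ++ q2).
Proof.
move=> p1p p2p q1p q2p u0 u10 n0 v10 m0.
have [a [b [a0 b0 [s' s'p]]]] := split_word u0.
have sI : inner u (map (relabel f) s') (a ++ b) by exists s'.
move: (map _ s') sI => s sI {s' s'p}.
have [|pa [vb [vb0 pap]]] := @absorbr (map f b ++ y).
  by case: (b) b0 => // c z _; exists c, (map f z ++ y).
have [|pc [va [va0 pcp]]] := @absorbl (x ++ map f a).
  by case/lastP: (a) a0 => // z c _; exists (x ++ map f z), c; rewrite -cats1 map_cat catA.
have sF := inner_first y sI; rewrite map_cat -catA in sF.
have sL := inner_last x sI; rewrite map_cat catA in sL.
have ne2 T (k h : seq T) : k <> [::] -> k ++ h <> [::] by case: k.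
have [b1 b1I] : exists b1, inner (a ++ vb) b1 u1.
  apply: inner_connected => //; first exact: ne2.
  exists (pathinv (s *< y ++ map f a >* pa) ++ p1); rewrite map_cat.
  apply: pth_cat (pth_any p1p); apply: pth_inv.
  exact: pth_cat (pth_any sF) (pthl _ pap).
have [b2 b2I] : exists b2, inner (va ++ b) b2 v1.
  apply: inner_connected => //; first exact: ne2.
  exists (pathinv (x >* s ++ pc *< map f b) ++ q1); rewrite map_cat.
  apply: pth_cat (pth_any q1p); apply: pth_inv.
  exact: pth_cat (pth_any sL) (pthr _ pcp).
have xsy : pth anyword (x ++ map f u ++ y) (x >* s *< y) ((x ++ map f a) ++ map f b ++ y).
  by rewrite -(catA x); apply: pthl sF.
have xa := pthl (x ++ map f a) pap; have cv := pthr (map f vb) pcp.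
have cb := pthr (map f b ++ y) pcp; have va_pa := pthl (map f va) pap.
have [d1 d1I] : exists d1, inner (va ++ vb) d1 n.
  apply: inner_connected => //; first exact: ne2.
  exists (pathinv (x >* s *< y ++ (x ++ map f a) >* pa ++ pc *< map f vb) ++ x >* p1 ++ p2).
  rewrite map_cat; apply: pth_cat (pth_cat (pthl x p1p) (pth_any p2p)).
  by apply: pth_inv; apply: pth_cat xsy (pth_cat xa cv).
have [d dI] : exists d, inner n d m.
  apply: inner_connected => //.
  exists (pathinv (x >* p1 ++ p2) ++ q1 *< y ++ q2).
  apply: (@pth_cat _ _ _ _ (x ++ map f u ++ y)).
    by apply: pth_inv; apply: pth_cat (pthl x p1p) (pth_any p2p).
  by rewrite catA; apply: pth_cat (pthr y q1p) (pth_any q2p).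
exists d => //; have d1p := inner_pth d1I; rewrite map_cat in d1p.
pose M := x >* s *< y ++ (x ++ map f a) >* pa ++ pc *< map f vb.
have Mp : pth anyword (x ++ map f u ++ y) M (map f va ++ map f vb).
  exact: pth_cat xsy (pth_cat xa cv).
have rightfirst : heq sim (x ++ map f u ++ y) (x >* p1 ++ p2) (M ++ d1).
  apply: (@heq_trans _ _ simH _ ((x >* (s *< y ++ map f a >* pa ++ b1)) ++ p2)).
    apply: (heq_catr simH) (pthl x p1p) p2p; apply: (heq_lact simH).
    apply: (coh_first p1p); apply: pth_cat sF _.
    apply: (@pth_cat _ _ _ _ (map f a ++ map f vb)); first exact: first_lact pap.
    by have := inner_first [::] b1I; rewrite map_cat !cats0 ract0.
  rewrite !lact_cat -lactM -!catA; apply: (heq_catl simH xsy).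
  apply: (heq_catl simH xa); apply: coh_last.
    by apply: pth_cat p2p; have := inner_last x b1I; rewrite map_cat catA.
  apply: pth_cat (last_ract vb0 pcp) _.
  by have := inner_last [::] d1I; rewrite map_cat lact0.
have leftfirst : heq sim (x ++ map f u ++ y) (q1 *< y ++ q2)
    ((x >* s *< y ++ pc *< (map f b ++ y) ++ map f va >* pa) ++ d1 ++ d).
  apply: (@heq_trans _ _ simH _ (((x >* s ++ pc *< map f b ++ b2) *< y) ++ q2)).
    rewrite catA; apply: (heq_catr simH) (pthr y q1p) q2p; apply: (heq_ract simH).
    apply: (coh_last q1p); apply: pth_cat sL _.
    apply: (@pth_cat _ _ _ _ (map f va ++ map f b)); first exact: last_ract pcp.
    by have := inner_last [::] b2I; rewrite map_cat lact0.
  rewrite !ract_cat lract -ractM -!catA; apply: (heq_catl simH xsy).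
  apply: (heq_catl simH cb).
  apply: coh_first.
    by apply: pth_cat q2p; have := inner_first y b2I; rewrite map_cat -catA.
  apply: pth_cat (first_lact va0 pap) _.
  have := inner_first [::] d1I; have := inner_first [::] dI.
  by rewrite !cats0 !ract0 map_cat => H1 H2; apply: pth_cat H2 H1.
apply: (@heq_trans _ _ simH _ ((M ++ d1) ++ d)).
  apply: (heq_catr simH rightfirst) (inner_pth dI).
  exact: pth_cat (pthl x p1p) (pth_any p2p).
apply: heq_sym => //; apply: (heq_trans simH leftfirst).
rewrite -(catA M); apply: (heq_catr simH) (pth_cat d1p (inner_pth dI)); last first.
  by apply: pth_cat xsy _; apply: pth_cat cb va_pa.
apply: (heq_catl simH xsy); exact: (heq_xchg simH pcp pap).
Qed.

Let agree w p n p' n' := exists2 d, inner n d n' & heq sim w (p ++ d) p'.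

Let agree_sym w p n p' n' : pth anyword w p (map f n) -> pth anyword w p' (map f n') ->
  agree w p n p' n' -> agree w p' n' p n.
Proof.
move=> pp pp' [d dI H]; have [n0 n'0] := inner_neq0 dI.
have [|e eI] := inner_connected n'0 n0.
  by exists (pathinv p' ++ p); apply: pth_cat (pth_inv pp') pp.
exists e => //.
have pdp := pth_cat pp (inner_pth dI).
apply: (@heq_trans _ _ simH _ ((p ++ d) ++ e)).
  exact: (heq_catr simH (heq_sym simH H) pp') (inner_pth eI).
rewrite -catA -[X in heq _ _ _ X]cats0; apply: (heq_catl simH pp).
apply: inner_coherent; first exact: inner_cat dI eI.
by exists [::].
Qed.

Let agree_trans w p n p' n' p'' n'' : pth anyword w p (map f n) ->
  agree w p n p' n' -> agree w p' n' p'' n'' -> agree w p n p'' n''.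
Proof.
move=> pp [d dI H] [e eI H']; exists (d ++ e); first exact: inner_cat dI eI.
apply: (heq_trans simH) H'; rewrite catA.
exact: (heq_catr simH H (pth_cat pp (inner_pth dI))) (inner_pth eI).
Qed.

Definition marked_eval w p n := n <> [::] /\ exists x s p1 u1 p2,
  [/\ w = x ++ s, u1 <> [::], pth Bfirst s p1 (map f u1),
      pth Blast (x ++ map f u1) p2 (map f n) & p = x >* p1 ++ p2].

Lemma marked_eval_pth w p n : marked_eval w p n -> pth anyword w p (map f n).
Proof.
by move=> [_ [x [s [p1 [u1 [p2 [-> _ H1 H2 ->]]]]]]]; apply: pth_cat (pthl x H1) (pth_any H2).
Qed.

Let Blast_map x u : u <> [::] -> Blast (x ++ map f u).
Proof.
by case/lastP: u => // u b _; exists (x ++ map f u), b; rewrite -cats1 map_cat catA.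
Qed.

Lemma marked_eval_first x s : Bfirst s -> exists p1 u1 p2 n, [/\ n <> [::], u1 <> [::],
  pth Bfirst s p1 (map f u1) & pth Blast (x ++ map f u1) p2 (map f n)].
Proof.
case/absorbr=> [p1 [u1 [u10 H1]]].
have [p2 [n [n0 H2]]] := absorbl (Blast_map x u10).
by exists p1, u1, p2, n.
Qed.

(** The letters between two marks can be absorbed into the second one: keeping
    the letter [f b] in front, this path belongs both to the words beginning with
    a [B]-letter and to the words ending with one. *)
Let marked_eval_shift x b e s' p1 u1 p2 n p1' u1' p2' n' :
  let s := f b :: e ++ s' in let x' := x ++ f b :: e in
  pth Bfirst s p1 (map f u1) -> pth Blast (x ++ map f u1) p2 (map f n) ->
  pth Bfirst s' p1' (map f u1') -> pth Blast (x' ++ map f u1') p2' (map f n') ->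
  u1 <> [::] -> n <> [::] -> u1' <> [::] -> n' <> [::] ->
  agree (x ++ s) (x >* p1 ++ p2) n (x' >* p1' ++ p2') n'.
Proof.
move=> s x' p1p p2p p1p' p2p' u10 n0 u10' n0'.
have [t0 [v [v0 t0p]]] := absorbl (Blast_map e u10').
have tF : pth Bfirst (f b :: e ++ map f u1') ([:: f b] >* t0) (map f (b :: v)).
  exact: (@first_lact [:: b] _ _ _ _ _ t0p).
have tL : pth Blast (f b :: e ++ map f u1') ([:: f b] >* t0) (map f (b :: v)).
  exact: (@last_lact [:: f b] _ _ _ t0p).
move: ([:: f b] >* t0) tF tL => t tF tL.
have eF : pth Bfirst s ((f b :: e) >* p1') (f b :: e ++ map f u1').
  apply: (@pth_lact _ Bfirst _ (f b :: e) _ _ _ _ p1p') => w _.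
  by exists b, (e ++ w).
have [c cI] : exists c, inner (b :: v) c u1.
  apply: inner_connected => //; exists (pathinv ((f b :: e) >* p1' ++ t) ++ p1).
  by apply: pth_cat (pth_any p1p); apply: pth_inv; apply: pth_cat (pth_any eF) (pth_any tF).
have pp : pth anyword (x ++ s) (x >* p1 ++ p2) (map f n).
  exact: pth_cat (pthl x p1p) (pth_any p2p).
have pp' : pth anyword (x ++ s) (x' >* p1' ++ p2') (map f n').
  apply: pth_cat (pth_any p2p'); have := pthl x' p1p'.
  by rewrite /x' /s -!catA.
have [d dI] : exists d, inner n d n'.
  apply: inner_connected => //; exists (pathinv (x >* p1 ++ p2) ++ (x' >* p1' ++ p2')).
  exact: pth_cat (pth_inv pp) pp'.
exists d => //; have dL := inner_last [::] dI; rewrite lact0 in dL.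
have cF := inner_first [::] cI; rewrite ract0 !cats0 in cF.
apply: (@heq_trans _ _ simH _ (((x >* ((f b :: e) >* p1' ++ t ++ c)) ++ p2) ++ d)).
  apply: (heq_catr simH _ pp) (inner_pth dI).
  apply: (heq_catr simH) (pthl x p1p) p2p; apply: (heq_lact simH).
  exact: (coh_first p1p) (pth_cat eF (pth_cat tF cF)).
rewrite !lact_cat -lactM -!catA.
have E0 : x ++ f b :: e ++ map f u1' = x' ++ map f u1' by rewrite /x' -catA.
have xeF := pthl x eF; rewrite /s -cat_cons catA.
apply: (@heq_catl _ _ simH anyword _ _ (x ++ f b :: e ++ map f u1')).
  by rewrite E0; exact: (pthl x' p1p').
apply: coh_last; last by rewrite E0; exact: p2p'.
apply: pth_cat (last_lact x tL) _; apply: pth_cat (inner_last x cI) _.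
exact: pth_cat p2p dL.
Qed.

Lemma marked_eval_agree w p n p' n' : marked_eval w p n -> marked_eval w p' n' ->
  agree w p n p' n'.
Proof.
move=> ev ev'; have pp := marked_eval_pth ev; have pp' := marked_eval_pth ev'.
case: ev pp => n0 [x [s [p1 [u1 [p2 [Ew u10 p1p p2p ->]]]]]] pp.
subst w; case: ev' pp' => n0' [x' [s' [p1' [u1' [p2' [E u10' p1p' p2p' ->]]]]]] pp'.
have [b [z Ds]] := (pth_src p1p).1; have [b' [z' Ds']] := (pth_src p1p').1.
subst s s'; have [[Ex Eb Ez]|[e [Ex Ez]]|[e [Ex Ez]]] := cat_cons_split E.
- subst x' z'; rewrite -Eb in p1p'.
  have [|c cI] := inner_connected u10 u10'.
    by exists (pathinv p1 ++ p1'); apply: pth_cat (pth_inv (pth_any p1p)) (pth_any p1p').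
  have [|d dI] := inner_connected n0 n0'.
    exists (pathinv (x >* p1 ++ p2) ++ (x >* p1' ++ p2')).
    by apply: pth_cat (pth_inv pp) pp'.
  exists d => //.
  have cF := inner_first [::] cI; rewrite ract0 !cats0 in cF.
  have dL := inner_last [::] dI; rewrite lact0 in dL.
  apply: (@heq_trans _ _ simH _ (x >* p1 ++ x >* c ++ p2')).
    rewrite -catA; apply: (heq_catl simH (pthl x p1p)).
    by apply: coh_last; [apply: pth_cat p2p dL|apply: pth_cat (inner_last x cI) p2p'].
  rewrite catA -lact_cat; apply: (heq_catr simH) (pthl x _) p2p'; last exact: pth_cat p1p cF.
  by apply: (heq_lact simH); apply: coh_first (pth_cat p1p cF) p1p'.
- subst x' z; exact: (marked_eval_shift p1p p2p p1p' p2p').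
- subst x z'; apply: (agree_sym pp' pp); rewrite E.
  exact: (marked_eval_shift p1p' p2p' p1p p2p).
Qed.

Lemma marked_eval_left s y q1 v q2 m p n :
  pth Blast s q1 (map f v) -> pth Bfirst (map f v ++ y) q2 (map f m) ->
  v <> [::] -> m <> [::] -> marked_eval (s ++ y) p n -> agree (s ++ y) p n (q1 *< y ++ q2) m.
Proof.
move=> q1p q2p v0 m0 ev; have [z [b Ds]] := (pth_src q1p).1; subst s.
have [|p1 [u1 [p2 [n1 [n10 u10 p1p p2p]]]]] := @marked_eval_first z (f b :: y).
  by exists b, y.
have ev1 : marked_eval ((z ++ [:: f b]) ++ y) (z >* p1 ++ p2) n1.
  by split=> //; exists z, (f b :: y), p1, u1, p2; rewrite -catA.
apply: agree_trans (marked_eval_agree ev ev1) _; first exact: marked_eval_pth.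
have := @absorb_swap z [:: b] y _ _ _ _ _ _ _ _ p1p p2p q1p q2p.
by rewrite -catA; apply.
Qed.

Lemma Bin_marked_eval w : Bin w -> exists p n, marked_eval w p n.
Proof.
case=> x [b [z ->]].
have [|p1 [u1 [p2 [n [n0 u10 p1p p2p]]]]] := @marked_eval_first x (f b :: z).
  by exists b, z.
by exists (x >* p1 ++ p2), n; split=> //; exists x, (f b :: z), p1, u1, p2.
Qed.

Lemma Bin_cat u v : Bin (u ++ v) -> Bin u \/ Bin v.
Proof.
elim: u => [|a u IH] /=; first by right.
case=> [[|c x] [b [z []]]] => [-> _|_ E]; first by left; exists [::], b, u.
have [|[x' [b' [z' ->]]]|?] := IH; [by exists x, b, z| |by right].
by left; exists (a :: x'), b', z'.
Qed.

Hypothesis rule_ends : forall r, rules r -> Bin r.1 -> Bin r.2 ->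
  (Bfirst r.1 /\ Bfirst r.2) \/ (Blast r.1 /\ Blast r.2).

(** If neither context contains a [B]-letter, then both sides of the relation do,
   and [rule_ends] places the mark at an end of the relation. *)
Lemma marked_eval_edge l r b t p n p' n' : rules r ->
  marked_eval (l ++ rule_side r b ++ t) p n -> marked_eval (l ++ rule_side r (~~ b) ++ t) p' n' ->
  agree (l ++ rule_side r b ++ t) p n (Edge l r b t :: p') n'.
Proof.
move=> rr ev ev'; have pp := marked_eval_pth ev; have pp' := marked_eval_pth ev'.
set src := l ++ _ in ev pp *; set tgt := l ++ _ in ev' pp'.
have Bin_ev w q k : marked_eval w q k -> Bin w.
  case=> _ [x [s [p1 [u1 [p2 [-> _ H _ _]]]]]].
  by have [[c [z ->]] _] := pth_src H; exists x, c, z.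
have ep : pth anyword src [:: Edge l r b t] tgt by apply: pth_edge.
suff [[x [l1 [Dl F1 F2]]]|[t1 [y [Dt F1 F2]]]] :
  (exists x l1, [/\ l = x ++ l1, Bfirst (l1 ++ rule_side r b ++ t) &
     Bfirst (l1 ++ rule_side r (~~ b) ++ t)]) \/
  (exists t1 y, [/\ t = t1 ++ y, Blast (l ++ rule_side r b ++ t1) &
     Blast (l ++ rule_side r (~~ b) ++ t1)]).
- have [p1 [u1 [p2 [m [m0 u10 p1p p2p]]]]] := marked_eval_first x F1.
  have [p1' [u1' [p2' [m' [m0' u10' p1p' p2p']]]]] := marked_eval_first x F2.
  have ev1 : marked_eval src (x >* p1 ++ p2) m.
    by split=> //; exists x, (l1 ++ rule_side r b ++ t), p1, u1, p2; split; rewrite // /src Dl -catA.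
  have ev1' : marked_eval tgt (x >* p1' ++ p2') m'.
    by split=> //; exists x, (l1 ++ rule_side r (~~ b) ++ t), p1', u1', p2'; split; rewrite // /tgt Dl -catA.
  have eF : pth Bfirst (l1 ++ rule_side r b ++ t) [:: Edge l1 r b t]
      (l1 ++ rule_side r (~~ b) ++ t) by apply: pth_edge.
  have pp1' := marked_eval_pth ev1'.
  have [|c cI] := inner_connected u10 u10'.
    exists (pathinv p1 ++ [:: Edge l1 r b t] ++ p1').
    by apply: pth_cat (pth_inv (pth_any p1p)) (pth_cat (pth_any eF) (pth_any p1p')).
  have [|d dI] := inner_connected m0 m0'.
    exists (pathinv (x >* p1 ++ p2) ++ [:: Edge l r b t] ++ (x >* p1' ++ p2')).
    by apply: pth_cat (pth_inv (marked_eval_pth ev1)) (pth_cat ep pp1').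
  have cF := inner_first [::] cI; rewrite ract0 !cats0 in cF.
  have dL := inner_last [::] dI; rewrite lact0 in dL.
  apply: (agree_trans pp (marked_eval_agree ev ev1)).
  apply: (@agree_trans _ _ _ ([:: Edge l r b t] ++ (x >* p1' ++ p2')) m').
  + exact: marked_eval_pth.
  + exists d => //.
    have -> : [:: Edge l r b t] = x >* [:: Edge l1 r b t] by rewrite /lact /= Dl.
    rewrite (catA (x >* [:: _])) -lact_cat /src Dl -(catA x).
    apply: (@heq_trans _ _ simH _ ((x >* (p1 ++ c)) ++ p2')).
      rewrite lact_cat -!catA; apply: (heq_catl simH (pthl x p1p)).
      by apply: coh_last; [apply: pth_cat p2p dL|apply: pth_cat (inner_last x cI) p2p'].
    apply: (heq_catr simH) (pthl x (pth_cat p1p cF)) p2p'.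
    by apply: (heq_lact simH); apply: coh_first (pth_cat p1p cF) (pth_cat eF p1p').
  + have [e eI He] := marked_eval_agree ev1' ev'; exists e => //.
    by rewrite -catA; apply: (heq_catl simH ep).
- have [q1 [v [v0 q1p]]] := absorbl F1; have [q1' [v' [v0' q1p']]] := absorbl F2.
  have BF (u : seq (letter B)) : u <> [::] -> Bfirst (map f u ++ y).
    by case: u => // c u _; exists c, (map f u ++ y).
  have [q2 [m [m0 q2p]]] := absorbr (BF v v0); have [q2' [m' [m0' q2p']]] := absorbr (BF v' v0').
  have Ds c : l ++ rule_side r c ++ t = (l ++ rule_side r c ++ t1) ++ y by rewrite Dt -!catA.
  rewrite /src Ds in ev pp ep *; rewrite /tgt Ds in ev' pp' ep *; move=> {src tgt}.
  have A := marked_eval_left q1p q2p v0 m0 ev; have A' := marked_eval_left q1p' q2p' v0' m0' ev'.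
  have eL : pth Blast (l ++ rule_side r b ++ t1) [:: Edge l r b t1]
      (l ++ rule_side r (~~ b) ++ t1) by apply: pth_edge.
  have qp := pth_cat (pthr y q1p) (pth_any q2p); have qp' := pth_cat (pthr y q1p') (pth_any q2p').
  have [|c cI] := inner_connected v0 v0'.
    exists (pathinv q1 ++ [:: Edge l r b t1] ++ q1').
    by apply: pth_cat (pth_inv (pth_any q1p)) (pth_cat (pth_any eL) (pth_any q1p')).
  have [|d dI] := inner_connected m0 m0'.
    exists (pathinv (q1 *< y ++ q2) ++ [:: Edge l r b t] ++ (q1' *< y ++ q2')).
    by apply: pth_cat (pth_inv qp) (pth_cat ep qp').
  have cL := inner_last [::] cI; rewrite lact0 in cL.
  have dF := inner_first [::] dI; rewrite ract0 !cats0 in dF.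
  apply: (agree_trans pp A).
  apply: (@agree_trans _ _ _ ([:: Edge l r b t] ++ (q1' *< y ++ q2')) m') => //.
  + exists d => //.
    have -> : [:: Edge l r b t] = [:: Edge l r b t1] *< y by rewrite /ract /= Dt.
    rewrite [X in heq _ _ _ X]catA -ract_cat.
    apply: (@heq_trans _ _ simH _ (((q1 ++ c) *< y) ++ q2')).
      rewrite ract_cat -!(catA (q1 *< y)); apply: (heq_catl simH (pthr y q1p)).
      by apply: coh_first; [apply: pth_cat q2p dF|apply: pth_cat (inner_first y cI) q2p'].
    apply: (heq_catr simH) (pthr y (pth_cat q1p cL)) q2p'.
    by apply: (heq_ract simH); apply: coh_last (pth_cat q1p cL) (pth_cat eL q1p').
  + have [e eI He] := agree_sym pp' qp' A'; exists e => //.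
    by rewrite -(catA [:: Edge l r b t]); apply: (heq_catl simH ep).
have [] := Bin_cat (Bin_ev _ _ _ ev).
  by case=> x [c [z Dl]]; left; exists x, (f c :: z); split=> //; eexists _, _.
have Blt : Bin t -> exists t1 y, [/\ t = t1 ++ y, Blast (l ++ rule_side r b ++ t1) &
     Blast (l ++ rule_side r (~~ b) ++ t1)].
  case=> x [c [z ->]]; exists (x ++ [:: f c]), z.
  split; first by rewrite -catA.
    by exists (l ++ rule_side r b ++ x), c; rewrite -!catA.
  by exists (l ++ rule_side r (~~ b) ++ x), c; rewrite -!catA.
case/Bin_cat=> [Bb|/Blt]; last by right.
have [[x [c [z Dl]]]|] := Bin_cat (Bin_ev _ _ _ ev').
  by left; exists x, (f c :: z); split=> //; eexists _, _.
case/Bin_cat=> [Bnb|/Blt]; last by right.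
have : (Bfirst (rule_side r b) /\ Bfirst (rule_side r (~~ b))) \/
    (Blast (rule_side r b) /\ Blast (rule_side r (~~ b))).
  by case: (b) Bb Bnb => /= B1 B2; have [] := rule_ends rr => //; tauto.
case=> [[[c [z F1]] [c' [z' F2]]]|[[z [c F1]] [z' [c' F2]]]]; [left|right].
  exists l, [::]; rewrite cats0 F1 F2; split=> //; by eexists _, _.
exists [::], t; rewrite !cats0 F1 F2; split=> //.
  by exists (l ++ z), c; rewrite catA.
by exists (l ++ z'), c'; rewrite catA.
Qed.

Lemma marked_eval_path u p v q n q' n' : pth Bin u p v -> marked_eval u q n ->
  marked_eval v q' n' -> agree u q n (p ++ q') n'.
Proof.
elim: p u q n => [|[l r b t] p IH] u q n.
  by case=> _ _ <- ev ev'; apply: marked_eval_agree.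
case=> rr <- _ pp ev ev'; have [s [m evm]] := Bin_marked_eval (pth_src pp).1.
apply: (agree_trans (marked_eval_pth ev) (marked_eval_edge rr ev evm)).
have [d dI Hd] := IH _ _ _ pp evm ev'; exists d => //.
rewrite -cat1s -(cat1s (Edge l r b t)) -catA; apply: (heq_catl simH) Hd.
exact: (@pth_edge _ anyword l r b t rr I I).
Qed.

Lemma Bin_coherent : coherent sim Bin.
Proof.
move=> u p q v pp qp.
have [s [n ev]] := Bin_marked_eval (pth_src pp).1.
have [s' [n' ev']] := Bin_marked_eval (pth_tgt pp).1.
have [d dI Hd] := marked_eval_path pp ev ev'; have [e eI He] := marked_eval_path qp ev ev'.
apply: (heq_rcancel simH pp qp (marked_eval_pth ev')).
apply: (heq_trans simH (heq_sym simH Hd)); apply: (heq_trans simH) He.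
by apply: (heq_catl simH (marked_eval_pth ev)); apply: inner_coherent dI eI.
Qed.

End TwoSided.


(** * Presentations and evaluation of words *)

Section Evaluation.
Variable S : monoidType.
Local Open Scope group_scope.

Definition value A (v : A -> S) (w : seq A) : S := foldr (fun a s => v a * s) 1 w.

Lemma value_cat A (v : A -> S) u w : value v (u ++ w) = value v u * value v w.
Proof. by elim: u => [|a u IH] /=; rewrite ?mul1g // IH mulgA. Qed.

Lemma value_seq1 A (v : A -> S) a : value v [:: a] = v a.
Proof. exact: mulg1. Qed.

Lemma value_map A A' (f : A -> A') (v : A' -> S) w : value v (map f w) = value (v \o f) w.
Proof. by elim: w => //= a w ->. Qed.

Lemma connected_value (P : presentation) (v : letter P -> S) u w :
  (forall r, rules r -> value v r.1 = value v r.2) -> connected u w -> value v u = value v w.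
Proof.
move=> vr [p]; elim: p u => [|[l r b t] p IH] u /=; first by case=> _ _ ->.
case=> /vr rr <- _ /IH <-; rewrite /esrc /etgt /= !value_cat.
by case: b => /=; rewrite rr.
Qed.

(** The defining map of a presentation is determined by its values on letters;
    by [rules_congE] its kernel is connectedness in the derivation graph. *)
Lemma definesP (P : presentation) (T : set S) : defines P T <->
  exists v : letter P -> S, [/\
    forall u w, u <> [::] -> w <> [::] -> value v u = value v w <-> connected u w &
    value v @` Aplus (letter P) = T].
Proof.
split=> [[phi [phiM phiE phiT]]|[v [vE vT]]].
  exists (fun a => phi [:: a]).
  have E w : w <> [::] -> value (fun a => phi [:: a]) w = phi w.
    elim: w => // a [|b w] IH _; first by rewrite value_seq1.
    by rewrite -[a :: _]cat1s value_cat IH // phiM // value_seq1.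
  split=> [u w u0 w0|]; first by rewrite !E // phiE // rules_congE.
  by rewrite -phiT; apply: eq_imagel => w /E.
exists (value v); split=> // u w u0 w0; first exact: value_cat.
by rewrite vE // rules_congE.
Qed.

End Evaluation.

(** * Green's relations *)

Section Green.
Variable S : monoidType.
Local Open Scope group_scope.
Implicit Types (x y z e : S) (cl : S -> set S).

Lemma greenRP x y : greenR x y <-> (exists s, x = y * s) /\ (exists s, y = x * s).
Proof.
split=> [E|[[s xs] [t yt]]].
  have H a : range (fun s : S => a * s) a by exists 1; rewrite ?mulg1.
  split; first by have := H x; rewrite E => -[s _ <-]; exists s.
  by have := H y; rewrite -E => -[s _ <-]; exists s.
apply/seteqP; split=> z [w _ <-].
  by exists (s * w); rewrite // mulgA -xs.
by exists (t * w); rewrite // mulgA -yt.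
Qed.

Lemma greenLP x y : greenL x y <-> (exists s, x = s * y) /\ (exists s, y = s * x).
Proof.
split=> [E|[[s xs] [t yt]]].
  have H a : range (fun s : S => s * a) a by exists 1; rewrite ?mul1g.
  split; first by have := H x; rewrite E => -[s _ <-]; exists s.
  by have := H y; rewrite -E => -[s _ <-]; exists s.
apply/seteqP; split=> z [w _ <-].
  by exists (w * s); rewrite // -mulgA -xs.
by exists (w * t); rewrite // -mulgA -yt.
Qed.

(** A map [cl] with finitely many values stands for a division into finitely many
    classes.  The identity element of a subgroup has to represent its own class
    for the generators of the subgroup to have the expected values. *)
Lemma class_representatives cl (D : set S) e : finite_set (cl @` D) -> D e ->
  exists n (r : 'I_n -> S) (i0 : 'I_n), [/\ r i0 = e, forall i, D (r i),
    forall x, D x -> exists i, cl x = cl (r i) &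
    forall i j, cl (r i) = cl (r j) -> i = j].
Proof.
move=> /finite_setP[n]; rewrite card_eq_sym => /card_set_bijP[g [gfun ginj gsurj]] De.
have /choice[r rP] : forall i : 'I_n, exists x, D x /\ cl x = g i.
  by move=> i; have [x Dx <-] := gfun i (ltn_ord i); exists x.
have sur x : D x -> exists i : 'I_n, cl x = cl (r i).
  move=> Dx; have [|k kn gk] := gsurj (cl x); first by exists x.
  by exists (Ordinal kn); rewrite (rP _).2.
have inj i j : cl (r i) = cl (r j) -> i = j.
  by rewrite !(rP _).2 => /ginj H; apply: val_inj; apply: H; rewrite inE /=.
have [i0 Ei0] := sur e De.
exists n, (fun i => if i == i0 then e else r i), i0.
have E i : cl (if i == i0 then e else r i) = cl (r i) by case: eqP => // ->.
split=> [|i|x /sur[i Ei]|i j]; rewrite ?eqxx ?E //; last exact: inj.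
  by case: ifP => // _; case: (rP i).
by exists i; rewrite E.
Qed.

Lemma finite_greenL (D : set S) : finite_set [set I : set S | left_ideal I] ->
  finite_set ((fun x => range (fun s : S => s * x)) @` D).
Proof.
apply: sub_finite_set => _ [x _ <-]; split; first by exists (1 * x), 1.
by move=> s _ [t _ <-]; exists (s * t); rewrite ?mulgA.
Qed.

Lemma finite_greenR (D : set S) : finite_set [set I : set S | right_ideal I] ->
  finite_set ((fun x => range (fun s : S => x * s)) @` D).
Proof.
apply: sub_finite_set => _ [x _ <-]; split; first by exists (x * 1), 1.
by move=> s _ [t _ <-]; exists (t * s); rewrite ?mulgA.
Qed.

Section Idempotent.
Variables (e : S) (ee : e * e = e).

Lemma greenR_idem x : greenR x e -> e * x = x.
Proof. by case/greenRP=> -[s ->] _; rewrite mulgA ee. Qed.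

Lemma greenL_idem x : greenL x e -> x * e = x.
Proof. by case/greenLP=> -[s ->] _; rewrite -mulgA ee. Qed.

Lemma greenR_eP x : greenR x e <-> e * x = x /\ exists s, x * s = e.
Proof.
split=> [H|[ex [s xs]]]; first by split; [exact: greenR_idem|case/greenRP: H => _ [s ->]; exists s].
by apply/greenRP; split; [exists x|exists s].
Qed.

Lemma greenL_eP x : greenL x e <-> x * e = x /\ exists s, s * x = e.
Proof.
split=> [H|[ex [s xs]]]; first by split; [exact: greenL_idem|case/greenLP: H => _ [s ->]; exists s].
by apply/greenLP; split; [exists x|exists s].
Qed.

Lemma greenH_mul x y : greenH x e -> greenH y e -> greenH (x * y) e.
Proof.
move=> [/greenL_eP[xe [s sx]] /greenR_eP[ex [t xt]]].
move=> [/greenL_eP[ye [s' sy]] /greenR_eP[ey [t' yt]]]; split.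
  apply/greenL_eP; split; first by rewrite -mulgA ye.
  by exists (s' * s); rewrite mulgA -(mulgA s') sx -mulgA ey.
apply/greenR_eP; split; first by rewrite mulgA ex.
by exists (t' * t); rewrite mulgA -(mulgA x) yt xe.
Qed.

Lemma greenR_prefix x c : e * x = x -> greenR (x * c) e -> greenR x e.
Proof. by move=> ex /greenR_eP[_ [s xs]]; apply/greenR_eP; split=> //; exists (c * s); rewrite mulgA. Qed.

(** Left translation between two L-related elements of the R-class of [e]
    commutes with the right action of the monoid. *)
Lemma greenR_act x y c : greenR x e -> greenR y e -> greenL x y ->
  greenR (x * c) e -> greenR (y * c) e.
Proof.
move=> /greenR_eP[ex [x' xx']] /greenR_eP[ey [y' yy']] /greenLP[[s xs] [t yt]].
move=> /greenR_eP[_ [d xcd]]; apply/greenR_eP; split; first by rewrite mulgA ey.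
have ycd : y * c * d = t * e by rewrite yt -!mulgA (mulgA x) xcd.
by exists (d * x * y'); rewrite !mulgA ycd -(mulgA t) ex -yt.
Qed.

Lemma greenL_mulr x y c : greenL x y -> greenL (x * c) (y * c).
Proof.
move=> /greenLP[[s xs] [t yt]]; apply/greenLP; split.
  by exists s; rewrite mulgA -xs.
by exists t; rewrite mulgA -yt.
Qed.

End Idempotent.
End Green.

(** * Maximal subgroups inherit finite derivation type *)

(** The Reidemeister-Schreier method: the monoid acts by partial maps on the
    right cosets of the subgroup in the R-class of [e], and the generators of the
    subgroup are the pairs of a coset and a letter.  With a representative [r i]
    and a right inverse [r' i] for each coset, [(i, a)] has the value
    [r i * v a * r' j] where [j] is the coset reached from [i] by [a]; pairs for
    which [a] leaves the R-class are kept, with the value [e], so that all pairs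
    are letters. *)

Section Subgroup.
Variable S : monoidType.
Local Open Scope group_scope.
Variables (e : S) (ee : e * e = e).
Variables (P : presentation) (v : letter P -> S).
Local Notation A := (letter P).
Hypothesis vE : forall u w, u <> [::] -> w <> [::] -> value v u = value v w <-> connected u w.
Hypothesis v_surj : forall s : S, exists w, w <> [::] /\ value v w = s.

Local Notation D x := (greenR x e).
Local Notation cl := (fun x : S => range (fun s : S => s * x)).

Variables (n : nat) (r : 'I_n -> S) (i0 : 'I_n) (r' : 'I_n -> S) (cls : S -> 'I_n).
Hypothesis ri0 : r i0 = e.
Hypothesis rD : forall i, D (r i).
Hypothesis clsP : forall x, D x -> greenL x (r (cls x)).
Hypothesis r_inj : forall i j, cl (r i) = cl (r j) -> i = j.
Hypothesis rr' : forall i, r i * r' i = e.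
Hypothesis r'e : forall i, r' i * e = r' i.

Let er i : e * r i = r i. Proof. exact: greenR_idem (rD i). Qed.

Let cls_eq x y : D x -> D y -> greenL x y -> cls x = cls y.
Proof. by move=> /clsP + /clsP; rewrite /greenL => + + E; rewrite E => ->; apply: r_inj. Qed.

Let cls_r i : cls (r i) = i.
Proof. by apply: r_inj; rewrite -(clsP (rD i)). Qed.

(** The states are the L-classes in the R-class of [e], that is, the right
    cosets of the maximal subgroup in it; [None] is reached by words that leave
    this R-class. *)
Definition coset_next (t : option 'I_n) (a : A) : option 'I_n :=
  if t is Some i then
    if pselect (D (r i * v a)) then Some (cls (r i * v a)) else None
  else None.

Definition coset_letter (t : option 'I_n) (a : A) : 'I_n * A := (odflt i0 t, a).

Local Notation live := (fun t : option 'I_n => t : bool).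

Lemma coset_move i w : move coset_next (Some i) w =
  if pselect (D (r i * value v w)) then Some (cls (r i * value v w)) else None.
Proof.
elim/last_ind: w => [|w a IH].
  rewrite /= mulg1; case: pselect => [Di|nD]; first by rewrite cls_r.
  by case: nD; apply: rD.
rewrite /move foldl_rcons -/(move _ _ _) IH -cats1 value_cat value_seq1 mulgA.
set x := r i * value v w; case: (pselect (D x)) => [Dx|nDx] /=; last first.
  case: pselect => // Dxa; case: nDx; apply: (greenR_prefix ee) Dxa.
  by rewrite /x mulgA er.
have xr := clsP Dx; have rx := esym xr.
have act1 : D (x * v a) -> D (r (cls x) * v a) by exact: (greenR_act ee Dx (rD (cls x)) xr).
have act2 : D (r (cls x) * v a) -> D (x * v a) by exact: (greenR_act ee (rD (cls x)) Dx rx).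
case: (pselect (D (r (cls x) * v a))) => D1; case: (pselect (D (x * v a))) => D2 //=.
- by congr Some; apply: cls_eq => //; apply: greenL_mulr.
- by case: D2; apply: act2.
- by case: D1; apply: act1.
Qed.

Definition coset_val (b : 'I_n * A) : S :=
  let x := r b.1 * v b.2 in if pselect (D x) then x * r' (cls x) else e.

Let factor x : D x -> x = x * r' (cls x) * r (cls x).
Proof. by move=> /clsP/greenLP[[s E] _]; rewrite {2}E -(mulgA s) rr' -mulgA er -E. Qed.

Let coset_valH b : greenH (coset_val b) e.
Proof.
rewrite /coset_val; case: pselect => // Dx; set x := _ * _ in Dx *.
have /greenLP[_ [t rt]] := clsP Dx; have /(greenR_eP ee)[ex [y xy]] := Dx.
split; first apply/(greenL_eP ee).
  split; first by rewrite -mulgA r'e.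
  by exists t; rewrite mulgA -rt rr'.
apply/(greenR_eP ee); split; first by rewrite mulgA ex.
by exists (r (cls x) * y); rewrite mulgA -factor.
Qed.

Lemma coset_valP i w : D (r i * value v w) ->
  r i * value v w = value coset_val (trans coset_next coset_letter (Some i) w) *
                  r (cls (r i * value v w)).
Proof.
elim: w i => [|a w IH] i /=; first by rewrite mulg1 mul1g cls_r.
rewrite mulgA => Dxw; have Dx : D (r i * v a).
  by apply: (greenR_prefix ee) Dxw; rewrite mulgA er.
rewrite /coset_val /= -/coset_val; case: (pselect (D _)) => [D'|//] /=; clear D'.
set x := r i * v a in Dx Dxw *; have xr := clsP Dx.
have Drw : D (r (cls x) * value v w) by apply: (greenR_act ee Dx (rD _) xr).
rewrite {1}(factor Dx) -(mulgA (x * r' (cls x))) (IH _ Drw) mulgA; congr (_ * r _).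
by apply: cls_eq => //; apply: greenL_mulr; apply: esym.
Qed.

Let H := [set x : S | greenH x e].

Let val_H w : w <> [::] -> greenH (value coset_val w) e.
Proof.
elim: w => // a [|b w] IH _; first by rewrite value_seq1; apply: coset_valH.
by rewrite -cat1s value_cat value_seq1; apply: (greenH_mul ee) (coset_valH a) (IH _).
Qed.

Variable psi : 'I_n * A -> seq A.
Hypothesis psi_neq0 : forall b, psi b <> [::].
Hypothesis psi_val : forall b, value v (psi b) = coset_val b.

Local Notation tr := (trans coset_next coset_letter).
Local Notation psis := (fun w => flatten (map psi w)).

Let psis_val w : value v (psis w) = value coset_val w.
Proof. by elim: w => //= b w IH; rewrite value_cat IH psi_val. Qed.

Let psis_neq0 w : w <> [::] -> psis w <> [::].
Proof. by case: w => // b w _ /=; case: (psi b) (@psi_neq0 b). Qed.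

Let H_e x : H x -> e * x = x /\ x * e = x.
Proof. by case=> /(greenL_idem ee) ? /(greenR_idem ee). Qed.

Let coset_loop w : H (value v w) -> move coset_next (Some i0) w = Some i0.
Proof.
move=> Hw; rewrite coset_move ri0 (H_e Hw).1; case: Hw => Lw Rw.
case: (pselect (D (value v w))) => [Dw|//]; congr Some.
by rewrite -[RHS]cls_r ri0; apply: cls_eq.
Qed.

(** The relations of the second kind turn every word into a translate of a word
    of the monoid; those of the first kind relate the translates to each other. *)
Definition subgroup_rules : set (seq ('I_n * A) * seq ('I_n * A)) :=
  [set x | exists t q, [/\ rules q, move coset_next t q.1 : bool & x = (tr t q.1, tr t q.2)]]
  `|` range (fun b => ([:: b], tr (Some i0) (psi b))).

Let tr_neq0 t w : w <> [::] -> tr t w <> [::].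
Proof. by case: w. Qed.

Lemma subgroup_rules_Aplus : subgroup_rules `<=` Aplus _ `*` Aplus _.
Proof.
move=> x [[t [q [/rules_Aplus[q1 q2] _ ->]]]|[b _ <-]]; split=> //=; try exact: tr_neq0.
Qed.

Definition subgroup_pres := Presentation subgroup_rules_Aplus.
Local Notation Q := subgroup_pres.

Let live_next t a : live (coset_next t a) -> live t.
Proof. by case: t. Qed.

Let move_None w : move coset_next None w = None.
Proof. by elim: w. Qed.

Let move_rule t q : @rules P q -> move coset_next t q.1 = move coset_next t q.2.
Proof.
move=> rq; case: t => [i|]; last by rewrite !move_None.
have [q1 q2] := rules_Aplus rq.
by rewrite !coset_move (vE q1 q2).2 //; apply: connected_rule.
Qed.

Let trans_rule t q : @rules P q -> live (move coset_next t q.1) ->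
  @rules Q (tr t q.1, tr t q.2).
Proof. by move=> rq lq; left; exists t, q. Qed.

Let rules_val q : @rules Q q -> value coset_val q.1 = value coset_val q.2.
Proof.
case=> [[[i|] [q' [rq lq ->]]]|[b _ <-]]; last 2 first.
- by rewrite move_None in lq.
- rewrite /= mulg1; have [eb be] := H_e (coset_valH b).
  have lb : move coset_next (Some i0) (psi b) = Some i0.
    by apply: coset_loop; rewrite psi_val; apply: coset_valH.
  have Db : D (r i0 * value v (psi b)).
    by rewrite psi_val ri0 eb; case: (coset_valH b).
  have := coset_valP Db; rewrite psi_val ri0 eb => E.
  have -> : coset_val b = coset_val b * e by rewrite be.
  have cb : cls (coset_val b) = i0.
    by rewrite -[RHS]cls_r ri0; apply: cls_eq => //; case: (coset_valH b).
  rewrite cb ri0 in E; rewrite be E.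
  by apply: (H_e _).2; apply: val_H; apply/tr_neq0/psi_neq0.
have [q1 q2] := rules_Aplus rq; have Ev := (vE q1 q2).2 (connected_rule rq).
move: lq; rewrite coset_move; case: pselect => [Dq _|//].
have Dq2 : D (r i * value v q'.2) by rewrite -Ev.
have E1 := coset_valP Dq; have E2 := coset_valP Dq2; rewrite -Ev in E2.
move: (cls _) E1 E2 => j E1 E2; have := congr1 (fun z => z * r' j) (etrans (esym E1) E2).
rewrite /= -!mulgA rr'.
by rewrite (H_e (val_H (tr_neq0 (t := Some i) q1))).2 (H_e (val_H (tr_neq0 (t := Some i) q2))).2.
Qed.

Let letter_edge (x : seq ('I_n * A)) b : edge ('I_n * A) :=
  Edge x ([:: b], tr (Some i0) (psi b)) true [::].

(* The scanner replaces each letter [b] by the translate of [psi b]; its states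
   are the words of the monoid that have been read so far in this way. *)
Let ok w := w <> [::] /\ H (value v w).
Let step w b := w ++ psi b.
Let stepp w b := [:: letter_edge (tr (Some i0) w) b].

Let ok_cat u w : ok u -> ok w -> ok (u ++ w).
Proof. by move=> [u0 Hu] [w0 Hw]; split; [case: (u) u0|rewrite value_cat; apply: greenH_mul]. Qed.

Let ok_psis w : w <> [::] -> ok (psis w).
Proof. by move=> w0; split; [exact: psis_neq0|rewrite psis_val; apply: val_H]. Qed.

Let tr_cat u w : ok u -> tr (Some i0) (u ++ w) = tr (Some i0) u ++ tr (Some i0) w.
Proof. by move=> [_ Hu]; rewrite trans_cat coset_loop. Qed.

Let stepP x b : pth (P := Q) anyword (x ++ [:: b]) [:: letter_edge x b] (x ++ tr (Some i0) (psi b)).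
Proof.
have rb : @rules Q ([:: b], tr (Some i0) (psi b)) by right; exists b.
by have := @pth_edge Q anyword x _ true [::] rb I I; rewrite !cats0.
Qed.

Let run_psis u w : run (P := Q) step u w = u ++ psis w.
Proof. by elim: w u => [|b w IH] u /=; rewrite ?cats0 // IH /step catA. Qed.

Let runp_shift u x w : ok u -> (x <> [::] -> ok x) -> runp (P := Q) step stepp (u ++ x) w =
  tr (Some i0) u >* runp (P := Q) step stepp x w.
Proof.
elim: w x => // b w IH x oku okx.
rewrite !runp_cons lact_cat -lract.
have -> : step (u ++ x) b = u ++ step x b by rewrite /step catA.
rewrite IH //; last first.
  move=> _; have okb : ok (psi b) by have := @ok_psis [:: b]; rewrite /= cats0; apply.
  by case: (x) okx => // c y /(_ ltac:(done)) H'; apply: ok_cat.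
congr (_ *< _ ++ _).
by rewrite /stepp /letter_edge /lact /= tr_cat.
Qed.

Let pth_runp w : w <> [::] -> pth (P := Q) anyword w (runp (P := Q) step stepp [::] w)
  (tr (Some i0) (psis w)).
Proof.
elim: w => // b w IH _; rewrite runp_cons.
have okb : ok (psi b) by have := @ok_psis [:: b]; rewrite /= cats0; apply.
have e0 : pth (P := Q) anyword [:: b] (stepp [::] b) (tr (Some i0) (psi b)) by apply: (stepP [::] b).
have -> : step [::] b = psi b ++ [::] by rewrite cats0.
rewrite runp_shift //; case: w IH => [|c w] IH.
  by rewrite ract0 /= !cats0; exact: e0.
rewrite [psis _]/= tr_cat // -cat1s; apply: pth_cat (pthr _ e0) (pthl _ (IH _)); done.
Qed.

Let connected_psis w : w <> [::] -> @connected Q w (tr (Some i0) (psis w)).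
Proof. by move=> w0; exists (runp (P := Q) step stepp [::] w); apply: pth_runp. Qed.

Let transP u p w : ok u -> pth (P := P) anyword u p w -> pth (P := Q) anyword
  (tr (Some i0) u) (map (trans_edge coset_next coset_letter (Some i0)) p) (tr (Some i0) w).
Proof.
move=> [_ Hu] pp; apply: (trans_pth (live := live) live_next move_rule trans_rule pp) => //.
by rewrite coset_loop.
Qed.

Let psis_connected u w : u <> [::] -> w <> [::] -> value coset_val u = value coset_val w ->
  @connected P (psis u) (psis w).
Proof. by move=> u0 w0 E; apply/vE; rewrite ?psis_val //; apply: psis_neq0. Qed.

Lemma subgroup_defines : defines Q H.
Proof.
apply/definesP; exists coset_val; split=> [u w u0 w0|].
  split=> [/psis_connected[] // p /(transP (ok_psis u0)) pp|]; last exact: connected_value.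
  apply: connected_trans (connected_psis u0) _.
  apply: connected_trans (connected_sym (connected_psis w0)).
  by exists (map (trans_edge coset_next coset_letter (Some i0)) p).
apply/seteqP; split=> [_ [w w0 <-]|h Hh]; first exact: val_H.
have [w [w0 wh]] := v_surj h; have [eh he] := H_e Hh.
exists (tr (Some i0) w); first exact: tr_neq0.
have Dw : D (r i0 * value v w) by rewrite wh ri0 eh; case: Hh.
have := coset_valP Dw; rewrite wh ri0 eh.
have -> : cls h = i0 by rewrite -[RHS]cls_r ri0; apply: cls_eq => //; case: Hh.
by rewrite ri0 (H_e (val_H _)).2 //; apply: tr_neq0.
Qed.

Hypothesis finP : finite_presentation P.
Hypothesis fdtP : presentation_fdt P.

Lemma subgroup_finite : finite_presentation Q.
Proof.
case: finP => finA finR; split.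
  have : finite_set ([set: 'I_n] `*` [set: A]) by apply: finite_setX => //; exact: finite_finset.
  by apply: sub_finite_set.
rewrite /= /subgroup_rules finite_setU; split; last first.
  apply: finite_image.
  have : finite_set ([set: 'I_n] `*` [set: A]) by apply: finite_setX => //; exact: finite_finset.
  by apply: sub_finite_set.
apply: (sub_finite_set (B := [set (tr t q.1, tr t q.2) | t in [set: option 'I_n] & q in @rules P])).
  by move=> _ [t [q [rq _ ->]]]; exists t => //; exists q.
by apply: finite_image2 => //; exact: finite_finset.
Qed.

(** One homotopy for each relation of the subgroup: it says that the relation
    is the translate of a path between words over the letters of the monoid. *)
Let rule_homotopy sim := forall q, @rules Q q -> forall b, [set: bool] b ->
  exists2 p, pth (P := P) anyword (psis (rule_side q b)) p (psis (rule_side q (~~ b))) &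
    heq sim (rule_side q b)
      (Edge [::] q b [::] :: runp (P := Q) step stepp [::] (rule_side q (~~ b)))
      (runp (P := Q) step stepp [::] (rule_side q b) ++
         map (trans_edge coset_next coset_letter (Some i0)) p).

Let rule_homotopy_forced : finitely_forced (P := Q) rule_homotopy.
Proof.
apply: finitely_forced_all => [|q rq]; first by case: subgroup_finite.
apply: finitely_forced_all => [|b _]; first exact: finite_finset.
have q0 c := @rule_side_neq0 Q q c rq.
have [|p pp] := psis_connected (q0 b) (q0 (~~ b)).
  by case: (b) => /=; rewrite rules_val.
have ep : pth (P := Q) anyword (rule_side q b) [:: Edge [::] q b [::]] (rule_side q (~~ b)).
  by have := @pth_edge Q anyword [::] _ b [::] rq I I; rewrite !cats0.
apply: finitely_forced_sub (finitely_forced_heq (pth_cat ep (pth_runp (q0 (~~ b))))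
  (pth_cat (pth_runp (q0 b)) (transP (ok_psis (q0 b)) pp))) => sim _ Hq.
by exists p.
Qed.

Lemma subgroup_fdt : presentation_fdt Q.
Proof.
have fin_state : finite_set [set: option 'I_n] by exact: finite_finset.
have tcoh := @transducer_coherent P Q (option 'I_n) live coset_next coset_letter
  live_next move_rule trans_rule fin_state fdtP.
apply: finitely_forced_fdt; apply: finitely_forced_sub
  (finitely_forced_and tcoh rule_homotopy_forced) => sim simH [coh ruleH].
pose wd := tr (Some i0).
pose inner u p w := [/\ ok u, ok w & exists2 q, pth (P := P) anyword u q w &
  p = map (trans_edge coset_next coset_letter (Some i0)) q].
suff: coherent (P := Q) sim (starting (fun=> True)).
  move=> C u p q w pp qp; have sub x y s : pth (P := Q) anyword x s y ->
      pth (P := Q) (starting (fun=> True)) x s y.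
    elim: s x => [|a s IH] x /=; first by case=> _; case: x.
    case=> ra <- _ /IH ?; split=> //.
    by case: (esrc a) (@esrc_neq0 Q a ra).
  by apply: C (sub _ _ _ pp) (sub _ _ _ qp).
have innerP u p w : inner u p w -> pth (P := Q) anyword (wd u) p (wd w).
  by case=> oku _ [q qp ->]; apply: transP.
have okpsi b : ok (psi b) by have := @ok_psis [:: b]; rewrite /= cats0; apply.
apply: (@scan_coherent Q sim simH _ ok wd inner (fun=> True) psi (stepp [::]) step stepp) => //.
- by move=> u [u0 _]; apply: tr_neq0.
- by move=> u b oku; apply: ok_cat.
- by move=> b _; apply: (stepP [::] b).
- by move=> u b oku; rewrite /wd tr_cat //; apply: stepP.
- by move=> u oku; split=> //; exists [::] => //; split=> //; case: oku.
- move=> u p w q x [oku okw [p' pp ->]] [_ okx [q' qp ->]]; split=> //.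
  by exists (p' ++ q'); [apply: pth_cat pp qp|rewrite map_cat].
- move=> u p q w [oku okw [p' pp ->]] [_ _ [q' qp ->]].
  by apply: coh pp qp _; rewrite coset_loop //; case: oku.
- move=> u p w b oku okw [_ _ [p' pp ->]].
  have pQ := transP oku pp; exists (map (trans_edge coset_next coset_letter (Some i0)) p' *< wd (psi b)).
    split; [exact: ok_cat|exact: ok_cat|exists (p' *< psi b); first exact: pthr pp].
    by rewrite (trans_ract (Q := Q) coset_letter move_rule _ _ pp) coset_loop //; case: oku.
  have := heq_xchg simH pQ (stepP [::] b).
  have E x : x >* [:: letter_edge [::] b] = [:: letter_edge x b] by rewrite /lact /= cats0.
  by rewrite !E.
- move=> u q b oku rq; have q0 c := @rule_side_neq0 Q q c rq.
  have [p pp Hp] := ruleH q rq b I; rewrite !run_psis.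
  exists (map (trans_edge coset_next coset_letter (Some i0)) (u >* p)).
    split; [exact: ok_cat oku (ok_psis (q0 _))|exact: ok_cat oku (ok_psis (q0 _))|].
    by exists (u >* p) => //; apply: pthl pp.
  have Er z : runp (P := Q) step stepp u z = wd u >* runp (P := Q) step stepp [::] z.
    by have := @runp_shift u [::] z oku ltac:(done); rewrite cats0.
  rewrite !Er.
  rewrite (trans_lact (P := P) (Q := Q)) coset_loop; last by case: oku.
  rewrite -lact_cat; have := heq_lact simH (wd u) Hp.
  by rewrite /lact /= !cats0.
- move=> q b N p N' p' rq; have q0 c := @rule_side_neq0 Q q c rq.
  have [s sp Hs] := ruleH q rq b I.
  have side c M m : eval (P := Q) psi (stepp [::]) step stepp (rule_side q c) M m ->
      M = psis (rule_side q c) /\ m = runp (P := Q) step stepp [::] (rule_side q c).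
    by case: (rule_side q c) => //= x z [-> ->]; rewrite run_psis.
  move=> _ _ /side[-> ->] /side[-> ->].
  exists (map (trans_edge coset_next coset_letter (Some i0)) s) => //.
  by split; [exact: ok_psis|exact: ok_psis|exists s].
Qed.

End Subgroup.

Theorem maximal_subgroup_fdt (S : monoidType) :
  finite_set [set I : set S | left_ideal I] -> has_fdt [set: S] ->
  forall H : set S, maximal_subgroup H -> has_fdt H.
Proof.
move=> finL [P [finP /definesP[v [vE vT]] fdtP]] _ [e [ee ->]].
have v_surj s : exists w, w <> [::] /\ value v w = s.
  have : [set: S] s by []. by rewrite -vT => -[w w0 <-]; exists w.
have De : [set x : S | greenR x e] e by [].
have [n [r [i0 [ri0 rD rsur rinj]]]] :=
  class_representatives (finite_greenL [set x : S | greenR x e] finL) De.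
have /choice[cls clsP] : forall x, exists i, greenR x e -> greenL x (r i).
  by move=> x; have [/rsur[i Ei]|nx] := pselect (greenR x e); [exists i|exists i0].
have /choice[r' r'P] : forall i, exists s, (r i * s = e /\ s * e = s)%g.
  move=> i; have [_ [s rs]] := (greenR_eP ee _).1 (rD i).
  by exists (s * e)%g; rewrite mulgA rs ee -mulgA ee.
have /choice[psi psiP] : forall b, exists w, w <> [::] /\
    value v w = coset_val e v r r' cls b by move=> b; apply: v_surj.
pose psi0 b := (psiP b).1.
exists (subgroup_pres e v r i0 cls psi0); split.
- exact: subgroup_finite.
- apply: (subgroup_defines ee vE v_surj ri0 rD clsP rinj (r' := r')) => // [i|i|b].
  + exact: (r'P i).1.
  + exact: (r'P i).2.
  + exact: (psiP b).2.
- apply: (subgroup_fdt ee vE ri0 rD clsP rinj (r' := r')) => // [i|i|b].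
  + exact: (r'P i).1.
  + exact: (r'P i).2.
  + exact: (psiP b).2.
Qed.


(** * The elements of an ideal above a smaller one *)

(** [I] and [I `|` D] are ideals, or [I] is empty, and any two elements of [D]
    generate the same ideal. *)

Section Layer.
Variable S : monoidType.
Local Open Scope group_scope.
Variables (I D : set S) (e : S).
Hypothesis I_mull : forall s x, I x -> I (s * x).
Hypothesis I_mulr : forall s x, I x -> I (x * s).
Hypothesis ID_mull : forall s x, D x -> I (s * x) \/ D (s * x).
Hypothesis ID_mulr : forall s x, D x -> I (x * s) \/ D (x * s).
Hypothesis DnI : forall x, D x -> ~ I x.
Hypothesis D_conn : forall a b, D a -> D b -> exists u v, b = u * a * v.
Hypothesis finL : finite_set [set I : set S | left_ideal I].
Hypothesis finR : finite_set [set I : set S | right_ideal I].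
Hypothesis ee : e * e = e.
Hypothesis De : D e.

Lemma pigeonhole (cl : S -> set S) (f : nat -> S) : finite_set (cl @` [set: S]) ->
  exists i j, (i < j)%N /\ cl (f i) = cl (f j).
Proof.
move=> fin; have [n [r [_ [_ _ rsur _]]]] := class_representatives fin (Logic.I : [set: S] 1).
have /choice[c cP] : forall s, exists i : 'I_n, cl s = cl (r i) by move=> s; apply: rsur.
have : ~~ injectiveb (fun k : 'I_n.+1 => c (f k)).
  by apply/injectiveP => /leq_card; rewrite !card_ord ltnn.
case/injectivePn=> i [j ij Eij].
have E : cl (f i) = cl (f j) by rewrite cP Eij -cP.
have [lij|lji|eij] := ltngtP i j; [by exists i, j|by exists j, i|].
by case/eqP: ij; apply: val_inj.
Qed.

(** Stability.  If [a = u * (a * s) * t] then [a = u ^+ k * a * (s * t) ^+ k] for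
    all [k], and two of the elements [a * (s * t) ^+ k] generate the same right
    ideal; multiplying by a power of [u] shows that [a] belongs to the right ideal
    of [a * s]. *)
Lemma layer_greenR a s : D a -> D (a * s) -> greenR (a * s) a.
Proof.
move=> Da Das; apply/greenRP; split; first by exists s.
have [u [t E]] := D_conn Das Da.
have iter k : a = u ^+ k * a * (s * t) ^+ k.
  elim: k => [|k IH]; first by rewrite !expg0 mul1g mulg1.
  by rewrite {1}IH {1}E expgSr [(s * t) ^+ k.+1]expgS !mulgA.
have [i [j [lij]]] := pigeonhole (fun k => a * (s * t) ^+ k) (finite_greenR _ finR).
move=> /(greenRP _ _)[[y Ey] _].
have : a = a * (s * t) ^+ (j - i) * y.
  rewrite {1}(iter i) -[u ^+ i * a * _]mulgA Ey -{1}(subnK (ltnW lij)) addnC expgnDr.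
  by rewrite !mulgA -iter.
rewrite -(prednK (n := j - i)) ?subn_gt0 // expgS => Ea.
by exists (t * (s * t) ^+ (j - i).-1 * y); rewrite {1}Ea !mulgA.
Qed.

Lemma layer_greenL a s : D a -> D (s * a) -> greenL (s * a) a.
Proof.
move=> Da Das; apply/greenLP; split; first by exists s.
have [u [t E]] := D_conn Das Da.
have iter k : a = (u * s) ^+ k * a * t ^+ k.
  elim: k => [|k IH]; first by rewrite !expg0 mul1g mulg1.
  by rewrite {1}IH {1}E [(u * s) ^+ k.+1]expgSr expgS !mulgA.
have [i [j [lij]]] := pigeonhole (fun k => (u * s) ^+ k * a) (finite_greenL _ finL).
move=> /(greenLP _ _)[[y Ey] _].
have : a = y * (u * s) ^+ (j - i) * a.
  rewrite {1}(iter i) Ey -{1}(subnK (ltnW lij)) expgnDr.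
  by rewrite [in RHS](iter i) !mulgA.
rewrite -(prednK (n := j - i)) ?subn_gt0 // expgSr => Ea.
by exists (y * (u * s) ^+ (j - i).-1 * u); rewrite {1}Ea !mulgA.
Qed.

Lemma greenR_layer x a : greenR x a -> D a -> D x.
Proof.
move=> /greenRP[[s ->] [t E]] Da; have [Ix|//] := ID_mulr s Da.
by case: (DnI Da); rewrite E; apply: I_mulr.
Qed.

Lemma greenL_layer x a : greenL x a -> D a -> D x.
Proof.
move=> /greenLP[[s ->] [t E]] Da; have [Ix|//] := ID_mull s Da.
by case: (DnI Da); rewrite E; apply: I_mull.
Qed.

End Layer.

(** The Rees coordinates of a layer, without its sandwich matrix: [x] and [y]
    represent the R-classes in the L-class of [e] and the L-classes in the R-class
    of [e], and [H] is the H-class of [e]. *)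
Record coordinates (S : monoidType) (D H : set S) n m (x : 'I_n -> S) (y : 'I_m -> S) : Prop := {
  coord_mem : forall i g k, H g -> D (x i * g * y k)%g;
  coord_surj : forall s, D s -> exists i g k, H g /\ s = (x i * g * y k)%g;
  coord_inj : forall i g k j h l, H g -> H h ->
    (x i * g * y k = x j * h * y l)%g -> [/\ i = j, g = h & k = l];
  coord_act : forall k s, D (y k * s)%g -> exists h l, H h /\ (y k * s = h * y l)%g;
  coord_xD : forall i, D (x i);
  coord_yD : forall k, D (y k);
  coord_HD : forall h, H h -> D h;
  coord_hyD : forall h k, H h -> D (h * y k)%g;
  coord_hy_inj : forall g k h l, H g -> H h -> (g * y k = h * y l)%g -> g = h /\ k = l
}.

Section Coordinates.
Variable S : monoidType.
Local Open Scope group_scope.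
Variables (I D : set S) (e : S).
Hypothesis I_mull : forall s x, I x -> I (s * x).
Hypothesis I_mulr : forall s x, I x -> I (x * s).
Hypothesis ID_mull : forall s x, D x -> I (s * x) \/ D (s * x).
Hypothesis ID_mulr : forall s x, D x -> I (x * s) \/ D (x * s).
Hypothesis DnI : forall x, D x -> ~ I x.
Hypothesis D_conn : forall a b, D a -> D b -> exists u v, b = u * a * v.
Hypothesis finL : finite_set [set I : set S | left_ideal I].
Hypothesis finR : finite_set [set I : set S | right_ideal I].
Hypothesis ee : e * e = e.
Hypothesis De : D e.

Local Notation H := [set h : S | greenH h e].

Lemma layer_coordinates : exists n m (x : 'I_n -> S) (y : 'I_m -> S), coordinates D H x y.
Proof.
have Rr : greenR e e by []. have Ll : greenL e e by [].
have [n [x [i0 [_ xL xsur xinj]]]] :=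
  class_representatives (finite_greenR [set z : S | greenL z e] finR) Ll.
have [m [y [k0 [_ yR ysur yinj]]]] :=
  class_representatives (finite_greenL [set z : S | greenR z e] finL) Rr.
have xe i : x i * e = x i by apply: greenL_idem (xL i).
have ey k : e * y k = y k by apply: greenR_idem (yR k).
have /choice[x' x'x] : forall i, exists s, s * x i = e.
  by move=> i; have [_] := (greenL_eP ee _).1 (xL i).
have /choice[y' yy'] : forall k, exists s, y k * s = e.
  by move=> k; have [_] := (greenR_eP ee _).1 (yR k).
have Re_D z : greenR z e -> D z by move=> /(greenR_layer I_mulr ID_mulr DnI); apply.
have Le_D z : greenL z e -> D z by move=> /(greenL_layer I_mull ID_mull DnI); apply.
have Rfact z : greenR z e -> exists h k, H h /\ z = h * y k.
  move=> zR; have [k /(greenLP _ _)[[s zs] [t ys]]] := ysur z zR.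
  have [ez [d zd]] := (greenR_eP ee _).1 zR.
  pose h := z * (y' k * e).
  have hz : h * y k = z.
    by rewrite /h -!mulgA ey {1}zs -mulgA (mulgA (y k)) yy' ey -zs.
  exists h, k; split=> //; split.
    apply/(greenL_eP ee); split; first by rewrite /h -!mulgA ee.
    by exists t; rewrite /h mulgA -ys mulgA yy' ee.
  apply/(greenR_eP ee); split; first by rewrite /h mulgA ez.
  by exists (y k * d); rewrite mulgA hz.
have Lfact z : greenL z e -> exists i g, H g /\ z = x i * g.
  move=> zL; have [i /(greenRP _ _)[[s zs] [t xs]]] := xsur z zL.
  have [ze [d dz]] := (greenL_eP ee _).1 zL.
  pose g := e * x' i * z.
  have gz : x i * g = z.
    by rewrite /g !mulgA xe {1}zs -!mulgA (mulgA (x' i)) x'x (mulgA (x i)) xe -zs.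
  exists i, g; split=> //; split.
    apply/(greenL_eP ee); split; first by rewrite /g -!mulgA ze.
    by exists (d * x i); rewrite -mulgA gz.
  apply/(greenR_eP ee); split; first by rewrite /g !mulgA ee.
  by exists t; rewrite /g -!mulgA -xs x'x ee.
have HgL g : H g -> g * e = g by case=> /(greenL_idem ee).
have HgR g : H g -> e * g = g by case=> _ /(greenR_idem ee).
have Hinv g : H g -> exists h, g * h = e.
  by case=> _ /(greenR_eP ee)[].
have Hinvl g : H g -> exists h, h * g = e.
  by case=> /(greenL_eP ee)[].
have xRg i g k : H g -> greenR (x i * g * y k) (x i).
  move=> Hg; have [h gh] := Hinv g Hg; apply/greenRP; split; first by exists (g * y k); rewrite mulgA.
  by exists (y' k * h); rewrite -!mulgA (mulgA (y k)) yy' (mulgA g) HgL // gh xe.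
have yLg g k : H g -> greenL (g * y k) (y k).
  move=> Hg; have [h hg] := Hinvl g Hg; apply/greenLP; split; first by exists g.
  by exists h; rewrite mulgA hg ey.
have hyR h k : H h -> greenR (h * y k) e.
  move=> Hh; have [g hg] := Hinv h Hh; apply/(greenR_eP ee); split; first by rewrite mulgA HgR.
  by exists (y' k * g); rewrite -!mulgA (mulgA (y k)) yy' (mulgA h) HgL.
have hy_inj g k h l : H g -> H h -> g * y k = h * y l -> g = h /\ k = l.
  move=> Hg Hh E; have kl : k = l.
    by apply: yinj; rewrite -(yLg g k Hg) -(yLg h l Hh) E.
  split=> //; move: E; rewrite -kl => /(congr1 (fun z => z * y' k)).
  by rewrite -!mulgA yy' !HgL.
exists n, m, x, y; split=> //.
- move=> i g k Hg; apply: (greenR_layer I_mulr ID_mulr DnI (xRg i g k Hg)).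
  exact: Le_D (xL i).
- move=> s Ds; have [u [v E]] := D_conn De Ds.
  have Due : D (u * e).
    by have [Iu|//] := ID_mull u De; case: (DnI Ds); rewrite E; apply: I_mulr.
  have Dev : D (e * v).
    by have [Iv|//] := ID_mulr v De; case: (DnI Ds); rewrite E -mulgA; apply: I_mull.
  have [i [g [Hg Eg]]] := Lfact _ (layer_greenL D_conn finL De Due).
  have [h [k [Hh Eh]]] := Rfact _ (layer_greenR D_conn finR De Dev).
  exists i, (g * h), k; split; first exact: (greenH_mul ee).
  by rewrite E -{1}ee !mulgA -(mulgA _ e v) Eg Eh !mulgA.
- move=> i g k j h l Hg Hh E.
  have ij : i = j by apply: xinj; rewrite -(xRg i g k Hg) -(xRg j h l Hh) E.
  subst j; have [] : g = h /\ k = l; last by [].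
  apply: hy_inj => //; have := congr1 (fun z => x' i * z) E.
  by rewrite !mulgA x'x !HgR.
- move=> k s Dys; apply: Rfact.
  have := layer_greenR D_conn finR (Re_D _ (yR k)) Dys.
  by rewrite /greenR => ->; apply: yR.
- by move=> i; apply: Le_D (xL i).
- by move=> k; apply: Re_D (yR k).
- by move=> h [/Le_D].
- by move=> h k /hyR/(Re_D _).
Qed.

End Coordinates.


(** * Adding a layer to an ideal preserves finite derivation type *)

(** [B] presents the ideal [I] and [G] the group [H] of the layer [D].  Words over
    the letters of [B] and [G] and over the coordinates [x i] and [y k] are
    scanned from left to right.  As long as the value stays in the layer the
    state is a word [x i] [V] [y k] with [V] a group word, and a letter [a] only
    involves [y k]; when [y k * a] falls into [I] the letters before it are
    absorbed from the right.  After that the state is a [B]-word. *)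

Section AddLayer.
Variable S : monoidType.
Local Open Scope group_scope.
Variables (I D H : set S).
Hypothesis S_regular : regular_semigroup S.
Hypothesis I_mull : forall s x, I x -> I (s * x).
Hypothesis I_mulr : forall s x, I x -> I (x * s).
Hypothesis ID_mull : forall s x, D x -> I (s * x) \/ D (s * x).
Hypothesis ID_mulr : forall s x, D x -> I (x * s) \/ D (x * s).
Hypothesis DnI : forall x, D x -> ~ I x.
Variables (n m : nat) (x : 'I_n -> S) (y : 'I_m -> S).
Hypothesis coord : coordinates D H x y.

Variables (B G : presentation) (vB : letter B -> S) (vG : letter G -> S).
Hypothesis vBE : forall u w, u <> [::] -> w <> [::] -> value vB u = value vB w <-> connected u w.
Hypothesis vBI : value vB @` Aplus (letter B) = I.
Hypothesis vGE : forall u w, u <> [::] -> w <> [::] -> value vG u = value vG w <-> connected u w.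
Hypothesis vGH : value vG @` Aplus (letter G) = H.

(** ** The presentation *)

Definition layer_letter : Type := letter B + (letter G + ('I_n + 'I_m)).
Local Notation Z := layer_letter.
Definition lB (b : letter B) : Z := inl b.
Definition lG (c : letter G) : Z := inr (inl c).
Definition lX (i : 'I_n) : Z := inr (inr (inl i)).
Definition lY (k : 'I_m) : Z := inr (inr (inr k)).

Definition vZ (a : Z) : S := match a with
  | inl b => vB b
  | inr (inl c) => vG c
  | inr (inr (inl i)) => x i
  | inr (inr (inr k)) => y k
  end.

(** Chosen words for the elements: [wB] on the ideal, [wX], [wG] and [wY] for
    the coordinates of an element of the layer, [qG] and [qY] for those of a
    product [y k * s] that stays in the layer. *)
Variables (wB : S -> seq (letter B)) (wX : S -> 'I_n) (wG : S -> seq (letter G)) (wY : S -> 'I_m).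
Variables (qG : S -> seq (letter G)) (qY : S -> 'I_m).
Hypothesis wBP : forall s, I s -> wB s <> [::] /\ value vB (wB s) = s.
Hypothesis wP : forall s, D s -> wG s <> [::] /\ s = x (wX s) * value vG (wG s) * y (wY s).
Hypothesis qP : forall k s, D (y k * s) ->
  qG (y k * s) <> [::] /\ y k * s = value vG (qG (y k * s)) * y (qY (y k * s)).

Definition normal_word i V k : seq Z := lX i :: map lG V ++ [:: lY k].
Definition inD s : bool := if pselect (D s) then true else false.

Definition reduct k (a : Z) : seq Z :=
  let s := y k * vZ a in if inD s then map lG (qG s) ++ [:: lY (qY s)] else map lB (wB s).

Lemma inDP s : reflect (D s) (inD s).
Proof. by rewrite /inD; case: pselect => ?; constructor. Qed.

Let I_letter b : I (vB b).
Proof. by rewrite -vBI; exists [:: b] => //; rewrite value_seq1. Qed.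

Let I_word u : u <> [::] -> I (value vB u).
Proof. by move=> u0; rewrite -vBI; exists u. Qed.

Let H_word V : V <> [::] -> H (value vG V).
Proof. by move=> V0; rewrite -vGH; exists V. Qed.

Let vZB u : value vZ (map lB u) = value vB u.
Proof. by rewrite value_map. Qed.

Let vZG V : value vZ (map lG V) = value vG V.
Proof. by rewrite value_map. Qed.

Let val_normal i V k : value vZ (normal_word i V k) = x i * value vG V * y k.
Proof. by rewrite /normal_word /= value_cat vZG value_seq1 mulgA. Qed.

Let D_normal i V k : V <> [::] -> D (x i * value vG V * y k).
Proof. by move=> /H_word; apply: coord_mem coord _ _ _. Qed.

Let ID_letter a : I (vZ a) \/ D (vZ a).
Proof.
case: a => [b|[c|[i|k]]]; first by left; apply: I_letter.
- by right; apply: (coord_HD coord); rewrite -[vZ _](value_seq1 vG); apply: H_word.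
- by right; apply: (coord_xD coord).
- by right; apply: (coord_yD coord).
Qed.

Let ID_word w : w <> [::] -> I (value vZ w) \/ D (value vZ w).
Proof.
elim: w => // a [|b w] IH _; first by rewrite value_seq1; apply: ID_letter.
rewrite -cat1s value_cat; have [Iw|Dw] := IH ltac:(done); first by left; apply: I_mull.
exact: ID_mull.
Qed.

Let y_not_in k a : ~ D (y k * vZ a) -> I (y k * vZ a).
Proof. by move=> nD; have [//|] := ID_mulr (vZ a) (coord_yD coord k). Qed.

Let reductP k a : reduct k a <> [::] /\ value vZ (reduct k a) = y k * vZ a.
Proof.
rewrite /reduct; case: inDP => [Ds|/y_not_in Is].
  have [q0 qE] := qP Ds; split; first by case: (qG _) q0.
  by rewrite value_cat vZG value_seq1 -qE.
have [w0 wE] := wBP Is; split; last by rewrite vZB.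
by case: (wB _) w0.
Qed.

(** Products with a [B]-letter serve to absorb letters on its right and on its
    left.  The normal word of a letter outside [B] is needed at the beginning of a
    word only; afterwards the state ends with some [y k], so that no other
    products than [y k * a] have to be known. *)
Definition layer_rules : set (seq Z * seq Z) :=
  [set (map lB r.1, map lB r.2) | r in @rules B] `|`
  [set (map lG r.1, map lG r.2) | r in @rules G] `|`
  range (fun ba => ([:: lB ba.1; ba.2], map lB (wB (vB ba.1 * vZ ba.2)))) `|`
  range (fun ab => ([:: ab.1; lB ab.2], map lB (wB (vZ ab.1 * vB ab.2)))) `|`
  [set ([:: a], normal_word (wX (vZ a)) (wG (vZ a)) (wY (vZ a))) | a in [set inr a' | a' in setT]] `|`
  range (fun ka => ([:: lY ka.1; ka.2], reduct ka.1 ka.2)).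

Lemma layer_rules_Aplus : layer_rules `<=` Aplus Z `*` Aplus Z.
Proof.
have map0 T T' (f : T -> T') w : w <> [::] -> map f w <> [::] by case: w.
move=> _ [[[[[[r /rules_Aplus[r1 r2] <-]|[r /rules_Aplus[r1 r2] <-]]|
  [ba _ <-]]|[ab _ <-]]|[a _ <-]]|[ka _ <-]].
- by split; apply: map0.
- by split; apply: map0.
- by split=> //; apply: map0; case: (wBP (I_mulr (vZ ba.2) (I_letter ba.1))).
- by split=> //; apply: map0; case: (wBP (I_mull (vZ ab.1) (I_letter ab.2))).
- by [].
- by split=> //; case: (reductP ka.1 ka.2).
Qed.

Definition layer_pres := Presentation layer_rules_Aplus.
Local Notation Q := layer_pres.

Let ruleB r : @rules B r -> @rules Q (map lB r.1, map lB r.2).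
Proof. by move=> rr; do 5 left; exists r. Qed.

Let ruleG r : @rules G r -> @rules Q (map lG r.1, map lG r.2).
Proof. by move=> rr; do 4 left; right; exists r. Qed.

Let rule_right b a : @rules Q ([:: lB b; a], map lB (wB (vB b * vZ a))).
Proof. by do 3 left; right; exists (b, a). Qed.

Let rule_left a b : @rules Q ([:: a; lB b], map lB (wB (vZ a * vB b))).
Proof. by do 2 left; right; exists (a, b). Qed.

Let rule_letter a' (a : Z := inr a') :
  @rules Q ([:: a], normal_word (wX (vZ a)) (wG (vZ a)) (wY (vZ a))).
Proof. by left; right; exists a => //; exists a'. Qed.

Let rule_reduct k a : @rules Q ([:: lY k; a], reduct k a).
Proof. by right; exists (k, a). Qed.

Let D_inr a' : D (vZ (inr a')).
Proof.
case: a' => [c|[i|k]]; [|exact: (coord_xD coord i)|exact: (coord_yD coord k)].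
by apply: (coord_HD coord); rewrite -[vZ _](value_seq1 vG); apply: H_word.
Qed.

Lemma layer_rules_val r : @rules Q r -> value vZ r.1 = value vZ r.2.
Proof.
move=> [[[[[[q rq <-]|[q rq <-]]|[[b a] _ <-]]|[[a b] _ <-]]|[_ [a' _ <-] <-]]|[[k a] _ <-]];
  rewrite [LHS]/= [X in _ = value _ X]/=.
- by rewrite -/(value vZ (map lB _)) !vZB; have [? ?] := rules_Aplus rq;
  apply/vBE => //; apply: connected_rule.
- by rewrite -/(value vZ (map lG _)) !vZG; have [? ?] := rules_Aplus rq;
  apply/vGE => //; apply: connected_rule.
- by rewrite mulg1 vZB; case: (wBP (I_mulr (vZ a) (I_letter b))) => _ ->.
- by rewrite mulg1 vZB; case: (wBP (I_mull (vZ a) (I_letter b))) => _ ->.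
- by rewrite mulg1 val_normal; case: (wP (D_inr a')).
- by rewrite mulg1; case: (reductP k a) => _ ->.
Qed.

Let connected_value_Q u w : @connected Q u w -> value vZ u = value vZ w.
Proof. exact: connected_value layer_rules_val. Qed.

Let pth_val W u p w : pth (P := Q) W u p w -> value vZ u = value vZ w.
Proof. by move=> /pth_any pp; apply: connected_value_Q; exists p. Qed.

(** ** Words containing a letter of the ideal *)

Local Notation Bin := (@Bin B Q lB).
Local Notation Bfirst := (@Bfirst B Q lB).
Local Notation Blast := (@Blast B Q lB).

Let isB (a : Z) := if a is inl _ then true else false.

Let Bin_has w : Bin w -> has isB w.
Proof. by case=> u [b [z ->]]; rewrite has_cat /= orbT. Qed.

Let no_B (f : letter G -> Z) V : (forall c, isB (f c) = false) -> has isB (map f V) = false.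
Proof. by move=> fB; elim: V => //= c V ->; rewrite fB. Qed.

Let Bfirst_map u : u <> [::] -> Bfirst (map lB u).
Proof. by case: u => // b u _; exists b, (map lB u). Qed.

Let Blast_map z u : u <> [::] -> Blast (z ++ map lB u).
Proof.
by case/lastP: u => // u b _; exists (z ++ map lB u), b; rewrite -cats1 map_cat catA.
Qed.

Let lB_connected u w : u <> [::] -> w <> [::] -> @connected Q (map lB u) (map lB w) ->
  @connected B u w.
Proof. by move=> u0 w0 /connected_value_Q; rewrite !vZB => /(vBE u0 w0). Qed.

Let absorbR (b : letter B) (a : letter Q) := wB (vB b * vZ a).
Let absorbL (b : letter B) (a : letter Q) := wB (vZ a * vB b).

Let absorbr_neq0 b a : absorbR b a <> [::].
Proof. by case: (wBP (I_mulr (vZ a) (I_letter b))). Qed.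

Let absorbl_neq0 b a : absorbL b a <> [::].
Proof. by case: (wBP (I_mull (vZ a) (I_letter b))). Qed.

Let absorbr w : Bfirst w -> exists p u, u <> [::] /\ pth (P := Q) Bfirst w p (map lB u).
Proof. exact: (@Bfirst_absorb B Q lB absorbR absorbr_neq0 rule_right). Qed.

Let absorbl w : Blast w -> exists p u, u <> [::] /\ pth (P := Q) Blast w p (map lB u).
Proof. exact: (@Blast_absorb B Q lB absorbL absorbl_neq0 (fun b a => rule_left a b)). Qed.

(* By regularity [s = s * (t * s * t) * s] with [t * s * t] in the ideal. *)
Let split_word u : u <> [::] ->
  exists u1 u2, [/\ u1 <> [::], u2 <> [::] & @connected B u (u1 ++ u2)].
Proof.
move=> u0; have Iu := I_word u0; have [t tE] := S_regular (value vB u).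
have [w0 wE] := wBP (I_mull t (I_mulr t Iu)).
exists u, (wB (t * (value vB u * t)) ++ u); split=> //; first by case: (wB _) w0.
apply/vBE => //; first by case: (u) u0.
by rewrite !value_cat wE !mulgA tE tE.
Qed.

Let rule_ends r : @rules Q r -> Bin r.1 -> Bin r.2 ->
  (Bfirst r.1 /\ Bfirst r.2) \/ (Blast r.1 /\ Blast r.2).
Proof.
move=> [[[[[[q rq <-]|[q rq <-]]|[[b a] _ <-]]|[[a b] _ <-]]|[_ [a' _ <-] <-]]|[[k a] _ <-]] /=.
- by have [? ?] := rules_Aplus rq; left; split; apply: Bfirst_map.
- by move=> /Bin_has; rewrite no_B.
- by left; split; [exists b, [:: a]|apply: Bfirst_map; apply: absorbr_neq0].
- right; split; first by exists [:: a], b.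
  exact: (@Blast_map [::]) (@absorbl_neq0 b a).
- by move=> /Bin_has.
- move=> /Bin_has /=; case: a => // b _; rewrite /reduct; case: inDP => [_|nD].
    by move=> /Bin_has; rewrite has_cat no_B.
  move=> _; right; split; first by exists [:: lY k], b.
  exact: (@Blast_map [::]) (@absorbl_neq0 b (lY k)).
Qed.

Hypothesis finB : finite_presentation B.
Hypothesis finG : finite_presentation G.
Hypothesis fdtB : presentation_fdt B.
Hypothesis fdtG : presentation_fdt G.

Lemma layer_finite : finite_presentation Q.
Proof.
have finZ : finite_set [set: Z].
  have : finite_set (range lB `|` range lG `|` range lX `|` range lY).
    rewrite !finite_setU; do !split; apply: finite_image; try exact: finite_finset.
      by case: finB.
    by case: finG.
  apply: sub_finite_set => -[b|[c|[i|k]]] _; [do 3 left|do 2 left; right|left; right|right].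
  - by exists b.
  - by exists c.
  - by exists i.
  - by exists k.
have [finBl finBr] := finB; have [finGl finGr] := finG.
have finX T T' : finite_set [set: T] -> finite_set [set: T'] -> finite_set [set: T * T'].
  by move=> fT fT'; have := finite_setX fT fT'; apply: sub_finite_set.
split=> //; rewrite /= /layer_rules !finite_setU; do !split; apply: finite_image => //.
- exact: finX.
- exact: finX.
- by apply: (sub_finite_set _ finZ).
- by apply: finX => //; exact: finite_finset.
Qed.

Let coherent_data (sim : gpath Z -> gpath Z -> Prop) :=
  [/\ relabel_coherent (P := B) (Q := Q) lB sim,
      relabel_coherent (P := G) (Q := Q) lG sim & coherent (P := Q) sim Bin].

Let coherent_data_forced : finitely_forced (P := Q) coherent_data.
Proof.
have F1 := relabel_fdt ruleB fdtB; have F2 := relabel_fdt ruleG fdtG.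
have F3 := @Bfirst_coherent B Q lB absorbR ruleB lB_connected absorbr_neq0 rule_right finB layer_finite.
have F4 := @Blast_coherent B Q lB absorbL ruleB lB_connected absorbl_neq0
  (fun b a => rule_left a b) finB layer_finite.
apply: finitely_forced_sub
  (finitely_forced_and (finitely_forced_and F1 F2) (finitely_forced_and F3 F4)).
move=> sim simH [[cB cG] [c1 c2]]; split=> //.
exact: (Bin_coherent simH ruleB lB_connected absorbr absorbl split_word cB (c1 cB) (c2 cB) rule_ends).
Qed.

(** ** Scanning words *)

Inductive state := NB of seq (letter B) | ND of 'I_n & seq (letter G) & 'I_m.

(* The paths that absorb a word into a [B]-word are chosen once and for all: the
   scanner has to be a function. *)
Let absR_ex : exists h : seq Z -> seq (edge Z) * seq (letter B), forall w, Bfirst w ->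
  (h w).2 <> [::] /\ pth (P := Q) Bfirst w (h w).1 (map lB (h w).2).
Proof.
have /choice[h hP] : forall w : seq Z, exists h : seq (edge Z) * seq (letter B), Bfirst w ->
    h.2 <> [::] /\ pth (P := Q) Bfirst w h.1 (map lB h.2).
  move=> w; have [/absorbr[p [u [u0 pp]]]|nw] := pselect (Bfirst w); first by exists (p, u).
  by exists ([::], [::]).
by exists h.
Qed.

Let absL_ex : exists h : seq Z -> seq (edge Z) * seq (letter B), forall w, Blast w ->
  (h w).2 <> [::] /\ pth (P := Q) Blast w (h w).1 (map lB (h w).2).
Proof.
have /choice[h hP] : forall w : seq Z, exists h : seq (edge Z) * seq (letter B), Blast w ->
    h.2 <> [::] /\ pth (P := Q) Blast w h.1 (map lB h.2).
  move=> w; have [/absorbl[p [u [u0 pp]]]|nw] := pselect (Blast w); first by exists (p, u).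
  by exists ([::], [::]).
by exists h.
Qed.

Definition absR := projT1 (cid absR_ex).
Definition absL := projT1 (cid absL_ex).

Let absRP w : Bfirst w -> (absR w).2 <> [::] /\
  pth (P := Q) Bfirst w (absR w).1 (map lB (absR w).2).
Proof. exact: projT2 (cid absR_ex) w. Qed.

Let absLP w : Blast w -> (absL w).2 <> [::] /\
  pth (P := Q) Blast w (absL w).1 (map lB (absL w).2).
Proof. exact: projT2 (cid absL_ex) w. Qed.

Definition pre i V : seq Z := lX i :: map lG V.
Arguments pre : simpl never.

Definition state_word N := match N with
  | NB u => map lB u
  | ND i V k => pre i V ++ [:: lY k]
  end.

Definition state_ok N := match N with NB u => u <> [::] | ND _ V _ => V <> [::] end.

Definition state_init (a : Z) := match a with
  | inl b => NB [:: b]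
  | inr a' => let s := vZ (inr a') in ND (wX s) (wG s) (wY s)
  end.

Definition state_initp (a : Z) : seq (edge Z) := match a with
  | inl _ => [::]
  | inr a' => let s := vZ (inr a') in
    [:: Edge [::] ([:: inr a'], normal_word (wX s) (wG s) (wY s)) true [::]]
  end.

Definition dropped k (a : Z) : seq Z := map lB (wB (y k * vZ a)).

Definition state_step N (a : Z) := match N with
  | NB u => NB (absR (map lB u ++ [:: a])).2
  | ND i V k => let s := y k * vZ a in
    if inD s then ND i (V ++ qG s) (qY s) else NB (absL (pre i V ++ dropped k a)).2
  end.

Definition reduct_edge z k (a : Z) : edge Z := Edge z ([:: lY k; a], reduct k a) true [::].

Definition state_stepp N (a : Z) : seq (edge Z) := match N with
  | NB u => (absR (map lB u ++ [:: a])).1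
  | ND i V k => reduct_edge (pre i V) k a ::
    if inD (y k * vZ a) then [::] else (absL (pre i V ++ dropped k a)).1
  end.

Local Notation run := (run (P := Q) state_step).
Local Notation runp := (runp (P := Q) state_step state_stepp).

Definition state_inner N p N' : Prop := match N, N' with
  | NB u, NB u' => @inner B Q lB u p u'
  | ND i V k, ND j V' l => [/\ i = j, k = l &
      exists2 q, @pth G anyword V q V' & p = [:: lX i] >* map (@relabel G Q lG) q *< [:: lY k]]
  | _, _ => False
  end.

Let dropped_neq0 k a : ~~ inD (y k * vZ a) -> wB (y k * vZ a) <> [::].
Proof. by case: inDP => // nD _; case: (wBP (y_not_in nD)). Qed.

Let reduct_edgeP z k a : pth (P := Q) anyword (z ++ [:: lY k; a]) [:: reduct_edge z k a]
  (z ++ reduct k a).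
Proof.
have := @pth_edge Q anyword z _ true [::] (rule_reduct k a) Logic.I Logic.I.
by rewrite !cats0.
Qed.

Let reduct_edge_lact z z' k a : z >* [:: reduct_edge z' k a] = [:: reduct_edge (z ++ z') k a].
Proof. by []. Qed.

Let reductD k a : inD (y k * vZ a) ->
  reduct k a = map lG (qG (y k * vZ a)) ++ [:: lY (qY (y k * vZ a))].
Proof. by rewrite /reduct => ->. Qed.

Let reductI k a : ~~ inD (y k * vZ a) -> reduct k a = dropped k a.
Proof. by rewrite /reduct; case: inD. Qed.

Let pre_cat i V W : pre i (V ++ W) = pre i V ++ map lG W.
Proof. by rewrite /pre map_cat. Qed.

Let first_map z u : u <> [::] -> Bfirst (map lB u ++ z).
Proof. by case: u => // b u _; exists b, (map lB u ++ z). Qed.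

Let stepD i V k a (s := y k * vZ a) : inD s ->
  state_step (ND i V k) a = ND i (V ++ qG s) (qY s) /\
  state_stepp (ND i V k) a = [:: reduct_edge (pre i V) k a].
Proof. by rewrite /state_step /state_stepp => ->. Qed.

Let stepI i V k a : ~~ inD (y k * vZ a) ->
  state_step (ND i V k) a = NB (absL (pre i V ++ dropped k a)).2 /\
  state_stepp (ND i V k) a =
    [:: reduct_edge (pre i V) k a] ++ (absL (pre i V ++ dropped k a)).1.
Proof. by rewrite /state_step /state_stepp => /negbTE ->. Qed.

Let state_word_cat i V W k : state_word (ND i (V ++ W) k) = pre i V ++ map lG W ++ [:: lY k].
Proof. by rewrite /state_word pre_cat -catA. Qed.

Let ok_init a : state_ok (state_init a).
Proof. by case: a => // a'; case: (wP (D_inr a')). Qed.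

Let ok_step N a : state_ok N -> state_ok (state_step N a).
Proof.
case: N => [u|i V k] N0; first by case: (absRP (first_map [:: a] N0)).
have [sD|nD] := boolP (inD (y k * vZ a)).
  by rewrite (stepD i V sD).1 /=; case: (V) N0.
rewrite (stepI i V nD).1.
by case: (absLP (Blast_map (pre i V) (dropped_neq0 nD))).
Qed.

Let initP a : pth (P := Q) anyword [:: a] (state_initp a) (state_word (state_init a)).
Proof.
case: a => // a' /=.
have := @pth_edge Q anyword [::] _ true [::] (rule_letter a') Logic.I Logic.I.
by rewrite !cats0.
Qed.

Let stepP N a : state_ok N ->
  pth (P := Q) anyword (state_word N ++ [:: a]) (state_stepp N a) (state_word (state_step N a)).
Proof.
case: N => [u|i V k] N0.
  by case: (absRP (first_map [:: a] N0)) => _ /pth_any.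
have -> : state_word (ND i V k) ++ [:: a] = pre i V ++ [:: lY k; a] by rewrite /state_word -catA.
have H1 := reduct_edgeP (pre i V) k a.
have [sD|nD] := boolP (inD (y k * vZ a)).
  by rewrite reductD // in H1; rewrite (stepD i V sD).1 (stepD i V sD).2 state_word_cat.
rewrite reductI // in H1; rewrite (stepI i V nD).1 (stepI i V nD).2.
have [_ /pth_any] := absLP (Blast_map (pre i V) (dropped_neq0 nD)).
exact: (pth_cat H1).
Qed.

Let wd_neq0 N : state_ok N -> state_word N <> [::].
Proof. by case: N => [[]|]. Qed.

Let state_inner_ex N N' : state_ok N -> state_ok N' ->
  value vZ (state_word N) = value vZ (state_word N') -> exists p, state_inner N p N'.
Proof.
have vN u : value vZ (state_word (NB u)) = value vB u := vZB u.
have vD i V k : value vZ (state_word (ND i V k)) = x i * value vG V * y k.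
  exact: (val_normal i V k).
case: N N' => [u|i V k] [u'|j V' l] N0 N0'; rewrite ?vN ?vD.
- by move=> /(vBE N0 N0')[p pp]; exists (map (@relabel B Q lB) p), p.
- by move=> E; case: (DnI (D_normal j l N0')); rewrite -E; apply: I_word.
- by move=> E; case: (DnI (D_normal i k N0)); rewrite E; apply: I_word.
move=> /(coord_inj coord (H_word N0) (H_word N0'))[-> /(vGE N0 N0')[p pp] ->].
by eexists; split=> //; exists p.
Qed.

Let state_innerP N p N' : state_inner N p N' ->
  pth (P := Q) anyword (state_word N) p (state_word N').
Proof.
case: N N' => [u|i V k] [u'|j V' l] //; first exact: inner_pth.
case=> <- <- [q qp ->]; rewrite -lract.
exact: (@pthr Q [:: lY k] _ _ _ _ (@pthl Q [:: lX i] _ _ _ _ (relabel_pth ruleG qp))).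
Qed.

(** The action of [z] on a state with last letter [lY k] depends on the other
    letters of that state only up to paths between words with a letter of the
    ideal: either [lY k :: z] becomes a group word followed by some [lY l], or
    it becomes a word of the ideal, into which the other letters are absorbed. *)
Let stays k z := exists W l t, [/\ z <> [::] -> W <> [::],
  pth (P := Q) anyword (lY k :: z) t (map lG W ++ [:: lY l]) &
  forall i V, run (ND i V k) z = ND i (V ++ W) l /\ runp (ND i V k) z = pre i V >* t].

Let drops k z := exists u t, [/\ u <> [::], pth (P := Q) anyword (lY k :: z) t (map lB u) &
  forall i V, exists u' q, [/\ run (ND i V k) z = NB u', u' <> [::],
    pth (P := Q) Bin (pre i V ++ map lB u) q (map lB u') &
    forall sim, homotopy_relation sim ->
      heq (P := Q) sim (pre i V ++ lY k :: z) (runp (ND i V k) z) (pre i V >* t ++ q)]].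

Let first_in w : Bfirst w -> Bin w.
Proof. by case=> b [z ->]; exists [::], b, z. Qed.

Let last_in w : Blast w -> Bin w.
Proof. by case=> z [b ->]; exists z, b, [::]. Qed.

Let in_lact z w : Bin w -> Bin (z ++ w).
Proof. by case=> a [b [c ->]]; exists (z ++ a), b, c; rewrite catA. Qed.

Let in_ract z w : Bin w -> Bin (w ++ z).
Proof. by case=> a [b [c ->]]; exists a, b, (c ++ z); rewrite -catA. Qed.

(* The path [q] of [drops] is obtained by undoing the absorption of the letters
   between [lY k] and the letter at which the value falls into the ideal, and by
   repeating it with the letters of the state in front. *)
Let scan_layer k z : stays k z \/ drops k z.
Proof.
have runp1 N a : runp N [:: a] = state_stepp N a by rewrite runp_cons ract0 cats0.
elim/last_ind: z => [|z a IH].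
  left; exists [::], k, [::]; split=> // i V.
  by rewrite cats0.
rewrite -cats1; have Dz : lY k :: z ++ [:: a] = (lY k :: z) ++ [:: a] by [].
case: IH => [[W [l [t [W0 tp H1]]]]|[u [t [u0 tp H1]]]]; last first.
  right; have [u20 qp] := absRP (first_map [:: a] u0).
  set q := (absR _).1 in qp; set u2 := (absR _).2 in u20 qp.
  exists u2, (t *< [:: a] ++ q); split=> // [|i V].
    by rewrite Dz; apply: pth_cat (@pthr Q [:: a] _ _ _ _ tp) (pth_any qp).
  have [u' [s [E1 u'0 sp H2]]] := H1 i V.
  have [u3 q'p] := absRP (first_map [:: a] u'0).
  set q' := (absR _).1 in q'p.
  have pq : pth (P := Q) Bin (pre i V ++ map lB u ++ [:: a]) (pre i V >* q) (pre i V ++ map lB u2).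
    by apply: pth_lact qp => w /first_in/in_lact.
  have sq' : pth (P := Q) Bin (pre i V ++ map lB u ++ [:: a]) (s *< [:: a] ++ q')
      (map lB (absR (map lB u' ++ [:: a])).2).
    apply: (@pth_cat Q _ _ _ (map lB u' ++ [:: a])).
      by rewrite catA; apply: pth_ract sp => w; apply: in_ract.
    by apply: pth_sub q'p => w /first_in.
  exists (absR (map lB u' ++ [:: a])).2, (pathinv (pre i V >* q) ++ s *< [:: a] ++ q').
  split=> //.
  - by rewrite run_cat E1.
  - exact: pth_cat (pth_inv pq) sq'.
  move=> sim simH; rewrite runp_cat E1 runp1 Dz.
  have tp' := @pthr Q [:: a] _ _ _ _ (@pthl Q (pre i V) _ _ _ _ tp).
  have rp := pth_any (pth_cat (pth_inv pq) sq').
  apply: (@heq_trans _ _ simH _ ((pre i V >* t ++ s) *< [:: a] ++ q')).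
    rewrite catA; have H3 := heq_ract simH [:: a] (H2 sim simH).
    have [v [p1 p2]] := heq_pth simH H3.
    apply: (heq_catr simH H3 p1).
    have p2' : pth (P := Q) anyword ((pre i V ++ lY k :: z) ++ [:: a])
        ((pre i V >* t ++ s) *< [:: a]) (map lB u' ++ [:: a]).
      by rewrite ract_cat; apply: pth_cat tp' (@pthr Q [:: a] _ _ _ _ sp).
    have -> : v = map lB u' ++ [:: a].
      by have [_ <-] := pth_is_path p2; have [_ <-] := pth_is_path p2'.
    exact: pth_any q'p.
  rewrite ract_cat !lact_cat -!catA -lract catA; apply: (heq_catl simH tp').
  rewrite -catA; apply: heq_sym => //.
  exact: (heq_Kinv simH pq sq').
have KWa : map lG W ++ [:: lY l; a] = (map lG W ++ [:: lY l]) ++ [:: a] by rewrite -catA.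
have ep := reduct_edgeP (map lG W) l a; rewrite KWa in ep.
have tep : pth (P := Q) anyword (lY k :: z ++ [:: a]) (t *< [:: a] ++ [:: reduct_edge (map lG W) l a])
    (map lG W ++ reduct l a) by rewrite Dz; apply: pth_cat (@pthr Q [:: a] _ _ _ _ tp) ep.
case: (boolP (inD (y l * vZ a))) => [sD|nD].
  have [q0 _] := qP (elimT (inDP _) sD).
  left; exists (W ++ qG (y l * vZ a)), (qY (y l * vZ a)), (t *< [:: a] ++ [:: reduct_edge (map lG W) l a]).
  split=> [_|//|i V]; first by case: (W).
    by rewrite map_cat -catA -reductD.
  have [E1 E2] := H1 i V.
  rewrite run_cat runp_cat E1 E2 runp1 (stepD i (V ++ W) sD).2 catA; split.
    exact: (stepD i (V ++ W) sD).1.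
  by rewrite lact_cat lract reduct_edge_lact pre_cat.
right; have [u0 qp] := absLP (Blast_map (map lG W) (dropped_neq0 nD)).
rewrite reductI // in tep.
set q := (absL _).1 in qp; set u := (absL _).2 in u0 qp.
exists u, ((t *< [:: a] ++ [:: reduct_edge (map lG W) l a]) ++ q); split=> // [|i V].
  exact: pth_cat tep (pth_any qp).
have [E1 E2] := H1 i V.
have [u'0 q'p] := absLP (Blast_map (pre i (V ++ W)) (dropped_neq0 nD)).
have pq : pth (P := Q) Bin (pre i V ++ map lG W ++ dropped l a) (pre i V >* q) (pre i V ++ map lB u).
  by apply: pth_lact qp => w /last_in/in_lact.
have q'p' : pth (P := Q) Bin (pre i V ++ map lG W ++ dropped l a)
    (absL (pre i (V ++ W) ++ dropped l a)).1 (map lB (absL (pre i (V ++ W) ++ dropped l a)).2).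
  by rewrite [X in pth _ X]catA -pre_cat; apply: pth_sub q'p => w /last_in.
exists (absL (pre i (V ++ W) ++ dropped l a)).2,
  (pathinv (pre i V >* q) ++ (absL (pre i (V ++ W) ++ dropped l a)).1); split=> //.
- by rewrite run_cat E1; exact: (stepI i (V ++ W) nD).1.
- exact: pth_cat (pth_inv pq) q'p'.
move=> sim simH; rewrite runp_cat E1 E2 runp1 (stepI i (V ++ W) nD).2.
have -> : (pre i V >* t) *< [:: a] ++ [:: reduct_edge (pre i (V ++ W)) l a] ++
    (absL (pre i (V ++ W) ++ dropped l a)).1 =
    (pre i V >* (t *< [:: a] ++ [:: reduct_edge (map lG W) l a])) ++
    (absL (pre i (V ++ W) ++ dropped l a)).1.
  by rewrite lact_cat -catA lract reduct_edge_lact pre_cat.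
rewrite [in X in heq _ _ _ X]lact_cat -catA; apply: (heq_catl simH (@pthl Q (pre i V) _ _ _ _ tep)).
apply: heq_sym => //; exact: (heq_Kinv simH pq q'p').
Qed.

Let run_NB u z : u <> [::] -> exists u', [/\ run (NB u) z = NB u', u' <> [::] &
  pth (P := Q) Bin (map lB u ++ z) (runp (NB u) z) (map lB u')].
Proof.
elim: z u => [|a z IH] u u0.
  exists u; split=> //; rewrite cats0; split=> //; first exact: first_in (Bfirst_map u0).
  by case: (u) u0.
have [u1 pp] := absRP (first_map [:: a] u0); have [u' [E u'0 qp]] := IH _ u1.
exists u'; split=> //; rewrite runp_cons -cat1s catA; apply: (@pth_cat Q) qp.
by apply: (@pth_ract Q Bfirst _ _ _ _ z _ pp) => w /first_in/in_ract.
Qed.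

Let inner_Bin u p w : @inner B Q lB u p w -> pth (P := Q) Bin (map lB u) p (map lB w).
Proof.
move=> /(inner_first ruleB [::]); rewrite !cats0 ract0.
by apply: pth_sub => z /first_in.
Qed.

(** One homotopy for each relation and each [lY k]: applying the relation after
    [lY k] commutes with scanning.  The letters in front of [lY k] act on the
    left of this homotopy. *)
Let rule_homotopy k r b sim := forall i V, V <> [::] ->
  exists2 q, state_inner (run (ND i V k) (rule_side r b)) q
                         (run (ND i V k) (rule_side r (~~ b))) &
    heq (P := Q) sim (state_word (ND i V k) ++ rule_side r b)
      (Edge (state_word (ND i V k)) r b [::] :: runp (ND i V k) (rule_side r (~~ b)))
      (runp (ND i V k) (rule_side r b) ++ q).

Let rule_homotopy_forced : finitely_forced (P := Q) (fun sim =>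
  forall k, [set: 'I_m] k -> forall r, @rules Q r -> forall b, [set: bool] b ->
  coherent_data sim -> rule_homotopy k r b sim).
Proof.
apply: finitely_forced_all => [|k _]; first exact: finite_finset.
apply: finitely_forced_all => [|r rr]; first by case: layer_finite.
apply: finitely_forced_all => [|b _]; first exact: finite_finset.
have r0 c : rule_side r c <> [::] := @rule_side_neq0 Q r c rr.
pose E := [:: Edge [:: lY k] r b [::]].
have Ep : pth (P := Q) anyword (lY k :: rule_side r b) E (lY k :: rule_side r (~~ b)).
  by have := @pth_edge Q anyword [:: lY k] _ b [::] rr Logic.I Logic.I; rewrite !cats0.
have valKY W l : value vZ (map lG W ++ [:: lY l]) = value vG W * y l.
  by rewrite value_cat value_seq1 vZG.
have valE := pth_val Ep.
have wE c i V : state_word (ND i V k) ++ rule_side r c = pre i V ++ lY k :: rule_side r c.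
  by rewrite /state_word -catA.
have [[W [l [t [W0 tp H1]]]]|[u [t [u0 tp H1]]]] := scan_layer k (rule_side r b);
have [[W' [l' [t' [W0' tp' H1']]]]|[u' [t' [u0' tp' H1']]]] := scan_layer k (rule_side r (~~ b)).
- have {W0}W0 := W0 (r0 _); have {W0'}W0' := W0' (r0 _).
  have := valE; rewrite (pth_val tp) (pth_val tp') !valKY.
  move=> /(coord_hy_inj coord (H_word W0) (H_word W0'))[/(vGE W0 W0')[q qp] ll'].
  subst l'; pose q' := map (@relabel G Q lG) q.
  have q'p : pth (P := Q) anyword (map lG W ++ [:: lY l]) (q' *< [:: lY l]) (map lG W' ++ [:: lY l]).
    exact: (@pthr Q _ _ _ _ _ (relabel_pth ruleG qp)).
  apply: finitely_forced_sub (finitely_forced_heq (pth_cat Ep tp') (pth_cat tp q'p)).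
  move=> sim simH F _ i V V0; have [E1 E2] := H1 i V; have [E1' E2'] := H1' i V.
  exists (pre i V >* q' *< [:: lY l]).
    rewrite E1 E1'; split=> //; exists (V >* q); first exact: pthl qp.
    by rewrite relabel_lact /pre -cat1s lactM -!lract.
  rewrite E2 E2' wE -lact_cat; have := heq_lact simH (pre i V) F.
  by rewrite (lact_cat _ E).
- have := valE; rewrite (pth_val tp) (pth_val tp') valKY vZB => E0.
  case: (DnI (coord_hyD coord l (H_word (W0 (r0 _))))); rewrite E0; exact: I_word.
- have := valE; rewrite (pth_val tp) (pth_val tp') valKY vZB => E0.
  case: (DnI (coord_hyD coord l' (H_word (W0' (r0 _))))); rewrite -E0; exact: I_word.
have [q qp] : @connected B u u'.
  by apply/vBE => //; rewrite -!vZB -(pth_val tp) -(pth_val tp').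
have qI : @inner B Q lB u (map (@relabel B Q lB) q) u' by exists q.
move: (map _ q) qI => q' qI; have q'p := inner_pth ruleB qI.
apply: finitely_forced_sub (finitely_forced_heq (pth_cat Ep tp') (pth_cat tp q'p)).
move=> sim simH F [_ _ cBin] i V V0.
have [u1 [s [E1 u10 sp F1]]] := H1 i V; have [u1' [s' [E1' u10' sp' F1']]] := H1' i V.
have pEp := @pthl Q (pre i V) _ _ _ _ Ep.
have ptp := @pthl Q (pre i V) _ _ _ _ tp; have ptp' := @pthl Q (pre i V) _ _ _ _ tp'.
have pq' : pth (P := Q) Bin (pre i V ++ map lB u) (pre i V >* q') (pre i V ++ map lB u').
  by apply: pth_lact (inner_Bin qI) => w; apply: in_lact.
have [p pI] : exists p, state_inner (NB u1) p (NB u1').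
  apply: state_inner_ex => //.
  rewrite -[value _ (state_word (NB u1))](pth_val (pth_cat ptp (pth_any sp))).
  by rewrite -[value _ (state_word (NB u1'))](pth_val (pth_cat pEp (pth_cat ptp' (pth_any sp')))).
have pp := inner_Bin pI.
exists p; rewrite ?E1 ?E1' // wE.
rewrite -[Edge _ r b [::] :: _]cat1s.
have -> : [:: Edge (state_word (ND i V k)) r b [::]] = pre i V >* E by [].
apply: (heq_trans simH (heq_catl simH pEp (F1' sim simH))).
apply: (@heq_trans _ _ simH _ ((pre i V >* t ++ s) ++ p)).
  apply: (@heq_trans _ _ simH _ (pre i V >* (t ++ q') ++ s')).
    rewrite catA -lact_cat; apply: (heq_catr simH (heq_lact simH (pre i V) F) _ sp').
    by apply: pthl; apply: pth_cat Ep tp'.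
  rewrite lact_cat -!catA; apply: (heq_catl simH ptp).
  exact: cBin (pth_cat pq' sp') (pth_cat sp pp).
have F1s := heq_sym simH (F1 sim simH).
exact: (heq_catr simH F1s (pth_cat ptp (pth_any sp)) pp).
Qed.

Local Notation anystart := (fun _ : letter Q => True).

Let eval_ex w : w <> [::] -> exists N p, eval (P := Q) state_init state_initp state_step state_stepp w N p.
Proof. by case: w => // a z _; do 2 eexists; split. Qed.

Let evalP w N p : eval (P := Q) state_init state_initp state_step state_stepp w N p ->
  state_ok N /\ pth (P := Q) anyword w p (state_word N).
Proof.
move=> ev; have sw : starting anystart w by case: w ev.
exact: (@pth_eval Q _ state_ok state_word anystart state_init state_initp state_step
  state_stepp wd_neq0 (fun a _ => ok_init a) ok_step (fun a _ => initP a) stepP w N p sw ev).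
Qed.

Let head_homotopy sim := forall r, @rules Q r -> forall b, [set: bool] b ->
  forall N p N' p', eval (P := Q) state_init state_initp state_step state_stepp (rule_side r b) N p ->
  eval (P := Q) state_init state_initp state_step state_stepp (rule_side r (~~ b)) N' p' ->
  exists2 q, state_inner N q N' &
    heq (P := Q) sim (rule_side r b) (Edge [::] r b [::] :: p') (p ++ q).

Let head_homotopy_forced : finitely_forced (P := Q) head_homotopy.
Proof.
apply: finitely_forced_all => [|r rr]; first by case: layer_finite.
apply: finitely_forced_all => [|b _]; first exact: finite_finset.
have r0 c : rule_side r c <> [::] := @rule_side_neq0 Q r c rr.
have [N [p ev]] := eval_ex (r0 b); have [N' [p' ev']] := eval_ex (r0 (~~ b)).
have [okN pp] := evalP ev; have [okN' pp'] := evalP ev'.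
have ep : pth (P := Q) anyword (rule_side r b) [:: Edge [::] r b [::]] (rule_side r (~~ b)).
  by have := @pth_edge Q anyword [::] _ b [::] rr Logic.I Logic.I; rewrite !cats0.
have [|q qI] := state_inner_ex okN okN'.
  by rewrite -(pth_val pp) -(pth_val pp') (pth_val ep).
apply: finitely_forced_sub
  (finitely_forced_heq (pth_cat ep pp') (pth_cat pp (state_innerP qI))) => sim _ F.
move=> M s M' s' /(eval_inj ev)[<- <-] /(eval_inj ev')[<- <-].
by exists q.
Qed.

Lemma layer_fdt : presentation_fdt Q.
Proof.
apply: finitely_forced_fdt; apply: finitely_forced_sub (finitely_forced_and coherent_data_forced
  (finitely_forced_and rule_homotopy_forced head_homotopy_forced)).
move=> sim simH [cd [ruleH headH]]; have [cB cG cBin] := cd.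
suff: coherent (P := Q) sim (starting anystart).
  move=> C u p q w pp qp; have sub z t s : pth (P := Q) anyword z s t ->
      pth (P := Q) (starting anystart) z s t.
    elim: s z => [|a s IH] z /=; first by case=> _; case: z.
    case=> ra <- _ /IH ?; split=> //.
    by case: (esrc a) (@esrc_neq0 Q a ra).
  by apply: C (sub _ _ _ pp) (sub _ _ _ qp).
apply: (@scan_coherent Q sim simH _ state_ok state_word state_inner anystart
  state_init state_initp state_step state_stepp) => //.
- by case=> [u|i V k] N0; [exists [::]|split=> //; exists [::]].
- move=> [u|i V k] p [u'|j V' l] q [u''|j' V'' l'] //=.
    exact: inner_cat.
  move=> [<- <- [p' pp ->]] [<- <- [q' qp ->]]; split=> //.
  by exists (p' ++ q'); [apply: pth_cat pp qp|rewrite map_cat ract_cat lact_cat].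
- move=> [u|i V k] p q [u'|j V' l] //; first exact: inner_coherent.
  move=> [_ _ [p' pp ->]] [_ _ [q' qp ->]]; rewrite -!lract.
  exact: (heq_ract simH [:: lY k] (heq_lact simH [:: lX i] (cG _ _ _ _ pp qp))).
- move=> [u|i V k] p [u'|j V' l] a N0 N0' //.
    move=> pI; have [u1 qp] := absRP (first_map [:: a] N0).
    have [u1' qp'] := absRP (first_map [:: a] N0').
    have pa : pth (P := Q) Bin (map lB u ++ [:: a]) (p *< [:: a]) (map lB u' ++ [:: a]).
      by apply: pth_ract (inner_Bin pI) => w; apply: in_ract.
    have {}qp : pth (P := Q) Bin (map lB u ++ [:: a]) (state_stepp (NB u) a)
        (state_word (state_step (NB u) a)) by apply: pth_sub qp => w /first_in.
    have {}qp' : pth (P := Q) Bin (map lB u' ++ [:: a]) (state_stepp (NB u') a)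
        (state_word (state_step (NB u') a)) by apply: pth_sub qp' => w /first_in.
    have [|q qI] := @state_inner_ex (state_step (NB u) a) (state_step (NB u') a) u1 u1'.
      by rewrite -(pth_val qp) -(pth_val qp') (pth_val pa).
    by exists q => //; apply: cBin (pth_cat pa qp') (pth_cat qp (inner_Bin qI)).
  case=> <- <- [p' pp Dp]; pose p2 := [:: lX i] >* map (@relabel G Q lG) p'.
  have p2p : pth (P := Q) anyword (pre i V) p2 (pre i V').
    exact: (@pthl Q [:: lX i] _ _ _ _ (relabel_pth ruleG pp)).
  have -> : p *< [:: a] = p2 *< [:: lY k; a] by rewrite Dp -lract -ractM.
  have wE X : state_word (ND i X k) ++ [:: a] = pre i X ++ [:: lY k; a] by rewrite /state_word -catA.
  have X := heq_xchg simH p2p (reduct_edgeP [::] k a).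
  rewrite !reduct_edge_lact !cats0 in X.
  have [sD|nD] := boolP (inD (y k * vZ a)).
    rewrite (stepD i V sD).1 (stepD i V sD).2 (stepD i V' sD).1 (stepD i V' sD).2 wE.
    exists (p2 *< reduct k a); last exact: X.
    split=> //; exists (p' *< qG (y k * vZ a)); first exact: pthr pp.
    by rewrite reductD // /p2 relabel_ract ractM !lract.
  rewrite (stepI i V nD).1 (stepI i V nD).2 (stepI i V' nD).1 (stepI i V' nD).2 wE.
  have [u1 qp] := absLP (Blast_map (pre i V) (dropped_neq0 nD)).
  have [u1' qp'] := absLP (Blast_map (pre i V') (dropped_neq0 nD)).
  set q := (absL _).1 in qp *; set u := (absL _).2 in u1 qp *.
  set q' := (absL _).1 in qp' *; set u' := (absL _).2 in u1' qp' *.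
  have pr : pth (P := Q) Bin (pre i V ++ dropped k a) (p2 *< dropped k a) (pre i V' ++ dropped k a).
    by apply: pth_ract p2p => w _; apply/last_in/Blast_map/dropped_neq0.
  have {}qp : pth (P := Q) Bin (pre i V ++ dropped k a) q (map lB u).
    by apply: pth_sub qp => w /last_in.
  have {}qp' : pth (P := Q) Bin (pre i V' ++ dropped k a) q' (map lB u').
    by apply: pth_sub qp' => w /last_in.
  have [|s sI] := @state_inner_ex (NB u) (NB u') u1 u1'.
    by rewrite -[LHS](pth_val qp) -[RHS](pth_val qp') (pth_val pr).
  exists s => //; rewrite reductI // in X.
  have e1 := reduct_edgeP (pre i V) k a; have e2 := reduct_edgeP (pre i V') k a.
  rewrite reductI // in e1 e2.
  apply: (@heq_trans _ _ simH _ (([:: reduct_edge (pre i V) k a] ++ p2 *< dropped k a) ++ q')).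
    rewrite catA; apply: (heq_catr simH X _ qp').
    exact: pth_cat (@pthr Q _ _ _ _ _ p2p) e2.
  rewrite -!catA; apply: (heq_catl simH e1).
  exact: cBin (pth_cat pr qp') (pth_cat qp (inner_Bin sI)).
- move=> [u|i V k] r b N0 rr; last exact: (ruleH k Logic.I r rr b Logic.I cd).
  have [u1 [E1 u10 pp]] := run_NB (rule_side r b) N0.
  have [u1' [E1' u10' pp']] := run_NB (rule_side r (~~ b)) N0.
  have ep : pth (P := Q) Bin (map lB u ++ rule_side r b) [:: Edge (map lB u) r b [::]]
      (map lB u ++ rule_side r (~~ b)).
    have := @pth_edge Q Bin (map lB u) _ b [::] rr; rewrite !cats0.
    by apply; apply: first_in; apply: first_map.
  have [|q qI] := @state_inner_ex (NB u1) (NB u1') u10 u10'.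
    by rewrite -[LHS](pth_val pp) -[RHS](pth_val pp') (pth_val ep).
  exists q; first by rewrite E1 E1'.
  exact: cBin (pth_cat ep pp') (pth_cat pp (inner_Bin qI)).
- by move=> r b N p N' p' rr _ _; apply: headH.
Qed.

Lemma layer_defines : defines Q (I `|` D).
Proof.
apply/definesP; exists vZ; split=> [u w u0 w0|].
  split=> [E|]; last exact: connected_value_Q.
  have [N [p ev]] := eval_ex u0; have [N' [p' ev']] := eval_ex w0.
  have [okN pp] := evalP ev; have [okN' pp'] := evalP ev'.
  have [|q qI] := state_inner_ex okN okN'; first by rewrite -(pth_val pp) -(pth_val pp') E.
  by exists (p ++ q ++ pathinv p'); apply: pth_cat pp (pth_cat (state_innerP qI) (pth_inv pp')).
apply/seteqP; split=> [_ [w w0 <-]|s [Is|Ds]]; first exact: ID_word.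
  have [w0 wE] := wBP Is; exists (map lB (wB s)); last by rewrite vZB.
  by rewrite /Aplus /=; case: (wB s) w0.
have [w0 wE] := wP Ds; exists (normal_word (wX s) (wG s) (wY s)) => //.
by rewrite val_normal -wE.
Qed.

End AddLayer.


(** * Induction over the ideals *)

Section Ideals.
Variable S : monoidType.
Local Open Scope group_scope.
Hypothesis S_regular : regular_semigroup S.
Hypothesis finL : finite_set [set I : set S | left_ideal I].
Hypothesis finR : finite_set [set I : set S | right_ideal I].

Lemma add_layer_fdt (I D : set S) (e : S) :
  (forall s x, I x -> I (s * x)) -> (forall s x, I x -> I (x * s)) ->
  (forall s x, D x -> I (s * x) \/ D (s * x)) -> (forall s x, D x -> I (x * s) \/ D (x * s)) ->
  (forall x, D x -> ~ I x) -> (forall a b, D a -> D b -> exists u v, b = u * a * v) ->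
  e * e = e -> D e -> has_fdt I -> has_fdt [set h : S | greenH h e] -> has_fdt (I `|` D).
Proof.
move=> Il Ir IDl IDr DnI Dconn ee De.
move=> [B [finB /definesP[vB [vBE vBI]] fdtB]] [G [finG /definesP[vG [vGE vGH]] fdtG]].
have [n [m [x [y coord]]]] := layer_coordinates Il Ir IDl IDr DnI Dconn finL finR ee De.
have /choice[wB wBP] : forall s, exists w, I s -> w <> [::] /\ value vB w = s.
  move=> s; have [|nI] := pselect (I s); last by exists [::].
  by rewrite -vBI => -[w w0 <-]; exists w.
have Gword h : greenH h e -> exists V, V <> [::] /\ value vG V = h.
  move=> Hh; have : [set h : S | greenH h e] h by [].
  by rewrite -vGH => -[V V0 <-]; exists V.
have [i0 [g0 [k0 _]]] := coord_surj coord De.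
have /choice[w wP] : forall s, exists w : 'I_n * seq (letter G) * 'I_m,
    D s -> w.1.2 <> [::] /\ s = x w.1.1 * value vG w.1.2 * y w.2.
  move=> s; have [|nD] := pselect (D s); last by exists (i0, [::], k0).
  move=> /(coord_surj coord)[i [g [k [/Gword[V [V0 <-]] ->]]]].
  by exists (i, V, k).
have /choice[q qP] : forall s, exists q : seq (letter G) * 'I_m,
    (exists k z, s = y k * z) /\ D s -> q.1 <> [::] /\ s = value vG q.1 * y q.2.
  move=> s; have [|nD] := pselect ((exists k z, s = y k * z) /\ D s); last by exists ([::], k0).
  move=> [[k [z ->]] /(coord_act coord)[h [l [/Gword[V [V0 <-]] ->]]]].
  by exists (V, l).
have qP' k s : D (y k * s) ->
    (q (y k * s)).1 <> [::] /\ y k * s = value vG (q (y k * s)).1 * y (q (y k * s)).2.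
  by move=> Ds; apply: qP; split=> //; exists k, s.
pose wX s := (w s).1.1; pose wG s := (w s).1.2; pose wY s := (w s).2.
pose qG s := (q s).1; pose qY s := (q s).2.
have wP' s : D s -> wG s <> [::] /\ s = x (wX s) * value vG (wG s) * y (wY s) by apply: wP.
exists (@layer_pres S I D _ Il Ir IDr n m x y coord B G vB vG vBI wB wX wG wY qG qY wBP qP').
split.
- exact: layer_finite.
- exact: layer_defines.
- exact: layer_fdt.
Qed.

(** The induction starts from the empty set rather than from the least ideal. *)
Lemma empty_fdt : has_fdt (set0 : set S).
Proof.
have R0 : (set0 : set (seq void * seq void)) `<=` Aplus void `*` Aplus void by [].
exists (Presentation R0); split.
- by split; [exact: finite_finset|exact: finite_set0].
- by exists (fun=> 1); split=> [[]|[]|] //; apply/seteqP; split=> // _ [[|[]] []].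
apply: finitely_forced_fdt; exists set0; split=> // sim simH _ [|[] //] p q v pp.
by case: (pth_src pp).
Qed.

Local Notation ideal I := ((forall s x, I x -> I (s * x)) /\ (forall s x, I x -> I (x * s))).

Lemma finite_ideals : finite_set [set I : set S | ideal I].
Proof.
apply: (sub_finite_set (B := [set I : set S | left_ideal I] `|` [set set0])).
  move=> I [Il _]; have [->|/set0P I0] := eqVneq I set0; first by right.
  by left; split.
by rewrite finite_setU; split=> //; exact: finite_set1.
Qed.

(** A maximal proper ideal [K] of [I], possibly empty, leaves a layer: for [b]
    in [I] outside [K], the ideal [K] together with the ideal generated by [b] is
    all of [I].  By regularity the layer contains an idempotent. *)
Lemma ideal_fdt (Hfdt : forall H : set S, maximal_subgroup H -> has_fdt H) (I : set S) :
  ideal I -> has_fdt I.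
Proof.
have [N] := (finite_setP _).1 finite_ideals.
rewrite card_eq_sym => /card_set_bijP[g [gfun _ gsurj]].
have gI (i : 'I_N) : ideal (g i) by apply: gfun; exact: ltn_ord.
have gP J : ideal J -> exists i : 'I_N, g i = J.
  by move=> /gsurj[k kN <-]; exists (Ordinal kN).
(* The induction is on the number of ideals strictly below [I]. *)
pose mu (J : set S) := #|[pred i : 'I_N | `[< g i `<` J >]]|.
have mu_lt J K : ideal J -> J `<` K -> (mu J < mu K)%N.
  move=> /gP[i <-] iK; apply: proper_card; apply/properP; split.
    apply/fintype.subsetP => j /asboolW jJ; apply: asboolT.
    split; first by move=> s /jJ.1/iK.1.
    by move=> Kj; apply: iK.2 => s /Kj/jJ.1.
  exists i; first exact: asboolT.
  by apply/negP => /asboolW[_ H]; apply: H.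
have inh (J : set S) : J = set0 \/ exists a, J a.
  have [|nJ] := pselect (exists a, J a); [by right|left].
  by apply/seteqP; split=> // s Js; case: nJ; exists s.
have lt0 J a : J a -> (mu set0 < mu J)%N.
  by move=> Ja; apply: mu_lt; [split|split=> // /(_ a Ja)].
move: {2}(mu I) (leqnn (mu I)) => c; elim: c I => [|c IH] I muI [Il Ir].
  have [E|[a Ia]] := inh I; first by rewrite E; exact: empty_fdt.
  by have := lt0 I a Ia; move: muI; rewrite leqn0 => /eqP ->.
have [E|[a0 Ia0]] := inh I; first by rewrite E; exact: empty_fdt.
have [i0 Ei0] : exists i : 'I_N, g i = set0 by apply: gP; split.
have Pi0 : `[< g i0 `<` I >] by apply/asboolP; rewrite Ei0; split=> // /(_ a0 Ia0).
have [i /asboolP[iI Ii] imax] := @arg_maxnP _ i0 (fun i => `[< g i `<` I >]) (fun i => mu (g i)) Pi0.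
have [Kl Kr] := gI i; set K := g i in iI Ii imax Kl Kr.
have KI : K `<` I by [].
have [a [Ia nKa]] : exists a, I a /\ ~ K a.
  by apply: contrapT => H; apply: Ii => s Is; apply: contrapT => nK; apply: H; exists s.
pose D := [set s | I s /\ ~ K s].
have Dconn b d : D b -> D d -> exists u v, d = u * b * v.
  move=> [Ib nKb] [Id nKd].
  pose J := [set s | K s \/ exists u v, s = u * b * v].
  have Jid : ideal J.
    split=> s z [Kz|[u [v ->]]]; [by left; apply: Kl| |by left; apply: Kr|].
      by right; exists (s * u), v; rewrite !mulgA.
    by right; exists u, (v * s); rewrite !mulgA.
  have [/(_ d Id)[//|//]|nIJ] := pselect (I `<=` J).
  have JI : J `<` I.
    by split=> // s [/iI//|[u [v ->]]]; apply: Ir; apply: Il.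
  have KJ : K `<` J.
    split=> [s Ks|]; first by left.
    by move=> JK; apply/nKb/JK; right; exists 1, 1; rewrite mul1g mulg1.
  have [j Ej] := gP J Jid; have := mu_lt K J (conj Kl Kr) KJ.
  have maxK : (mu (g j) <= mu K)%N by apply: imax; rewrite Ej; apply: asboolT.
  by rewrite ltnNge -Ej maxK.
have [a' aa'] := S_regular a; pose e := a * a'.
have ee : e * e = e by rewrite /e mulgA aa'.
have De : D e by split; [apply: Ir|move=> Ke; apply: nKa; rewrite -aa'; apply: Kr].
have DnK s : D s -> ~ K s by case.
have split_KD s : I s -> K s \/ D s.
  by move=> Is; have [|nK] := pselect (K s); [left|right].
have -> : I = K `|` D.
  by apply/seteqP; split=> s; [move/split_KD|case=> [/iI|[]]].
apply: (add_layer_fdt (e := e)) => //.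
- by move=> s z [Iz _]; apply: split_KD; apply: Il.
- by move=> s z [Iz _]; apply: split_KD; apply: Ir.
- by apply: IH => //; rewrite -ltnS; apply: leq_trans muI; apply: mu_lt.
- by apply: Hfdt; exists e.
Qed.

End Ideals.

Theorem theorem2 (S : monoidType) (S_regular : regular_semigroup S)
    (fin_left : finite_set [set I : set S | left_ideal I])
    (fin_right : finite_set [set I : set S | right_ideal I]) :
  has_fdt [set: S] <-> (forall H : set S, maximal_subgroup H -> has_fdt H).
Proof.
split=> [|Hfdt]; first exact: maximal_subgroup_fdt.
exact: (ideal_fdt S_regular fin_left fin_right Hfdt).
Qed.
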